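(* Let $T$ be an interval exchange transformation satisfying the Keane condition, and suppose that for every $\epsilon>0$ there exist $\xi>0$ and $C$ such that the sequence $a_i=a_i(\xi)$ satisfies (1) $a_i\le i^{4/3}$ for all but finitely many $i$; (2) $\displaystyle\limsup_{N\to\infty}\frac1N\Big(\sum_{i=1}^N\log a_i-\sum_{1\le i\le N,\ a_i<C}\log a_i\Big)<\epsilon$; and (3) $\displaystyle\sum_{k:\,a_k>k^{1/2}}\frac{\log k}{k^{2/3}}<\infty$. Then for any Khinchin sequence $\{r_i\}$ and any $a\in[0,1)$, $$\lim_{N\to\infty}\frac{\sum_{j=1}^N\chi_{B(a,r_j)}(T^jx)}{\sum_{j=1}^N2r_j}=1$$ for (Lebesgue) almost every $x\in[0,1)$.
   Context: Interval exchange transformation (IET): given $(l_1,\dots,l_d)$ with $l_i\ge0$, $\sum l_i=1$, put $I_1=[0,l_1)$, $I_2=[l_1,l_1+l_2)$, ..., $I_d=[l_1+\dots+l_{d-1},1)$; given a permutation $\pi$ of $\{1,\dots,d\}$, the IET $T:[0,1)\to[0,1)$ is $T(x)=x-\sum_{k<j}l_k+\sum_{\pi(k')<\pi(j)}l_{k'}$ for $x\in I_j$. The discontinuities of $T$ are the points of $D=\{\sum_{i=1}^r l_i\}_{r=1}^{d-1}$, and the discontinuities of $T^n$ are the points of $\bigcup_{i=0}^{n-1}T^{-i}D$. $T$ satisfies the Keane condition if the orbits of all its discontinuities are infinite and disjoint. $e_T(n)$ is the minimum distance between two discontinuities of $T^n$ (and $0$ if two discontinuities orbit into each other). For $\xi>0$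 define an increasing sequence inductively by $n_0(\xi)=1$ and $n_{i+1}(\xi)=\min\{2^k>n_i(\xi): k\in\mathbb{N},\ e_T(2\cdot2^k)>\xi/2^k\}$ (it is assumed that these are defined for all $i$), and put $a_i(\xi)=n_i(\xi)/n_{i-1}(\xi)$ for $i\ge1$. A Khinchin sequence is a sequence $\{r_i\}_{i\ge1}$ of real numbers with $ir_i$ non-increasing and $\sum r_i=\infty$. $B(a,r)$ is the ball of radius $r$ about $a$, with $[0,1)$ identified with the circle $\mathbb{R}/\mathbb{Z}$; $\chi_A$ is the indicator of $A$. *)

(* Defs.v *)
From HB Require Import structures.
From mathcomp Require Import all_boot all_order all_algebra perm.
From mathcomp Require Import all_classical all_reals all_analysis.
Set Implicit Arguments.
Unset Strict Implicit.
Unset Printing Implicit Defensive.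
Import Order.TTheory GRing.Theory Num.Theory.
Import numFieldNormedType.Exports.
Local Open Scope classical_set_scope.
Local Open Scope ring_scope.

Definition breakpoint (R : realType) (d : nat) (l : 'I_d -> R) (r : nat) : R :=
  \sum_(k < d | (k < r)%N) l k.

(* Indices run over 0, ..., d-1. *)
Definition iet_interval (R : realType) (d : nat) (l : 'I_d -> R) (j : 'I_d)
    : set R :=
  [set x | breakpoint l j <= x < breakpoint l j.+1].

(* The exchange acts on [0, 1); it is extended to R by the identity.  The      *)
(* index j picked below is unique, zero-length intervals being empty.          *)
Definition iet (R : realType) (d : nat) (l : 'I_d -> R) (pi : 'S_d) (x : R)
    : R :=
  if [pick j | x \in iet_interval l j] is Some j then
    x - \sum_(k < d | (k < j)%N) l k + \sum_(k < d | (pi k < pi j)%N) l k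
  else x.

Definition disc (R : realType) (d : nat) (l : 'I_d -> R) : set R :=
  [set x | exists r : nat, (0 < r < d)%N /\ x = breakpoint l r].

Definition disc_iter (R : realType) (d : nat) (l : 'I_d -> R) (pi : 'S_d)
    (n : nat) : set R :=
  [set x | exists i : nat, (i < n)%N /\ iter i (iet l pi) x \in disc l].

(* For a bijection T this is the full orbit {T^n x : n in Z}. *)
Definition full_orbit (R : realType) (T : R -> R) (x : R) : set R :=
  [set y | exists n : nat, y = iter n T x \/ x = iter n T y].

(* The endpoint 1 lies in [disc l] when the last length is 0; it is then fixed *)
(* by [iet l pi], so that the Keane condition fails.                           *)
Definition keane (R : realType) (d : nat) (l : 'I_d -> R) (pi : 'S_d) : Prop :=
  (forall p, disc l p -> infinite_set (full_orbit (iet l pi) p)) /\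
  (forall p q, disc l p -> disc l q -> p <> q ->
     full_orbit (iet l pi) p `&` full_orbit (iet l pi) q = set0).

Definition connected_discs (R : realType) (d : nat) (l : 'I_d -> R)
    (pi : 'S_d) : Prop :=
  exists p q : R, [/\ disc l p, disc l q, p <> q &
    exists k : nat, iter k (iet l pi) p = q].

(* The infimum is over a finite set, hence a minimum, except that inf set0 = 0 *)
(* when there are no two discontinuities; for d = 1 this means that no         *)
(* sequence satisfies [is_nseq] below.                                         *)
Definition e_T (R : realType) (d : nat) (l : 'I_d -> R) (pi : 'S_d) (n : nat)
    : R :=
  if `[< connected_discs l pi >] then 0
  else inf [set t | exists p q : R, [/\ disc_iter l pi n p,
              disc_iter l pi n q, p <> q & t = `|p - q|]].

Definition is_min_nat (A : set nat) (m : nat) : Prop :=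
  A m /\ forall m', A m' -> (m <= m')%N.

(* Stating the sequence as a relation includes the assumption that n_i(xi) is  *)
(* defined for all i.                                                          *)
Definition is_nseq (R : realType) (d : nat) (l : 'I_d -> R) (pi : 'S_d)
    (xi : R) (n : nat -> nat) : Prop :=
  n 0%N = 1%N /\
  forall i : nat,
    is_min_nat [set m | exists k : nat, [/\ m = (2 ^ k)%N, (n i < m)%N &
                  xi / 2 ^+ k < e_T l pi (2 * 2 ^ k)]] (n i.+1).

(* Meaningful for i >= 1 only. *)
Definition ratio_seq (R : realType) (n : nat -> nat) (i : nat) : R :=
  (n i)%:R / (n i.-1)%:R.

(* Sequences r_1, r_2, ...; the value at 0 is unused. *)
Definition khinchin_seq (R : realType) (r : nat -> R) : Prop :=
  (forall i j : nat, (1 <= i)%N -> (i <= j)%N -> j%:R * r j <= i%:R * r i) /\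
  (fun N : nat => \sum_(1 <= i < N.+1) r i) @ \oo --> +oo.

Definition circle_ball (R : realType) (a r : R) : set R :=
  [set y | exists m : int, `|y - a - m%:~R| < r].

(* Main.v *)
Require Import Defs.
From HB Require Import structures.
From mathcomp Require Import all_boot all_order all_algebra perm.
From mathcomp Require Import all_classical all_reals all_analysis.
From mathcomp Require Import measurable_realfun zify ring lra.
Set Implicit Arguments.
Unset Strict Implicit.
Unset Printing Implicit Defensive.
Import Order.TTheory GRing.Theory Num.Theory.
Import numFieldNormedType.Exports.
Local Open Scope classical_set_scope.
Local Open Scope ring_scope.

(** The idea is to bound the second moment of the number of visits, using the scales
[n] at which [e_T (2 n) > xi / n] to show that orbits equidistribute in intervals
at an effective rate.

Good scales. At such a scale [n = 4 L] the singularities of the iterate of order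
[2 n] are separated by [xi / n]. Hence orbit segments of length [n] are separated
too ([orbit_separation]), and towers of height [n] over segments of length [xi / n]
fill a definite part of the unit interval. Let [f L] be the centred number of
visits of an orbit segment of length [L] to a fixed interval. If the mean square
of [f L / L] decreased little from the scale [L] to the scale [r L], then [f L] would
be nearly invariant in mean square ([near_invariance]). Averaging over towers turns
this into near constancy along each orbit. Close points have close values, even
when a singularity separates them, as one can compare their pasts; and orbit
segments with different values of [f L] are separated from each other, so that only
boundedly many different values occur. Thus [f L] is almost constant, and it is
small because its integral is zero ([oscillation_bound]). Therefore the mean square
discrepancy contracts by a definite factor at each good scale ([contraction]), and
discrepancies decay exponentially in the number of scales passed, for every single
orbit ([discrepancy_decay]).

Variance. A ball is the union of an interval to the right and one to the left of
its centre; each of these gives a nested sequence of targets. By nestedness, the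
covariances of the [i]-th visit with all later visits add up to the integral of
discrepancies of single orbit segments for the [i]-th target. On short segments
separation bounds these discrepancies from above, and on long ones effective
equidistribution does. This bounds the variance of the number of visits up to [N]
by a multiple of [E_N + sum_(i <= N) u_i], where [E_N = sum_(i <= N) r_i] and [u_i] is
an explicit error ([variance_bound]).

Arithmetic. Equidistribution is used after about [log s] good scales, where [s] is
the index of the scale preceding [i]. As [i r_i] is nonincreasing, [E_i] is at least
of order [s n_s r_(n_s)], and the block of the [i] between two consecutive scales
contributes to [sum u_i / E_i^2] at most of order [a_(s+1) / s^2], plus a power of
[log s] over [s^2] ([sum_error_le]). The growth conditions on the [a_k] make
the sum of the [a_k / k^2] finite ([ratio_sum_bounded]).

Conclusion. By Chebyshev's inequality and summability, the ratio of the number of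
visits to [E_N] tends to 1 almost surely along times at which [E_N] grows
geometrically, and then along all times by monotonicity ([strong_law]). *)

(** * Interval exchanges *)

Section ietBasics.
Context (R : realType) (d : nat).
Implicit Types (l : 'I_d -> R) (pi : 'S_d).

Lemma breakpoint0 l : breakpoint l 0 = 0.
Proof. by rewrite /breakpoint big_pred0. Qed.

Lemma breakpointS l (j : 'I_d) : breakpoint l j.+1 = breakpoint l j + l j.
Proof.
rewrite /breakpoint (bigD1 j) //= addrC; congr (_ + _).
apply: eq_bigl => k; rewrite ltnS ltn_neqAle andbC; congr (_ && _).
Qed.

Lemma breakpoint_total l m : (d <= m)%N -> breakpoint l m = \sum_(i < d) l i.
Proof.
move=> dm; apply: eq_bigl => k; apply/idP; exact: (leq_trans (ltn_ord k) dm).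
Qed.

Lemma breakpoint_mono l m n : (forall i, 0 <= l i) -> (m <= n)%N ->
  breakpoint l m <= breakpoint l n.
Proof.
move=> l0 mn; rewrite /breakpoint [leRHS](bigID (fun k : 'I_d => (k < m)%N)) /=.
rewrite (eq_bigl (fun k : 'I_d => (k < n)%N && (k < m)%N)); last first.
  move=> k; apply/idP/andP => [km|[]//]; split => //; exact: leq_trans mn.
by rewrite lerDl sumr_ge0.
Qed.

Lemma iet_interval_ex l x : \sum_(i < d) l i = 1 -> 0 <= x < 1 ->
  exists j, iet_interval l j x.
Proof.
move=> l1 /andP[x0 x1].
have ex : exists r, x < breakpoint l r by exists d; rewrite breakpoint_total ?l1.
case: (ex_minnP ex) => -[|r] xr rmin; first by rewrite breakpoint0 ltNge x0 in xr.
have rd : (r < d)%N.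
  rewrite ltnNge; apply/negP => dr; suff /rmin : x < breakpoint l d by lia.
  by rewrite breakpoint_total ?l1.
exists (Ordinal rd); rewrite /iet_interval /= xr andbT leNgt; apply/negP => /rmin.
by rewrite ltnn.
Qed.

Lemma iet_interval_uniq l (j k : 'I_d) x : (forall i, 0 <= l i) ->
  iet_interval l j x -> iet_interval l k x -> j = k.
Proof.
move=> l0 /andP[jx xj] /andP[kx xk]; apply/val_inj => /=.
have [jk|kj|//] := ltngtP j k.
- by exfalso; have := breakpoint_mono l0 jk; lra.
- by exfalso; have := breakpoint_mono l0 kj; lra.
Qed.

Lemma iet_interval01 l (j : 'I_d) x : (forall i, 0 <= l i) ->
  \sum_(i < d) l i = 1 -> iet_interval l j x -> 0 <= x < 1.
Proof.
move=> l0 l1 /andP[jx xj]; have := breakpoint_mono l0 (leq0n j).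
have := breakpoint_mono l0 (ltn_ord j).
rewrite breakpoint0 [X in _ <= X]breakpoint_total ?l1 //; lra.
Qed.

(** The intervals of the image partition are laid out from left to right in the
order prescribed by [pi], so that they are the intervals of these lengths. *)
Definition image_lengths l pi : 'I_d -> R := fun k => l ((pi^-1)%g k).

Lemma breakpoint_image l pi (j : 'I_d) :
  breakpoint (image_lengths l pi) (pi j) = \sum_(k < d | (pi k < pi j)%N) l k.
Proof.
rewrite /breakpoint (reindex_inj (@perm_inj _ pi)) /=.
by apply: eq_bigr => k _; rewrite /image_lengths permK.
Qed.

Lemma image_lengths_ge0 l pi : (forall i, 0 <= l i) ->
  forall i, 0 <= image_lengths l pi i.
Proof. by move=> l0 i; exact: l0. Qed.

Lemma image_lengths_sum l pi : \sum_(i < d) image_lengths l pi i = \sum_(i < d) l i.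
Proof.
rewrite (reindex_inj (@perm_inj _ pi)) /=.
by apply: eq_bigr => k _; rewrite /image_lengths permK.
Qed.

Lemma image_lengths_perm l pi j : image_lengths l pi (pi j) = l j.
Proof. by rewrite /image_lengths permK. Qed.

Lemma image_lengthsK l pi : image_lengths (image_lengths l pi) (pi^-1)%g = l.
Proof. by apply/funext => k; rewrite /image_lengths invgK permK. Qed.

Lemma ietE l pi (j : 'I_d) x : (forall i, 0 <= l i) -> iet_interval l j x ->
  iet l pi x = x - breakpoint l j + breakpoint (image_lengths l pi) (pi j).
Proof.
move=> l0 jx; rewrite /iet; case: pickP => [k|nj]; last first.
  by move: (nj j); rewrite /= (mem_set jx).
by rewrite inE => kx; rewrite (iet_interval_uniq l0 kx jx) breakpoint_image.
Qed.

Lemma iet_out l pi x : (forall i, 0 <= l i) -> \sum_(i < d) l i = 1 ->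
  ~~ (0 <= x < 1) -> iet l pi x = x.
Proof.
move=> l0 l1 x01; rewrite /iet; case: pickP => // k; rewrite inE => kx.
by rewrite (iet_interval01 l0 l1 kx) in x01.
Qed.

Lemma iet_image l pi (j : 'I_d) x : (forall i, 0 <= l i) -> iet_interval l j x ->
  iet_interval (image_lengths l pi) (pi j) (iet l pi x).
Proof.
move=> l0 jx; rewrite (ietE pi l0 jx) /iet_interval /= breakpointS.
rewrite image_lengths_perm; move: jx => /andP[]; rewrite breakpointS; lra.
Qed.

Definition iet_inv l pi : R -> R := iet (image_lengths l pi) (pi^-1)%g.

Lemma ietK l pi x : (forall i, 0 <= l i) -> \sum_(i < d) l i = 1 ->
  iet_inv l pi (iet l pi x) = x.
Proof.
move=> l0 l1; have l0' := image_lengths_ge0 pi l0.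
have l1' : \sum_(i < d) image_lengths l pi i = 1 by rewrite image_lengths_sum.
have [x01|x01] := boolP (0 <= x < 1); last first.
  by rewrite (iet_out pi l0 l1 x01) /iet_inv (iet_out _ l0' l1').
have [j jx] := iet_interval_ex l1 x01.
rewrite /iet_inv (ietE _ l0' (iet_image pi l0 jx)) image_lengthsK permK.
rewrite (ietE pi l0 jx); ring.
Qed.

Lemma iet_invK l pi x : (forall i, 0 <= l i) -> \sum_(i < d) l i = 1 ->
  iet l pi (iet_inv l pi x) = x.
Proof.
move=> l0 l1; have := @ietK (image_lengths l pi) (pi^-1)%g x.
rewrite {1}/iet_inv image_lengthsK invgK; apply; first exact: image_lengths_ge0.
by rewrite image_lengths_sum.
Qed.

Lemma iet01 l pi x : (forall i, 0 <= l i) -> \sum_(i < d) l i = 1 ->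
  0 <= x < 1 -> 0 <= iet l pi x < 1.
Proof.
move=> l0 l1 x01; have [j jx] := iet_interval_ex l1 x01.
apply: (iet_interval01 (image_lengths_ge0 pi l0) _ (iet_image pi l0 jx)).
by rewrite image_lengths_sum.
Qed.

Lemma iet_inv01 l pi x : (forall i, 0 <= l i) -> \sum_(i < d) l i = 1 ->
  0 <= x < 1 -> 0 <= iet_inv l pi x < 1.
Proof.
move=> l0 l1; apply: iet01; first exact: image_lengths_ge0.
by rewrite image_lengths_sum.
Qed.

Lemma iet_translation l pi x y : (forall i, 0 <= l i) -> \sum_(i < d) l i = 1 ->
  0 <= x -> x <= y -> y < 1 -> (forall p, disc l p -> ~~ (x < p <= y)) ->
  iet l pi y - iet l pi x = y - x.
Proof.
move=> l0 l1 x0 xy y1 nd.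
have x01 : 0 <= x < 1 by apply/andP; split => //; exact: le_lt_trans xy y1.
have y01 : 0 <= y < 1 by rewrite y1 (le_trans x0 xy).
have [j jx] := iet_interval_ex l1 x01; have [k ky] := iet_interval_ex l1 y01.
suff jk : j = k by rewrite -jk in ky; rewrite (ietE pi l0 jx) (ietE pi l0 ky); ring.
move: (jx) (ky) => /andP[jx1 jx2] /andP[ky1 ky2]; apply/val_inj => /=.
have [jk|kj|//] := ltngtP j k.
- have : disc l (breakpoint l j.+1).
    by exists j.+1; split => //; rewrite ltnS leq0n /=; exact: leq_ltn_trans jk _.
  move=> /nd /negP; rewrite jx2 /= => /negP; rewrite -ltNge => yj.
  by exfalso; have := breakpoint_mono l0 jk; lra.
- by exfalso; have := breakpoint_mono l0 kj; lra.
Qed.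

(** [p1] is the right endpoint of the interval which is sent to the far right,
that is, the last one of positive length in the order prescribed by [pi]. *)
Lemma iet_to_right_end l pi : (forall i, 0 <= l i) -> \sum_(i < d) l i = 1 ->
  exists p1, [/\ disc l p1 \/ p1 = 1, 0 < p1 &
   forall x, 0 <= x < p1 -> (forall p, disc l p -> ~~ (x < p < p1)) ->
     iet l pi x = 1 - (p1 - x)].
Proof.
move=> l0 l1.
have [j0 lj0] : exists j, 0 < l j.
  apply: contrapT => /forallNP nl; have : \sum_(i < d) l i = 0.
    apply: big1 => i _; apply/eqP; rewrite eq_le l0 andbT leNgt; exact/negP.
  by rewrite l1 => /eqP; rewrite oner_eq0.
case: (@arg_maxnP _ j0 (fun j => 0 < l j) (fun j => pi j) lj0) => j lj jmax.
have bj := breakpointS l j.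
exists (breakpoint l j.+1); split.
- have [jd|jd] := ltnP j.+1 d; first by left; exists j.+1; rewrite jd.
  by right; rewrite breakpoint_total // ?l1.
- have := breakpoint_mono l0 (leq0n j); rewrite breakpoint0; lra.
move=> x /andP[x0 xj] nd.
have jx : iet_interval l j x.
  rewrite /iet_interval /= xj andbT; have [j00|jgt0] := posnP j.
    by rewrite j00 breakpoint0.
  have /nd : disc l (breakpoint l j) by exists j; rewrite jgt0 ltn_ord.
  rewrite negb_and -!leNgt => /orP[//|]; lra.
have : breakpoint (image_lengths l pi) (pi j).+1 = 1.
  rewrite -l1 -(image_lengths_sum l pi) /breakpoint [RHS](bigID
    (fun k : 'I_d => (k < (pi j).+1)%N)) /= [X in _ + X]big1 ?addr0 // => k.
  rewrite -leqNgt => pjk; rewrite /image_lengths.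
  apply/eqP; rewrite eq_le l0 andbT leNgt; apply/negP => /jmax.
  by rewrite permKV /=; lia.
rewrite breakpointS image_lengths_perm (ietE pi l0 jx) bj => <-; ring.
Qed.

(** The point sent to 0 is the left endpoint of an interval of the partition. *)
Lemma iet_to_left_end l pi : (forall i, 0 <= l i) -> \sum_(i < d) l i = 1 ->
  exists p0, [/\ disc l p0 \/ p0 = 0, 0 <= p0 < 1 & iet l pi p0 = 0].
Proof.
move=> l0 l1; exists (iet_inv l pi 0).
have x01 : 0 <= iet_inv l pi 0 < 1 by apply: iet_inv01 => //; rewrite lexx ltr01.
have [j jx] := iet_interval_ex l1 x01; split => //; last exact: iet_invK.
have := iet_invK pi 0 l0 l1; have := ietE pi l0 jx; move: (jx).
move: (iet_inv l pi 0) => x /andP[jx1 jx2] -> T0.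
have b0 := breakpoint_mono (image_lengths_ge0 pi l0) (leq0n (pi j)).
rewrite breakpoint0 in b0.
have -> : x = breakpoint l j by lra.
have [->|jgt0] := posnP j; first by right; rewrite breakpoint0.
by left; exists j; rewrite jgt0 ltn_ord.
Qed.

End ietBasics.

(** * Invariance of Lebesgue measure *)

Section translationInvariance.
Context (R : realType).
Notation mu := (@lebesgue_measure R).

Lemma measurable_shift (c : R) : measurable_fun [set: R] (fun x : R => x + c).
Proof. exact: measurable_funD. Qed.

Lemma lebesgue_measure_shift (c : R) (A : set R) : measurable A ->
  mu ((fun x => x + c) @^-1` A) = mu A.
Proof.
move=> mA; have mphi : @measurable_fun _ _ (measurableTypeR R)
  (measurableTypeR R) setT (fun x => x + c) by exact: measurable_shift.
pose F : {mfun measurableTypeR R >-> measurableTypeR R} :=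
  HB.pack (fun x : R => x + c) (isMeasurableFun.Build _ _ _ _ _ mphi).
have -> : mu ((fun x => x + c) @^-1` A) = pushforward mu F A by [].
apply/esym/lebesgue_measure_unique => //= _ [[a b]] /= ab <-.
rewrite /pushforward [X in _ = mu X](_ : _ = `]a - c, b - c]%classic); last first.
  by apply/seteqP; split => x /=; rewrite !in_itv /= ltrBlDr lerBrDr.
by rewrite !lebesgue_measure_itv /= !lte_fin ltrD2r -!EFinB; case: ifP => // _;
  congr EFin; ring.
Qed.

End translationInvariance.

Section ietMeasure.
Context (R : realType) (d : nat).
Notation mu := (@lebesgue_measure R).
Implicit Types (l : 'I_d -> R) (pi : 'S_d).

Lemma iet_intervalE l j :
  iet_interval l j = `[breakpoint l j, breakpoint l j.+1[%classic.
Proof. by apply/seteqP; split => x; rewrite /iet_interval /= in_itv. Qed.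

Lemma measurable_iet_interval l j : measurable (iet_interval l j).
Proof. rewrite iet_intervalE; exact: measurable_itv. Qed.

Lemma measurable_iet l pi : (forall i, 0 <= l i) -> \sum_(i < d) l i = 1 ->
  measurable_fun [set: R] (iet l pi).
Proof.
move=> l0 l1; pose c j := breakpoint (image_lengths l pi) (pi j) - breakpoint l j.
have -> : iet l pi = (fun x => x + \sum_(j < d) c j * \1_(iet_interval l j) x).
  apply/funext => x; have [x01|x01] := boolP (0 <= x < 1).
    have [j jx] := iet_interval_ex l1 x01.
    rewrite (ietE pi l0 jx) (bigD1 j) //= big1 ?addr0 => [|k kj].
      by rewrite indicE (mem_set jx) mulr1 /c; ring.
    rewrite indicE memNset ?mulr0 // => kx.
    by rewrite (iet_interval_uniq l0 kx jx) eqxx in kj.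
  rewrite (iet_out pi l0 l1 x01) big1 ?addr0 // => k _.
  rewrite indicE memNset ?mulr0 // => kx.
  by rewrite (iet_interval01 l0 l1 kx) in x01.
apply: measurable_funD => //; apply: measurable_sum => j.
apply: measurable_funM => //; apply: measurable_indic.
exact: measurable_iet_interval.
Qed.

Lemma lebesgue_measure_pieces l (B : set R) : (forall i, 0 <= l i) ->
  \sum_(i < d) l i = 1 -> measurable B ->
  mu B = (mu (B `\` `[0%R, 1%R[) + \sum_(j < d) mu (B `&` iet_interval l j))%E.
Proof.
move=> l0 l1 mB; rewrite (measureDI mu mB (measurable_itv `[0, 1[)).
congr (_ + _)%E; rewrite -measure_bigsetU_ord; last 2 first.
- by move=> j; apply: measurableI => //; exact: measurable_iet_interval.
- by move=> j k _ _ [x [[_ jx] [_ kx]]]; exact: iet_interval_uniq l0 jx kx.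
congr (mu _); apply/seteqP; split => x.
  move=> [Bx /=]; rewrite in_itv /= => x01; have [j jx] := iet_interval_ex l1 x01.
  by rewrite -bigcup_seq; exists j => //=; exact: mem_index_enum.
rewrite -bigcup_seq => -[j _ [Bx jx]]; split => //=.
by rewrite in_itv /=; exact: iet_interval01 jx.
Qed.

(** The intervals of the two partitions correspond to each other by translations. *)
Lemma iet_measure_preserving l pi (A : set R) : (forall i, 0 <= l i) ->
  \sum_(i < d) l i = 1 -> measurable A -> mu (iet l pi @^-1` A) = mu A.
Proof.
move=> l0 l1 mA; have l0' := image_lengths_ge0 pi l0.
have l1' : \sum_(i < d) image_lengths l pi i = 1 by rewrite image_lengths_sum.
have mT : measurable (iet l pi @^-1` A).
  by rewrite -[X in measurable X]setTI; exact: measurable_iet.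
rewrite (lebesgue_measure_pieces l0 l1 mT) (lebesgue_measure_pieces l0' l1' mA).
congr (_ + _)%E.
  congr (mu _); apply/seteqP; split => x /= [Ax]; rewrite in_itv /= => /negP x01.
    by move: Ax; rewrite (iet_out pi l0 l1 x01) => ?; split => //; exact/negP.
  by rewrite (iet_out pi l0 l1 x01); split => //; exact/negP.
rewrite [RHS](reindex_inj (@perm_inj _ pi)) /=; apply: eq_bigr => j _.
pose c := breakpoint (image_lengths l pi) (pi j) - breakpoint l j.
rewrite -[RHS](lebesgue_measure_shift c); last first.
  by apply: measurableI => //; exact: measurable_iet_interval.
congr (mu _); apply/seteqP; split => x /=.
  move=> [Ax jx]; have := iet_image pi l0 jx; move: Ax.
  by rewrite (ietE pi l0 jx) /c -addrA (addrC (- _)).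
move=> [Ax]; rewrite /iet_interval /= breakpointS image_lengths_perm /c => jx.
have jx' : iet_interval l j x.
  by rewrite /iet_interval /= breakpointS; move: jx; lra.
by split => //; move: Ax; rewrite (ietE pi l0 jx') /c -addrA (addrC (- _)).
Qed.

End ietMeasure.

(** * Integration of bounded functions over the unit interval *)

Section unitIntegral.
Context (R : realType).
Notation mu := (@lebesgue_measure R).
Implicit Types f g : R -> R.

(** Everything integrated below is bounded, so that no integrability condition is
ever at stake. *)
Definition bmeas f := measurable_fun [set: R] f /\ exists M, forall x, `|f x| <= M.

Definition Int f : R := (\int[mu]_(x in `[0, 1[) f x)%R.

Lemma bmeas_cst c : bmeas (fun=> c).
Proof. by split => //; exists `|c|. Qed.

Lemma bmeasD f g : bmeas f -> bmeas g -> bmeas (fun x => f x + g x).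
Proof.
move=> [mf [M fM]] [mg [N gN]]; split; first exact: measurable_funD.
by exists (M + N) => x; rewrite (le_trans (ler_normD _ _)) // lerD.
Qed.

Lemma bmeasM f g : bmeas f -> bmeas g -> bmeas (fun x => f x * g x).
Proof.
move=> [mf [M fM]] [mg [N gN]]; split; first exact: measurable_funM.
by exists (M * N) => x; rewrite normrM ler_pM.
Qed.

Lemma bmeasZ c f : bmeas f -> bmeas (fun x => c * f x).
Proof. by move=> bf; apply: bmeasM => //; exact: bmeas_cst. Qed.

Lemma bmeasN f : bmeas f -> bmeas (fun x => - f x).
Proof.
move=> bf; under eq_fun do rewrite -mulN1r; apply: bmeasM => //; exact: bmeas_cst.
Qed.

Lemma bmeasB f g : bmeas f -> bmeas g -> bmeas (fun x => f x - g x).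
Proof. by move=> bf bg; apply: bmeasD => //; exact: bmeasN. Qed.

Lemma bmeasX f k : bmeas f -> bmeas (fun x => f x ^+ k).
Proof.
move=> bf; elim: k => [|k ih].
  under eq_fun do rewrite expr0; exact: bmeas_cst.
under eq_fun do rewrite exprS; exact: bmeasM.
Qed.

Lemma bmeas_norm f : bmeas f -> bmeas (fun x => `|f x|).
Proof.
move=> [mf [M fM]]; split; first exact: measurableT_comp.
by exists M => x; rewrite normr_id.
Qed.

Lemma bmeas_sum (I : Type) (s : seq I) (P : pred I) (F : I -> R -> R) :
  (forall i, bmeas (F i)) -> bmeas (fun x => \sum_(i <- s | P i) F i x).
Proof.
move=> bF; elim: s => [|i s ih].
  under eq_fun do rewrite big_nil; exact: bmeas_cst.
under eq_fun do rewrite big_cons.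
by case: (P i) => //; exact: bmeasD.
Qed.

Lemma bmeas_indic (A : set R) : measurable A -> bmeas \1_A.
Proof.
move=> mA; split; first exact: measurable_indic.
by exists 1 => x; rewrite indicE; case: (x \in A); rewrite ?normr1 ?normr0.
Qed.

Lemma bmeas_comp f (T : R -> R) : measurable_fun [set: R] T -> bmeas f ->
  bmeas (fun x => f (T x)).
Proof.
by move=> mT [mf [M fM]]; split; [exact: measurableT_comp|exists M => x].
Qed.

Lemma mu_unit : mu `[0%R, 1%R[%classic = 1%E.
Proof. by rewrite lebesgue_measure_itv /= lte_fin ltr01 oppr0 adde0. Qed.

Lemma bmeas_integrable f : bmeas f -> mu.-integrable `[0, 1[ (EFin \o f).
Proof.
move=> [mf [M fM]]; apply: measurable_bounded_integrable => //.
- by rewrite [X in (X < _)%E]mu_unit ltry.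
- exact: measurable_funTS.
- by exists M; split; [exact: num_real|move=> N MN x _; exact: le_trans (fM x) (ltW MN)].
Qed.

Lemma Int_cst c : Int (fun=> c) = c.
Proof. by rewrite /Int Rintegral_cst // [X in fine X]mu_unit mulr1. Qed.

Lemma IntD f g : bmeas f -> bmeas g -> Int (fun x => f x + g x) = Int f + Int g.
Proof. by move=> bf bg; apply: RintegralD => //; exact: bmeas_integrable. Qed.

Lemma IntB f g : bmeas f -> bmeas g -> Int (fun x => f x - g x) = Int f - Int g.
Proof. by move=> bf bg; apply: RintegralB => //; exact: bmeas_integrable. Qed.

Lemma IntZ c f : bmeas f -> Int (fun x => c * f x) = c * Int f.
Proof. by move=> bf; apply: RintegralZl => //; exact: bmeas_integrable. Qed.

Lemma eq_Int f g : (forall x, 0 <= x < 1 -> f x = g x) -> Int f = Int g.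
Proof. by move=> fg; apply: eq_Rintegral => x; rewrite inE /= in_itv; exact: fg. Qed.

Lemma le_Int f g : bmeas f -> bmeas g -> (forall x, 0 <= x < 1 -> f x <= g x) ->
  Int f <= Int g.
Proof.
by move=> bf bg fg; apply: le_Rintegral => //; exact: bmeas_integrable.
Qed.

Lemma Int_ge0 f : (forall x, 0 <= x < 1 -> 0 <= f x) -> 0 <= Int f.
Proof. by move=> f0; apply: Rintegral_ge0 => x /=; rewrite in_itv; exact: f0. Qed.

Lemma Int_sum (I : Type) (s : seq I) (P : pred I) (F : I -> R -> R) :
  (forall i, bmeas (F i)) ->
  Int (fun x => \sum_(i <- s | P i) F i x) = \sum_(i <- s | P i) Int (F i).
Proof.
move=> bF; elim: s => [|i s ih].
  by under eq_Int do rewrite big_nil; rewrite Int_cst big_nil.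
rewrite big_cons; under eq_Int do rewrite big_cons.
by case: (P i) => //; rewrite IntD // ?ih //; exact: bmeas_sum.
Qed.

Lemma Int_indic (A : set R) : measurable A -> Int \1_A = fine (mu (A `&` `[0%R, 1%R[)).
Proof. by move=> mA; rewrite /Int /Rintegral integral_indic. Qed.

Lemma Int_comp f (T : R -> R) : bmeas f -> measurable_fun [set: R] T ->
  (forall A, measurable A -> mu (T @^-1` A) = mu A) ->
  (forall x, (0 <= T x < 1) = (0 <= x < 1)) ->
  Int (fun x => f (T x)) = Int f.
Proof.
move=> bf mT pT T01; rewrite /Int /Rintegral; congr fine.
have mT' : @measurable_fun _ _ (measurableTypeR R) (measurableTypeR R) setT T.
  exact: mT.
pose F : {mfun measurableTypeR R >-> measurableTypeR R} :=
  HB.pack T (isMeasurableFun.Build _ _ _ _ _ mT').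
have pre : F @^-1` `[0, 1[%classic = `[0, 1[%classic.
  by apply/seteqP; split => x /=; rewrite !in_itv /= T01.
transitivity (\int[pushforward mu F]_(x in `[0%R, 1%R[) (f x)%:E)%E; last first.
  by apply: eq_measure_integral => A mA _; exact: pT.
rewrite integral_pushforward //.
- by rewrite pre.
- by apply/measurable_EFinP; case: bf.
- rewrite pre; apply: (@bmeas_integrable (f \o T)); exact: bmeas_comp.
Qed.

End unitIntegral.

(** * Counting separated points *)

Section counting.
Context (R : realType).

(** The indices of the cells of length [e] that contain the points are pairwise
distinct. *)
Lemma separated_card (I : finType) (P : pred I) (y : I -> R) (e al be : R) :
  0 < e -> (forall i, P i -> al <= y i <= be) ->
  (forall i j, P i -> P j -> i != j -> e <= `|y i - y j|) ->
  al <= be -> #|P|%:R <= 1 + (be - al) / e.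
Proof.
move=> e0 yab sep ab; pose K := Num.truncn ((be - al) / e).
pose f (i : I) : 'I_K.+1 := inord (Num.truncn ((y i - al) / e)).
have q0 i : P i -> 0 <= (y i - al) / e.
  by move=> /yab /andP[ay _]; rewrite divr_ge0 ?subr_ge0 // ltW.
have fE i : P i -> f i = Num.truncn ((y i - al) / e) :> nat.
  move=> Pi; rewrite inordK // ltnS; apply: le_truncn.
  by rewrite ler_pM2r ?invr_gt0 // lerD2r; case/andP: (yab i Pi).
have finj : {in P &, injective f}.
  move=> i j Pi Pj fij; apply/eqP/negP => /negP ij.
  have := sep i j Pi Pj ij.
  have := truncn_itv (q0 i Pi); have := truncn_itv (q0 j Pj).
  have -> : Num.truncn ((y i - al) / e) = Num.truncn ((y j - al) / e).
    by rewrite -!fE // fij.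
  rewrite ![_ / e < _]ltr_pdivrMr // ![_ <= _ / e]ler_pdivlMr //.
  move: (Num.truncn _) => N /andP[h1 h2] /andP[h3 h4].
  rewrite -natr1 mulrDl mul1r in h2 h4.
  by rewrite leNgt => /negP; apply; rewrite ltr_norml; apply/andP; split; lra.
have : (#|P| <= K.+1)%N.
  rewrite -(card_in_imset finj) -[X in (_ <= X)%N]card_ord; exact: max_card.
rewrite -(ler_nat R) -natr1 addrC => /le_trans; apply; rewrite lerD2l.
by rewrite truncn_le divr_ge0 ?subr_ge0 // ltW.
Qed.

Lemma separated_visits (y : nat -> R) (k : nat) (A : set R) (e al be : R) :
  0 < e -> A `<=` `[al, be] ->
  (forall i j, (i < j < k)%N -> A (y i) -> A (y j) -> e <= `|y j - y i|) ->
  al <= be -> \sum_(0 <= m < k) \1_A (y m) <= 1 + (be - al) / e.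
Proof.
move=> e0 Aab sep ab; rewrite big_mkord.
apply: le_trans (@separated_card _ [pred m : 'I_k | y m \in A] _ e al be e0 _ _ ab).
- rewrite -sum1_card natr_sum [leRHS]big_mkcond /=; apply: ler_sum => m _.
  by rewrite indicE inE; case: ifP.
- move=> i /=; rewrite inE => /Aab /=; rewrite in_itv; exact.
- move=> i j /=; rewrite !inE => Ai Aj ij.
  have : i != j :> nat by [].
  rewrite neq_ltn => /orP[ij'|ji']; last by apply: sep; rewrite ?ji' /=.
  by rewrite distrC; apply: sep; rewrite ?ij' /=.
Qed.

End counting.

Section finiteSetGaps.
Context (R : realType).

Lemma finite_next (F : set R) (y : R) : finite_set F ->
  (forall p, F p -> p <= y) \/
  exists p, [/\ F p, y < p & forall q, F q -> y < q -> p <= q].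
Proof.
move=> /finite_seqP[s ->]; elim: s => [|a s [ih|[p [ps yp pmin]]]]; first by left.
- have [ay|ya] := leP a y.
    by left=> p /=; rewrite inE => /orP[/eqP ->//|]; exact: ih.
  right; exists a; split=> //=; first by rewrite mem_head.
  move=> q; rewrite inE => /orP[/eqP ->//|/ih]; lra.
- right; have [ya|ay] := ltP y a; last first.
    exists p; split=> //=; first by rewrite inE ps orbT.
    move=> q; rewrite inE => /orP[/eqP ->|]; [lra|exact: pmin].
  exists (Num.min a p); split=> /=.
  + by rewrite minEle; case: ifP => _; rewrite inE ?eqxx ?ps ?orbT.
  + by rewrite lt_min ya.
  + move=> q; rewrite inE => /orP[/eqP ->|qs yq]; first by rewrite ge_min lexx.
    by rewrite ge_min pmin ?orbT.
Qed.

Lemma finite_prev (F : set R) (y : R) : finite_set F ->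
  (forall p, F p -> y < p) \/
  exists p, [/\ F p, p <= y & forall q, F q -> q <= y -> q <= p].
Proof.
move=> /finite_seqP[s ->]; elim: s => [|a s [ih|[p [ps yp pmin]]]]; first by left.
- have [ya|ay] := ltP y a.
    by left=> p /=; rewrite inE => /orP[/eqP ->//|]; exact: ih.
  right; exists a; split=> //=; first by rewrite mem_head.
  move=> q; rewrite inE => /orP[/eqP ->//|/ih]; lra.
- right; have [ay|ya] := leP a y; last first.
    exists p; split=> //=; first by rewrite inE ps orbT.
    move=> q; rewrite inE => /orP[/eqP ->|]; [lra|exact: pmin].
  exists (Num.max a p); split=> /=.
  + by rewrite maxEle; case: ifP => _; rewrite inE ?eqxx ?ps ?orbT.
  + by rewrite ge_max ay.
  + move=> q; rewrite inE => /orP[/eqP ->|qs yq]; first by rewrite le_max lexx.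
    by rewrite le_max pmin ?orbT.
Qed.

End finiteSetGaps.

Lemma injective_iter (X : Type) (f : X -> X) n : injective f ->
  injective (iter n f).
Proof. by move=> finj; elim: n => // n ih x y /finj /ih. Qed.

(** * Piecewise translations and their singularities *)

(** The features of an interval exchange on which the argument rests: [T] and [S]
are inverse to each other and preserve the measure, [T] is a translation between
consecutive points of [D], and [ex_keane] is what remains of the Keane condition.
The endpoints of the unit interval need care, because singularities are compared
as points of the line: [p1] is where the interval ends whose image reaches up
to 1, and [p0] is the preimage of 0. *)
Record exchange (R : realType) (T S : R -> R) (D : set R) : Prop := Exchange {
  exT01 : forall x, 0 <= x < 1 -> 0 <= T x < 1;
  exS01 : forall x, 0 <= x < 1 -> 0 <= S x < 1;
  exTK : forall x, S (T x) = x;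
  exSK : forall x, T (S x) = x;
  exTm : measurable_fun [set: R] T;
  exSm : measurable_fun [set: R] S;
  exTmu : forall A, measurable A -> lebesgue_measure (T @^-1` A) = lebesgue_measure A;
  exD01 : forall p, D p -> 0 <= p < 1;
  exDfin : finite_set D;
  ex_tr : forall x y, 0 <= x -> x <= y -> y < 1 ->
    (forall p, D p -> ~~ (x < p <= y)) -> T y - T x = y - x;
  ex_right : exists p1, [/\ D p1 \/ p1 = 1, 0 < p1 &
    forall x, 0 <= x < p1 -> (forall p, D p -> ~~ (x < p < p1)) ->
      T x = 1 - (p1 - x)];
  ex_left : exists p0, [/\ D p0 \/ p0 = 0, 0 <= p0 < 1 & T p0 = 0];
  ex_keane : forall p q i, D p -> D q -> iter i.+1 T p <> q }.

(** The Keane condition excludes connections: one between distinct discontinuities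
would make two orbits meet, and one from a discontinuity to itself would make
its orbit finite. *)
Lemma exchange_iet (R : realType) (d : nat) (l : 'I_d -> R) (pi : 'S_d) :
  (forall i, 0 <= l i) -> \sum_(i < d) l i = 1 -> keane l pi ->
  exchange (iet l pi) (iet_inv l pi) (disc l).
Proof.
move=> l0 l1 [Kinf Kdis].
have Keane p q i : disc l p -> disc l q -> iter i.+1 (iet l pi) p <> q.
  move=> Dp Dq pq; have [qp|/eqP qp] := eqVneq p q; last first.
    suff : (full_orbit (iet l pi) p `&` full_orbit (iet l pi) q) q.
      by rewrite (Kdis _ _ Dp Dq qp).
    by split; [exists i.+1; left|exists 0%N; left].
  rewrite -{}qp in pq; apply: (Kinf _ Dp).
  have perm m : iter (m * i.+1) (iet l pi) p = p.
    by elim: m => // m ih; rewrite mulSn iterD ih.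
  apply: (@sub_finite_set _ _ ((fun n => iter n (iet l pi) p) @` `I_i.+1)); last first.
    exact: finite_image.
  move=> y [n [->|py]].
    exists (n %% i.+1)%N; first by rewrite /= ltn_mod.
    by rewrite {2}(divn_eq n i.+1) addnC iterD perm.
  have inj : injective (iet l pi) by apply: can_inj (fun x => ietK pi x l0 l1).
  have [m [nm ->]] : exists m, (n <= m)%N /\ y = iter (m - n) (iet l pi) p.
    exists (n * i.+1)%N; split; first by rewrite mulnS leq_addr.
    apply: (injective_iter (n := n) inj); rewrite -[LHS]py -iterD subnKC ?perm //.
    by rewrite mulnS leq_addr.
  exists ((m - n) %% i.+1)%N; first by rewrite /= ltn_mod.
  by rewrite {2}(divn_eq (m - n) i.+1) addnC iterD perm.
split.
- by move=> x; exact: iet01.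
- by move=> x; exact: iet_inv01.
- by move=> x; exact: ietK.
- by move=> x; exact: iet_invK.
- exact: measurable_iet.
- apply: measurable_iet; first exact: image_lengths_ge0.
  by rewrite image_lengths_sum.
- by move=> A; exact: iet_measure_preserving.
- move=> p Dp; have [r [rd pE]] := Dp.
  have := breakpoint_mono l0 (leq0n r); rewrite breakpoint0 -pE => -> /=.
  have := breakpoint_mono l0 (ltnW (proj2 (andP rd))).
  rewrite [X in _ <= X]breakpoint_total // l1 -pE le_eqVlt => /orP[/eqP p1|//].
  exfalso; apply: (Keane p p 0%N Dp Dp) => /=.
  by rewrite p1 iet_out // ltxx andbF.
- apply: (@sub_finite_set _ _ ((fun r => breakpoint l r) @` `I_d)); last first.
    exact: finite_image.
  by move=> p [r [/andP[_ rd] ->]]; exists r.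
- by move=> x y; exact: iet_translation.
- exact: iet_to_right_end.
- exact: iet_to_left_end.
- exact: Keane.
Qed.

(** The discontinuities of the iterate of order [m]. *)
Definition sing (R : realType) (T : R -> R) (D : set R) (m : nat) : set R :=
  [set p | 0 <= p < 1 /\ exists i, (i < m)%N /\ D (iter i T p)].

Definition nosing (R : realType) (T : R -> R) (D : set R) (m : nat) (x y : R) :=
  forall p, sing T D m p -> ~~ (x < p <= y).

Section exchangeTheory.
Context (R : realType) (T S : R -> R) (D : set R) (E : exchange T S D).

Lemma exT_inj : injective T.
Proof. exact: can_inj (exTK E). Qed.

Lemma iterTK n x : iter n S (iter n T x) = x.
Proof. by elim: n x => // n ih x; rewrite iterSr iterS (exTK E) ih. Qed.

Lemma iterSK n x : iter n T (iter n S x) = x.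
Proof. by elim: n x => // n ih x; rewrite iterSr iterS (exSK E) ih. Qed.

Lemma iterT01 n x : 0 <= x < 1 -> 0 <= iter n T x < 1.
Proof. by move=> x01; elim: n => // n ih; rewrite iterS; exact: (exT01 E). Qed.

Lemma iterS01 n x : 0 <= x < 1 -> 0 <= iter n S x < 1.
Proof. by move=> x01; elim: n => // n ih; rewrite iterS; exact: (exS01 E). Qed.

Lemma exT01E x : (0 <= T x < 1) = (0 <= x < 1).
Proof.
apply/idP/idP => [Tx|]; last exact: (exT01 E).
by rewrite -(exTK E x); exact: (exS01 E).
Qed.

Lemma sing_finite m : finite_set (sing T D m).
Proof.
apply: (@sub_finite_set _ _ (\bigcup_(i in `I_m) (iter i S @` D))); last first.
  by apply: bigcup_finite => // i _; apply: finite_image; exact: (exDfin E).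
move=> p [_ [i [im Dp]]]; exists i => //=; exists (iter i T p) => //.
exact: iterTK.
Qed.

Lemma D_sing m p : D p -> (0 < m)%N -> sing T D m p.
Proof. by move=> Dp m0; split; [exact: (exD01 E)|exists 0%N]. Qed.

Lemma sub_sing m k p : sing T D m p -> (m <= k)%N -> sing T D k p.
Proof.
by move=> [p01 [i [im Dp]]] mk; split => //; exists i; split => //; lia.
Qed.

Lemma sing_back m k p : 0 <= p < 1 -> sing T D m (iter k T p) ->
  sing T D (k + m) p.
Proof.
move=> p01 [_ [i [im Dp]]]; split => //; exists (i + k)%N; rewrite iterD.
by split => //; lia.
Qed.

Lemma sub_nosing m k x y x' y' : nosing T D m x y -> (k <= m)%N -> x <= x' ->
  y' <= y -> nosing T D k x' y'.
Proof.
move=> nd km xx yy p /sub_sing /(_ km) /nd; apply: contra => /andP[xp py].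
by rewrite (le_lt_trans xx xp) (le_trans py yy).
Qed.

(** The singularities of an iterate of order [m] are exactly what may prevent
the first [m] iterates from translating a segment. *)
Lemma rigid m x y i : 0 <= x -> x <= y -> y < 1 -> nosing T D m x y ->
  (i <= m)%N -> iter i T y - iter i T x = y - x.
Proof.
move=> x0 xy y1 nd; elim: i y xy y1 nd => // i ih y xy y1 nd im.
rewrite !iterS -(ih y) //; last exact: ltnW.
have x01 : 0 <= x < 1 by apply/andP; split; [|exact: le_lt_trans y1].
have y01 : 0 <= y < 1 by apply/andP; split; [exact: le_trans xy|].
have yx := ih y xy y1 nd (ltnW im).
apply: (ex_tr E).
- by case/andP: (iterT01 i x01).
- lra.
- by case/andP: (iterT01 i y01).
move=> p Dp; apply/negP => /andP[xp py].
pose q := x + (p - iter i T x).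
have xq : x < q by rewrite /q; lra.
have qy : q <= y by rewrite /q; lra.
have := ih q (ltW xq) (le_lt_trans qy y1) (sub_nosing nd (leqnn _) (lexx _) qy) (ltnW im).
rewrite {2}/q => iq.
have : sing T D m q.
  split; first by rewrite (le_trans x0 (ltW xq)) (le_lt_trans qy y1).
  exists i; split => //; suff -> : iter i T q = p by [].
  lra.
by move=> /nd; rewrite xq qy.
Qed.

(** If 0 were fixed, [T] would be the identity up to the first discontinuity [q].
By continuity to the left of the preimage of [q], the points just below it are
sent to points just below [q], which are fixed; by injectivity these are the
same points, so that [q] is its own preimage, which is a connection. *)
Lemma not_fixed0 p : D p -> T 0 <> 0.
Proof.
move=> Dp T0.
have nD0 : ~ D 0 by move=> D0; apply: (ex_keane E (i := 0) D0 D0) => /=.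
have [nq|[q [Dq q0 qmin]]] := finite_next 0 (exDfin E).
  have /andP[p0 _] := exD01 E Dp.
  by apply: nD0; rewrite (_ : 0 = p) //; apply/eqP; rewrite eq_le p0 nq.
have /andP[_ q1] := exD01 E Dq.
have Tid x : 0 <= x < q -> T x = x.
  move=> /andP[x0 xq]; rewrite -[RHS]subr0 -[LHS]subr0 -{1}T0.
  apply: (ex_tr E) => //; first exact: lt_trans q1.
  move=> r Dr; apply/negP => /andP[r0 rx]; have := qmin r Dr r0; lra.
have Sq01 : 0 <= S q < 1 by apply: (exS01 E); rewrite ltW.
have TSq : T (S q) = q by exact: (exSK E).
have nDS : ~ D (S q) by move=> DS; apply: (ex_keane E (i := 0) DS Dq).
have Sq0 : 0 < S q.
  rewrite lt_neqAle (andP Sq01).1 andbT; apply/eqP => Sq; move: TSq.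
  by rewrite -Sq T0; lra.
have [u [u0 uS nu]] : exists u, [/\ 0 <= u, u < S q &
    forall r, D r -> ~~ (u < r <= S q)].
  have [nr|[r [Dr rS rmax]]] := finite_prev (S q) (exDfin E).
    exists 0; split => // r Dr; apply/negP => /andP[_ rS].
    have := nr r Dr; lra.
  exists r; split.
  - by case/andP: (exD01 E Dr).
  - by rewrite lt_neqAle rS andbT; apply/eqP => rSq; apply: nDS; rewrite -rSq.
  - move=> v Dv; apply/negP => /andP[rv vS]; have := rmax v Dv vS; lra.
pose z := Num.max u (S q - q).
have uz : u <= z by rewrite /z le_max lexx.
have qz : S q - q <= z by rewrite /z le_max lexx orbT.
have zS : z < S q by rewrite /z gt_max uS /=; lra.
have Tz : T z = q - (S q - z).
  have : T (S q) - T z = S q - z.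
    apply: (ex_tr E); [lra|exact: ltW|by case/andP: Sq01|].
    move=> r Dr; apply/negP => /andP[zr rS]; have := nu r Dr.
    by rewrite rS (le_lt_trans uz zr).
  rewrite TSq; lra.
have : T z = T (q - (S q - z)).
  rewrite Tz Tid //; apply/andP; split; lra.
move=> /exT_inj zE; have Sqq : S q = q by lra.
by apply: nDS; rewrite Sqq.
Qed.

Lemma preimage0 p : D p -> exists p0, D p0 /\ T p0 = 0.
Proof.
move=> Dp; have [p0 [[Dp0|->] _ T0]] := ex_left E; first by exists p0.
by case: (not_fixed0 Dp).
Qed.

End exchangeTheory.

(** * Separation at a good scale *)

(** Keeping [e] as a parameter, rather than the minimal distance between
singularities, allows the same record to serve for any lower bound. *)
Record good_scale (R : realType) (T : R -> R) (D : set R) (n : nat) (e : R) : Prop :=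
  GoodScale {
  gs_n : (0 < n)%N;
  gs_e : 0 < e;
  gs_D : exists p, D p;
  gs_sep : forall p q, sing T D (2 * n) p -> sing T D (2 * n) q -> p <> q ->
    e <= `|p - q| }.

Section goodScale.
Context (R : realType) (T S : R -> R) (D : set R) (E : exchange T S D).
Context (n : nat) (e : R) (G : good_scale T D n e).

Let n0 := gs_n G.
Let e0 := gs_e G.

Let two_le : (1 + 1 <= 2 * n)%N. Proof. lia. Qed.
Let one_lt : (1 < 2 * n)%N. Proof. exact: two_le. Qed.
Let double_le k : (k <= n)%N -> (k + k <= 2 * n)%N. Proof. lia. Qed.
Let lt_double k : (k <= n)%N -> (k < 2 * n)%N. Proof. lia. Qed.

Let sep_lt p q : sing T D (2 * n) p -> sing T D (2 * n) q -> `|p - q| < e -> p = q.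
Proof.
move=> sp sq pq; apply: contrapT => /(gs_sep G sp sq); lra.
Qed.

Let D_sing2 p : D p -> sing T D (2 * n) p.
Proof. by move=> Dp; apply: (D_sing E Dp); lia. Qed.

(** Pulling a singularity near an endpoint of the unit interval back by one step,
next to the discontinuity whose image is this endpoint, would create two close
singularities. *)
Lemma sing_away_from_0 m p : sing T D m p -> (m < 2 * n)%N -> e <= p.
Proof.
move=> sp mn; have [p0 [Dp0 Tp0]] := preimage0 E (proj2_sig (cid (gs_D G))).
have sp2 : sing T D (2 * n) p by exact: sub_sing sp (ltnW mn).
have [/andP[p_ge0 p1] [i [im Di]]] := sp.
have pgt0 : 0 < p.
  rewrite lt_neqAle p_ge0 andbT; apply/eqP => pE.
  by apply: (ex_keane E (i := i) Dp0 Di); rewrite iterSr Tp0 pE.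
rewrite leNgt; apply/negP => pe.
have /andP[p0_ge0 p0_lt1] := exD01 E Dp0.
have [h|h] := ltP (p0 + p) 1.
  have Tz : T (p0 + p) = p.
    have : T (p0 + p) - T p0 = (p0 + p) - p0.
      apply: (ex_tr E) => //; first by lra.
      move=> q Dq; apply/negP => /andP[pq qp].
      have : q = p0.
        by apply: sep_lt; [exact: D_sing2|exact: D_sing2|rewrite ger0_norm; lra].
      lra.
    rewrite Tp0; lra.
  have : p0 + p = p0.
    apply: sep_lt; last by rewrite ger0_norm; lra.
      apply: (@sub_sing R T D (1 + m)); last exact: mn.
      apply: sing_back => /=; last by rewrite Tz.
      by apply/andP; split; lra.
    exact: D_sing2.
  lra.
have [p1' [Dp1 p1gt0 Hp1]] := ex_right E.
case: Dp1 => [Dp1|p1E]; last first.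
  apply: (ex_keane E (i := 0) Dp0 Dp0) => /=.
  rewrite Hp1 p1E; first by lra.
    by rewrite p0_ge0.
  move=> q Dq; apply/negP => /andP[pq q1].
  have : q = p0.
    by apply: sep_lt; [exact: D_sing2|exact: D_sing2|rewrite ger0_norm; lra].
  lra.
have /andP[_ p1lt1] := exD01 E Dp1.
have [h1|h1] := leP (1 - p0) p1'.
  have Tz : T (p1' - (1 - p0)) = p0.
    rewrite Hp1; [by lra|by apply/andP; split; lra|].
    move=> q Dq; apply/negP => /andP[pq q1].
    have : q = p1'.
      by apply: sep_lt; [exact: D_sing2|exact: D_sing2|rewrite ler0_norm; lra].
    lra.
  have : p1' - (1 - p0) = p1'.
    apply: sep_lt; last by rewrite ler0_norm; lra.
      apply: (@sub_sing R T D (1 + 1)); last exact: two_le.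
      apply: sing_back => /=; first by apply/andP; split; lra.
      by rewrite Tz; exact: (D_sing E).
    exact: D_sing2.
  lra.
have : p1' = p.
  by apply: sep_lt => //; [exact: D_sing2|rewrite ler0_norm; lra].
lra.
Qed.

(** As at the left endpoint, with the interval whose image reaches up to 1 in the
place of the discontinuity sent to 0. *)
Lemma sing_away_from_1 m p : sing T D m p -> (m < 2 * n)%N -> p <= 1 - e.
Proof.
move=> sp mn; have sp2 : sing T D (2 * n) p by exact: sub_sing sp (ltnW mn).
have [/andP[p_ge0 p1] _] := sp.
rewrite leNgt; apply/negP => pe.
have [p1' [Dp1 p1gt0 Hp1]] := ex_right E.
case: Dp1 => [Dp1|p1E]; last first.
  have [q0 Dq0] := gs_D G.
  have [nq|[q [Dq _ qmax]]] := finite_prev 1 (exDfin E).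
    have := nq _ Dq0; have /andP[_] := exD01 E Dq0; lra.
  apply: (ex_keane E (i := 0) Dq Dq) => /=; rewrite Hp1 p1E; first by lra.
    exact: (exD01 E).
  move=> r Dr; apply/negP => /andP[qr r1]; have := qmax r Dr (ltW r1); lra.
have /andP[_ p1lt1] := exD01 E Dp1.
have [h1|h1] := leP (1 - p) p1'.
  have Tz : T (p1' - (1 - p)) = p.
    rewrite Hp1; [by lra|by apply/andP; split; lra|].
    move=> q Dq; apply/negP => /andP[pq q1].
    have : q = p1'.
      by apply: sep_lt; [exact: D_sing2|exact: D_sing2|rewrite ler0_norm; lra].
    lra.
  have : p1' - (1 - p) = p1'.
    apply: sep_lt; last by rewrite ler0_norm; lra.
      apply: (@sub_sing R T D (1 + m)); last exact: mn.
      apply: sing_back => /=; last by rewrite Tz.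
      by apply/andP; split; lra.
    exact: D_sing2.
  lra.
have : e <= p1' by apply: (@sing_away_from_0 1); [exact: (D_sing E)|exact: one_lt].
lra.
Qed.

(** If [T^k] moved a point by less than [e], it would translate by the same amount
the whole segment up to the next singularity [p], and both [p] and its
preimage would be singularities of [T^(2 k)]. *)
Lemma orbit_separation y k : 0 <= y < 1 -> (0 < k <= n)%N ->
  e <= `|iter k T y - y|.
Proof.
move=> /andP[y0 y1] /andP[k0 kn].
have Ty := iterT01 E k (introT andP (conj y0 y1)).
pose de := iter k T y - y; rewrite -/de leNgt; apply/negP.
rewrite ltr_norml => /andP[de1 de2].
have s2 p : sing T D k p -> sing T D (2 * n) p by move=> sp; exact: sub_sing sp (ltnW (lt_double kn)).
have close z p : sing T D k p -> 0 <= z < 1 -> iter k T z = p -> `|z - p| < e -> z = p.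
  move=> sp z01 zp zpe; apply: sep_lt => //; last exact: s2.
  by apply: (@sub_sing R T D (k + k)); [apply: sing_back => //; rewrite zp|exact: double_le].
have kk : k = k.-1.+1 by rewrite prednK.
have [de0|de0|de0] := ltgtP de 0.
- have [np|[p [sp py pmax]]] := finite_prev y (sing_finite E k).
    have rg := rigid E (lexx 0) y0 y1 _ (leqnn k).
    have /rg : nosing T D k 0 y.
      by move=> p sp; apply/negP => /andP[_ py]; have := np p sp; lra.
    have /andP[] := iterT01 E k (introT andP (conj (lexx 0) (ltr01 : 0 < 1 :> R))).
    move: de0; rewrite /de; lra.
  have pe := sing_away_from_1 sp (lt_double kn).
  have [/andP[p0 p1] _] := sp.
  suff Tz : iter k T (p - de) = p.
    have : p - de = p.
      by apply: close => //; [apply/andP; split; lra|rewrite ger0_norm; lra].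
    lra.
  have npy : nosing T D k p y.
    by move=> q sq; apply/negP => /andP[pq qy]; have := pmax q sq qy; lra.
  have [zy|yz] := leP (p - de) y.
    have := rigid E p0 py y1 npy (leqnn k).
    have h : p <= p - de by lra.
    have := rigid E p0 h (le_lt_trans zy y1) (sub_nosing npy (leqnn _) (lexx _) zy) (leqnn k).
    rewrite /de; lra.
  have : iter k T (p - de) - iter k T y = (p - de) - y.
    apply: (rigid E y0 (ltW yz) _ _ (leqnn k)); first by lra.
    move=> q sq; apply/negP => /andP[yq qz].
    have : q = p by apply: sep_lt; [exact: s2|exact: s2|rewrite ger0_norm; lra].
    lra.
  rewrite /de; lra.
- have [np|[p [sp yp pmin]]] := finite_next y (sing_finite E k).
    pose z := Num.max y (1 - de / 2).
    have yz : y <= z by rewrite /z le_max lexx.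
    have z1 : z < 1 by rewrite /z gt_max y1 /=; lra.
    have dz : 1 - de / 2 <= z by rewrite /z le_max lexx orbT.
    have := rigid E y0 yz z1 _ (leqnn k).
    have /[swap]/[apply] : nosing T D k y z.
      by move=> p sp; apply/negP => /andP[yp _]; have := np p sp; lra.
    have /andP[] := iterT01 E k (introT andP (conj (le_trans y0 yz) z1)).
    rewrite /de in de0 dz *; lra.
  have pe := sing_away_from_0 sp (lt_double kn).
  have [/andP[p0 p1] _] := sp.
  suff Tz : iter k T (p - de) = p.
    have : p - de = p.
      by apply: close => //; [apply/andP; split; lra|rewrite ler0_norm; lra].
    lra.
  have [yz|zy] := leP y (p - de).
    have h : p - de < 1 by lra.
    have := rigid E y0 yz h _ (leqnn k).
    have /[swap]/[apply] : nosing T D k y (p - de).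
      move=> q sq; apply/negP => /andP[yq qz]; have := pmin q sq yq; lra.
    rewrite /de; lra.
  have z0 : 0 <= p - de by lra.
  have := rigid E z0 (ltW zy) y1 _ (leqnn k).
  have /[swap]/[apply] : nosing T D k (p - de) y.
    move=> q sq; apply/negP => /andP[zq qy].
    have : q = p by apply: sep_lt; [exact: s2|exact: s2|rewrite ler0_norm; lra].
    lra.
  rewrite /de; lra.
- have [np|[p [sp py pmax]]] := finite_prev y (sing_finite E k).
    have [p0 [Dp0 Tp0]] := preimage0 E (proj2_sig (cid (gs_D G))).
    have rg := rigid E (lexx 0) y0 y1 _ (leqnn k).
    have /rg : nosing T D k 0 y.
      by move=> p sp; apply/negP => /andP[_ py]; have := np p sp; lra.
    move=> Tk0; have {}Tk0 : iter k T 0 = 0 by move: de0 Tk0; rewrite /de; lra.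
    apply: (ex_keane E (i := k.-1) Dp0 Dp0); rewrite -kk.
    by apply: (exT_inj E); rewrite -iterS iterSr Tp0 Tk0.
  have [/andP[p0 p1] [i [ik Di]]] := sp.
  have npy : nosing T D k p y.
    by move=> q sq; apply/negP => /andP[pq qy]; have := pmax q sq qy; lra.
  have Tkp : iter k T p = p.
    by have := rigid E p0 py y1 npy (leqnn k); move: de0; rewrite /de; lra.
  apply: (ex_keane E (i := k.-1) Di Di); rewrite -kk.
  by rewrite -iterD addnC iterD Tkp.
Qed.

End goodScale.

(** * Birkhoff sums of an interval *)

(** Leaving the endpoints free makes the two halves of a ball instances of one
notion. *)
Record target (R : realType) (A : set R) (al be : R) : Prop := Target {
  tg_m : measurable A;
  tg_al : 0 <= al;
  tg_le : al <= be;
  tg_be : be <= 1;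
  tg_sub : A `<=` `[al, be];
  tg_sup : `]al, be[ `<=` A }.

Lemma target_itv (R : realType) (u v : R) : 0 <= u -> u <= v -> v <= 1 ->
  target `[u, v[%classic u v.
Proof.
move=> u0 uv v1; split => //.
  by move=> z /=; rewrite !in_itv /= => /andP[uz /ltW zv]; apply/andP.
by move=> z /=; rewrite !in_itv /= => /andP[/ltW uz zv]; apply/andP.
Qed.

(** Centred when [a] is the length of [A]. *)
Definition birk (R : realType) (T : R -> R) (A : set R) (a : R) (L : nat) (x : R) : R :=
  \sum_(0 <= i < L) (\1_A (iter i T x) - a).

Lemma sum_nat_sub (R : realType) (F : nat -> R) a b c d : (forall i, 0 <= F i) ->
  (a <= b)%N -> (c <= d)%N -> \sum_(b <= i < c) F i <= \sum_(a <= i < d) F i.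
Proof.
move=> F0 ab cd; have [bc|cb] := leqP b c; last first.
  by rewrite big_geq ?sumr_ge0 // ltnW.
rewrite (big_cat_nat (n := b) ab) ?(leq_trans bc cd) //=.
rewrite [X in _ <= _ + X](big_cat_nat (n := c) bc) //=.
by rewrite addrCA lerDl addr_ge0 ?sumr_ge0.
Qed.

Lemma sum_nat_below (R : realType) (F : nat -> R) a b c :
  (forall i, (a <= i)%N -> 0 <= F i) ->
  \sum_(a <= i < b) (if (i < c)%N then F i else 0) <= \sum_(a <= i < c) F i.
Proof.
move=> F0; have [ca|ac] := leqP c a.
  rewrite [leRHS]big_geq // big1_seq // => i; rewrite mem_index_iota => /andP[_ /andP[ai _]].
  by rewrite ltnNge (leq_trans ca ai).
have [bc|cb] := leqP b c.
  rewrite -[leLHS]addr0; have [ba|ab] := leqP b a.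
    by rewrite big_geq // addr0 big_nat_cond; apply: sumr_ge0 => i /andP[/andP[ai _] _]; exact: F0.
  rewrite [leRHS](big_cat_nat (n := b)) ?(ltnW ab) //=; apply: lerD.
    by apply: ler_sum_nat => i /andP[_ ib]; rewrite (leq_trans ib).
  by rewrite big_nat_cond; apply: sumr_ge0 => i /andP[/andP[bi _] _]; apply/F0/(leq_trans (ltnW ab)).
rewrite (big_cat_nat (n := c)) ?(ltnW ac) ?(ltnW cb) //= [X in _ + X]big1_seq ?addr0 => [|i].
  by apply: ler_sum_nat => i /andP[_ ->].
by rewrite mem_index_iota => /andP[_ /andP[h _]]; rewrite ltnNge h.
Qed.

Lemma sum_nat_shift (R : realType) (F : nat -> R) a b i :
  \sum_(a <= j < b) F (j + i)%N = \sum_(a + i <= j < b + i) F j.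
Proof. by rewrite big_addn addnK. Qed.

(** The difference of the two sides is half the sum of all [(F i - F j) ^+ 2]. *)
Lemma sqr_sum_le (R : realType) (I : finType) (F : I -> R) :
  (\sum_i F i) ^+ 2 <= #|I|%:R * \sum_i F i ^+ 2.
Proof.
have h : 0 <= \sum_i \sum_j (F i - F j) ^+ 2.
  by apply: sumr_ge0 => i _; apply: sumr_ge0 => j _; exact: sqr_ge0.
have E : \sum_i \sum_j (F i - F j) ^+ 2 =
    2 * (#|I|%:R * \sum_i F i ^+ 2) - 2 * (\sum_i F i) ^+ 2.
  transitivity (\sum_i (#|I|%:R * F i ^+ 2 + \sum_j F j ^+ 2
      - 2 * F i * \sum_j F j)).
    apply: eq_bigr => i _; rewrite mulr_sumr.
    have -> : #|I|%:R * F i ^+ 2 = \sum_(j : I) F i ^+ 2.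
      by rewrite sumr_const mulr_natl.
    rewrite -big_split -sumrB /=; apply: eq_bigr => j _; ring.
  rewrite sumrB big_split /= -mulr_sumr -mulr_suml -mulr_sumr.
  rewrite sumr_const -mulr_natl expr2; ring.
rewrite E in h; lra.
Qed.

Lemma sqr_sum_nat_le (R : realType) (F : nat -> R) N :
  (\sum_(0 <= i < N) F i) ^+ 2 <= N%:R * \sum_(0 <= i < N) F i ^+ 2.
Proof. by rewrite !big_mkord; have := sqr_sum_le (fun i : 'I_N => F i); rewrite card_ord. Qed.

Section birkhoffSums.
Context (R : realType) (T S : R -> R) (D : set R) (E : exchange T S D).
Context (A : set R) (al be : R) (tA : target A al be).

Local Notation f := (birk T A (be - al)).

Lemma bmeas_iter g j : bmeas g -> bmeas (fun x => g (iter j T x)).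
Proof.
move=> bg; elim: j => // j ih; under eq_fun do rewrite iterSr.
exact: (bmeas_comp (exTm E) ih).
Qed.

Lemma bmeas_iterS g j : bmeas g -> bmeas (fun x => g (iter j S x)).
Proof.
move=> bg; elim: j => // j ih; under eq_fun do rewrite iterSr.
exact: (bmeas_comp (exSm E) ih).
Qed.

Lemma Int_iter g j : bmeas g -> Int (fun x => g (iter j T x)) = Int g.
Proof.
move=> bg; elim: j => // j ih; under eq_Int do rewrite iterSr.
rewrite (Int_comp (f := fun x => g (iter j T x))) //; [exact: bmeas_iter|exact: (exTm E)|exact: (exTmu E)|exact: (exT01E E)].
Qed.

Lemma bmeas_birk L : bmeas (f L).
Proof.
apply: bmeas_sum => i; apply: bmeasB; last exact: bmeas_cst.
by apply: (bmeas_iter (g := \1_A)); apply: bmeas_indic; exact: (tg_m tA).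
Qed.

Lemma Int_target : Int \1_A = be - al.
Proof.
have mA := tg_m tA; have [[al0 albe] be1] := (tg_al tA, tg_le tA, tg_be tA).
suff muA : lebesgue_measure (A `&` `[0%R, 1%R[) = (be - al)%:E.
  by rewrite Int_indic // [X in fine X]muA.
apply/eqP; rewrite eq_le; apply/andP; split.
  have -> : (be - al)%:E = lebesgue_measure `[al, be]%classic.
    rewrite lebesgue_measure_itv /= lte_fin; case: ltP => // ?.
    by congr EFin; lra.
  apply: le_measure; rewrite ?inE //; first exact: measurableI.
  by move=> x [/(tg_sub tA)].
have -> : (be - al)%:E = lebesgue_measure `]al, be[%classic.
  rewrite lebesgue_measure_itv /= lte_fin; case: ltP => // ?.
  by congr EFin; lra.
apply: le_measure; rewrite ?inE //; first exact: measurableI.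
move=> x xab; split; first exact: (tg_sup tA).
by move: xab; rewrite /= !in_itv /= => /andP[h1 h2]; apply/andP; split; lra.
Qed.

Lemma Int_birk L : Int (f L) = 0.
Proof.
have bA : bmeas \1_A by apply: bmeas_indic; exact: (tg_m tA).
rewrite /birk Int_sum; last first.
  by move=> i; apply: bmeasB; [exact: (bmeas_iter (g := \1_A))|exact: bmeas_cst].
apply: big1 => i _; rewrite IntB; last 2 first.
- exact: (bmeas_iter (g := \1_A)).
- exact: bmeas_cst.
by rewrite (Int_iter i bA) Int_target Int_cst subrr.
Qed.

Lemma birkD L M x : f (L + M) x = f L x + f M (iter L T x).
Proof.
rewrite /birk (big_cat_nat (n := L)) ?leq_addr //=; congr (_ + _).
rewrite -{1}[L]add0n big_addn addKn; apply: eq_bigr => i _.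
by rewrite iterD.
Qed.

Lemma birk_shift M k x :
  f M (iter k T x) - f M x = f k (iter M T x) - f k x.
Proof. by have := birkD k M x; rewrite addnC birkD; lra. Qed.

Section oneScale.
Context (n : nat) (e : R) (G : good_scale T D n e).

Lemma visits_le k (x : R) (B : set R) (b1 b2 : R) : (k <= n)%N -> 0 <= x < 1 ->
  B `<=` `[b1, b2]%classic -> b1 <= b2 ->
  \sum_(0 <= m < k) (\1_B (iter m T x) : R) <= 1 + (b2 - b1) / e.
Proof.
move=> kn x01 Bb bb; apply: separated_visits => //; first exact: (gs_e G).
move=> i j /andP[ij jk] _ _; rewrite -(subnK (ltnW ij)) iterD.
apply: (orbit_separation E G); first exact: (iterT01 E).
by rewrite subn_gt0 ij /= (leq_trans (leq_subr _ _)) // ltnW // (leq_trans jk).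
Qed.

Lemma visits_short k (x : R) (B : set R) (b1 b2 : R) : (k <= n)%N -> 0 <= x < 1 ->
  B `<=` `[b1, b2]%classic -> b1 <= b2 -> b2 - b1 < e ->
  \sum_(0 <= m < k) (\1_B (iter m T x) : R) <= 2.
Proof.
move=> kn x01 Bb bb b12; apply: le_trans (visits_le kn x01 Bb bb) _.
have : (b2 - b1) / e <= 1 by rewrite ler_pdivrMr ?(gs_e G) // mul1r ltW.
lra.
Qed.

(** Two points on a short segment without singularities travel together: their
Birkhoff sums differ only when an endpoint of the target falls between
them, which separation allows a bounded number of times. *)
Lemma birk_near L j x y : (L <= n)%N -> 0 <= x -> x <= y -> y < 1 -> y - x < e ->
  nosing T D (j + L) x y -> `|f L (iter j T y) - f L (iter j T x)| <= 4.
Proof.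
move=> Ln x0 xy y1 xye nd.
have x01 : 0 <= x < 1 by rewrite x0 (le_lt_trans xy).
pose u := iter j T x; pose de := y - x.
have u01 : 0 <= u < 1 by exact: (iterT01 E).
have yE i : (i < L)%N -> iter i T (iter j T y) = iter i T u + de.
  move=> iL; rewrite /u /de -!iterD.
  have /(rigid E x0 xy y1 nd) : (i + j <= j + L)%N by rewrite addnC leq_add2l ltnW.
  lra.
rewrite /birk -sumrB; apply: le_trans (ler_norm_sum _ _ _) _.
apply: (@le_trans _ _ (\sum_(0 <= i < L) (\1_(`[be - de, be]%classic) (iter i T u)
   + \1_(`[al - de, al]%classic) (iter i T u)))).
  apply: ler_sum_nat => i /andP[_ iL].
  rewrite yE // -/u; move: (iter i T u) => z.
  have sb (p q c : R) : (p - c) - (q - c) = p - q by ring.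
  rewrite sb !indicE.
  have de0 : 0 <= de by rewrite /de; lra.
  have [[h1 h2] [h3 h4]] := (@tg_sub _ _ _ _ tA (z + de), @tg_sub _ _ _ _ tA z,
     (@tg_sup _ _ _ _ tA (z + de), @tg_sup _ _ _ _ tA z)).
  rewrite /= !in_itv /= in h1 h2 h3 h4 *.
  have [Az|nAz] := pselect (A z); have [Azd|nAzd] := pselect (A (z + de)).
  - by rewrite (mem_set Az) (mem_set Azd) subrr normr0 addr_ge0.
  - rewrite (mem_set Az) (memNset nAzd).
    have /andP[a1 a2] := h2 Az.
    have zi : `[be - de, be]%classic z.
      rewrite /= in_itv /= a2 andbT leNgt; apply/negP => zb.
      apply: nAzd; have [->|de1] := eqVneq de 0; first by rewrite addr0.
      have : 0 < de by rewrite lt_neqAle eq_sym de1.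
      by move=> ?; apply: h3; apply/andP; split; lra.
    by rewrite (mem_set zi) sub0r normrN normr1 lerDl.
  - rewrite (memNset nAz) (mem_set Azd).
    have /andP[a1 a2] := h1 Azd.
    have zi : `[al - de, al]%classic z.
      rewrite /= in_itv /=; apply/andP; split; first by lra.
      rewrite leNgt; apply/negP => zb.
      apply: nAz; have [de1|de1] := eqVneq de 0.
        by move: Azd; rewrite de1 addr0.
      have : 0 < de by rewrite lt_neqAle eq_sym de1.
      by move=> ?; apply: h4; apply/andP; split; lra.
    by rewrite (mem_set zi) subr0 normr1 lerDr.
  - by rewrite (memNset nAz) (memNset nAzd) subrr normr0 addr_ge0.
rewrite big_split /=.
have v w : \sum_(0 <= i < L) (\1_(`[w - de, w]%classic) (iter i T u) : R) <= 2.
  by apply: (visits_short Ln u01 (b1 := w - de) (b2 := w)) => //; rewrite /de; lra.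
have := v be; have := v al; lra.
Qed.

(** A segment of length [eps] contains at most one singularity, and none close to
0 or 1, so that it can be slid until its interior is free of singularities; the
iterates of order less than [2 n] are translations there. *)
Lemma cell_ex eps x : 0 < eps < e -> 0 <= x < 1 ->
  exists u, [/\ 0 <= u, u <= x < u + eps, u + eps <= 1 &
    forall p, sing T D (2 * n).-1 p -> ~~ (u < p < u + eps)].
Proof.
move=> /andP[eps0 epse] /andP[x0 x1].
have n0 := gs_n G.
have lt2 : ((2 * n).-1 < 2 * n)%N by rewrite prednK // muln_gt0.
have e_le p : sing T D (2 * n).-1 p -> e <= p <= 1 - e.
  by move=> sp; rewrite (sing_away_from_0 E G sp) // (sing_away_from_1 E G sp).
have [h|h] := ltP 1 (x + eps).
  have [epx|xep] := leP eps 1.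
    exists (1 - eps); split; [lra|apply/andP; split; lra|lra|].
    move=> p /e_le /andP[]; lra.
  have [p0 Dp0] := gs_D G.
  have /e_le /andP[] : sing T D (2 * n).-1 p0.
    by apply: (D_sing E Dp0); move: n0; case: (n) => // k _; rewrite mulnS.
  lra.
have [[p [sp xp]]|np] := pselect (exists p, sing T D (2 * n).-1 p /\ x < p < x + eps).
  have /andP[ep pe] := e_le p sp.
  exists (p - eps); split; [lra|move: xp => /andP[]; lra|lra|].
  move=> q sq; apply/negP => /andP[pq qp].
  have : q = p.
    apply: contrapT => /(gs_sep G (sub_sing sq (ltnW lt2)) (sub_sing sp (ltnW lt2))).
    rewrite ler0_norm; lra.
  lra.
exists x; split => //; first by rewrite lexx /= ltrDl.
by move=> p sp; apply/negP => xp; apply: np; exists p.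
Qed.

(** The orbit of a point visits a short segment at most twice, so that the first
levels of the tower above this segment have multiplicity at most two. *)
Lemma tower_le (g : R -> R) k u eps : bmeas g -> (forall x, 0 <= g x) -> (k <= n)%N ->
  0 < eps < e -> \sum_(0 <= i < k) Int (fun y => \1_(`[u, u + eps[%classic) y * g (iter i T y))
    <= 2 * Int g.
Proof.
move=> bg g0 kn /andP[eps0 epse]; set C := `[u, u + eps[%classic.
have bC : bmeas \1_C by apply: bmeas_indic; exact: measurable_itv.
have -> : \sum_(0 <= i < k) Int (fun y => \1_C y * g (iter i T y)) =
    \sum_(0 <= i < k) Int (fun y => \1_C (iter i.+1 T y) * g (iter k T y)).
  rewrite big_nat_rev /= add0n big_nat_cond [RHS]big_nat_cond.
  apply: eq_bigr => i /andP[/andP[_ ik] _].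
  rewrite -(@Int_iter (fun y => \1_C y * g (iter (k - i.+1) T y)) i.+1); last first.
    by apply: bmeasM => //; exact: bmeas_iter.
  by apply: eq_Int => y _; rewrite -iterD subnK.
have bt i : bmeas (fun y => \1_C (iter i.+1 T y) * g (iter k T y)).
  by apply: bmeasM; [exact: (bmeas_iter (g := \1_C))|exact: bmeas_iter].
rewrite -(@Int_sum R _ _ _ (fun i y => \1_C (iter i.+1 T y) * g (iter k T y))) //.
rewrite -(Int_iter k bg) -IntZ; last exact: bmeas_iter.
apply: le_Int; first exact: bmeas_sum.
  by apply: bmeasM; [exact: bmeas_cst|exact: bmeas_iter].
move=> x x01; rewrite -mulr_suml ler_wpM2r //.
under eq_bigr do rewrite iterSr.
apply: (visits_short kn (exT01 E x01) (b1 := u) (b2 := u + eps)); [|lra|lra].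
by move=> y /=; rewrite !in_itv /= => /andP[uy /ltW yu]; apply/andP.
Qed.

End oneScale.
End birkhoffSums.

(** * Mean square oscillation bounds the mean square *)

Lemma discrete_ivt (R : realType) (g : nat -> R) (N : nat) (st th : R) :
  (forall k, (k < N)%N -> `|g k - g k.+1| <= st) -> 0 <= st -> g 0%N <= th <= g N ->
  exists2 k, (k <= N)%N & `|g k - th| <= st.
Proof.
move=> hst st0 /andP[g0 gN].
have ex : exists k, (k <= N)%N && (th <= g k) by exists N; rewrite leqnn.
case: (ex_minnP ex) => -[|k] /andP[kN thk] kmin.
  by exists 0%N => //; rewrite ger0_norm; lra.
exists k.+1 => //; have := hst k kN; rewrite !ler_norml => /andP[h1 h2].
have : g k < th by rewrite ltNge; apply/negP => h; have := kmin k; rewrite h (ltnW kN) ltnn => /(_ isT).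
by move=> h; apply/andP; split; lra.
Qed.

(** Throughout this section [4 L] is a good scale and [Z] bounds in mean square the
change of [f L] along orbit segments of length [5 L]. Windows of length [4 L]
at times between [L] and [5 L] leave room for shifting a window by up to [L], and
contain stretches of length [L] with any delay up to [3 L]. *)
Section oscillation.
Context (R : realType) (T S : R -> R) (D : set R) (E : exchange T S D).
Context (A : set R) (al be : R) (tA : target A al be).
Context (L : nat) (e xi : R) (G : good_scale T D (4 * L) e).
Hypothesis xi0 : 0 < xi.
Hypothesis xie : xi / (4 * L)%:R < e.

Local Notation f := (birk T A (be - al)).
Local Notation eps := (xi / (4 * L)%:R).

Variable Z : R.
Hypothesis hZ : forall j, (j < 5 * L)%N ->
  Int (fun x => (f L (iter j T x) - f L x) ^+ 2) <= Z.

Let L0 : (0 < L)%N. Proof. by have := gs_n G; rewrite muln_gt0. Qed.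
Let L0R : 0 < L%:R :> R. Proof. by rewrite ltr0n. Qed.
Let eps0 : 0 < eps. Proof. by rewrite divr_gt0 // ltr0n muln_gt0. Qed.
Let epse : 0 < eps < e. Proof. by rewrite eps0. Qed.
Let L4 : (L <= 4 * L)%N. Proof. lia. Qed.
Let ar6 : (6 * L <= (2 * (4 * L)).-1)%N. Proof. lia. Qed.
Let ar56 j : (j < 5 * L)%N -> (j + L <= 6 * L)%N. Proof. lia. Qed.
Let ar58 j : (j < 5 * L)%N -> (j + L < 8 * L)%N. Proof. lia. Qed.
Let ar54 : (5 * L - L = 4 * L)%N. Proof. lia. Qed.
Let ar23 j : (j < L + L)%N -> (j + L <= 3 * L)%N. Proof. lia. Qed.
Let ar28 j : (j < L + L)%N -> (j + L < 8 * L)%N. Proof. lia. Qed.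
Let ar45 j s : (j + s <= 4 * L)%N -> (j + L <= 5 * L)%N * (j + L + s <= 5 * L)%N.
Proof. by move=> h; split; lia. Qed.
Let ar34 s : (s <= 3 * L)%N -> (L + s <= 4 * L)%N. Proof. lia. Qed.
Let ar4L : (4 * L + L = 5 * L)%N. Proof. lia. Qed.
Let ar38 : ((3 * L).+1 < 2 * (4 * L))%N. Proof. lia. Qed.
Let ar38' : (3 * L <= 2 * (4 * L))%N. Proof. lia. Qed.
Let bf j : bmeas (fun x => f L (iter j T x)).
Proof. by apply: (bmeas_iter E); exact: (bmeas_birk E tA). Qed.

(* [W] and [Ga] measure the variation of [f L] along the orbit of [x] in the
   window and in the longer segment, and [v] is the mean value in the window. *)
Let c x j := f L (iter j T x).
Let W x := \sum_(L <= j < 5 * L) \sum_(L <= k < 5 * L) (c x j - c x k) ^+ 2.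
Let Ga x := \sum_(0 <= j < 5 * L) \sum_(0 <= k < 5 * L) (c x j - c x k) ^+ 2.
Let v x := (\sum_(L <= j < 5 * L) c x j) / (4 * L)%:R.
(* The first term comes from averaging [Z] over towers, and the second one from the
   error 4 made when comparing neighbours. *)
Let Y := 20 ^+ 2 * Z / xi + 2 ^+ 11.

Let Z0 : 0 <= Z.
Proof.
apply: le_trans (hZ (j := 0) _); last by rewrite muln_gt0.
by apply: Int_ge0 => x _; exact: sqr_ge0.
Qed.

Let Y_ge : 2 ^+ 11 <= Y.
Proof.
have : 0 <= 20 ^+ 2 * Z / xi by apply: divr_ge0; [apply: mulr_ge0; [exact: sqr_ge0|]|exact: ltW].
rewrite /Y; lra.
Qed.

Let pair_le j k : (j < 5 * L)%N -> (k < 5 * L)%N ->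
  Int (fun x => (c x j - c x k) ^+ 2) <= Z.
Proof.
wlog jk : j k / (k <= j)%N => [hw|] jL kL.
  have [kj|/ltnW jk] := leqP k j; first exact: hw.
  under eq_Int do rewrite -opprB sqrrN.
  exact: hw.
have -> : Int (fun x => (c x j - c x k) ^+ 2) =
    Int (fun x => (f L (iter (j - k) T x) - f L x) ^+ 2).
  rewrite -(@Int_iter _ _ _ _ E
    (fun x => (f L (iter (j - k) T x) - f L x) ^+ 2) k); last first.
    by apply: bmeasX; apply: bmeasB; [exact: bf|exact: (bf 0)].
  by apply: eq_Int => x _; rewrite /c -iterD subnK.
by apply: hZ; rewrite (leq_ltn_trans (leq_subr _ _)).
Qed.

Let bW : bmeas W.
Proof.
apply: bmeas_sum => j; apply: bmeas_sum => k; apply: bmeasX.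
by apply: bmeasB; exact: bf.
Qed.

Let bGa : bmeas Ga.
Proof.
apply: bmeas_sum => j; apply: bmeas_sum => k; apply: bmeasX.
by apply: bmeasB; exact: bf.
Qed.

Let Ga_ge0 x : 0 <= Ga x.
Proof. by apply: sumr_ge0 => j _; apply: sumr_ge0 => k _; exact: sqr_ge0. Qed.

Let Int_Ga : Int Ga <= (5 * L)%:R ^+ 2 * Z.
Proof.
rewrite /Ga Int_sum; last first.
  move=> j; apply: bmeas_sum => k; apply: bmeasX.
  by apply: bmeasB; exact: bf.
apply: (@le_trans _ _ (\sum_(0 <= j < 5 * L) \sum_(0 <= k < 5 * L) Z)); last first.
  by rewrite !sumr_const_nat !subn0 -mulrnA -(mulr_natl Z) natrM expr2.
apply: ler_sum_nat => j /andP[_ jL].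
rewrite Int_sum; last by move=> k; apply: bmeasX; apply: bmeasB; exact: bf.
apply: ler_sum_nat => k /andP[_ kL].
exact: pair_le.
Qed.

(* Shifting the window by at most [L] keeps it inside the long segment. *)
Let W_le_Ga x i : (i <= L)%N -> W x <= Ga (iter i T x).
Proof.
move=> iL.
have -> : Ga (iter i T x) = \sum_(0 + i <= j < 5 * L + i)
    \sum_(0 + i <= k < 5 * L + i) (c x j - c x k) ^+ 2.
  rewrite -(sum_nat_shift (fun j => \sum_(0 + i <= k < 5 * L + i) (c x j - c x k) ^+ 2)).
  apply: eq_bigr => j _; rewrite -(sum_nat_shift (fun k => (c x (j + i) - c x k) ^+ 2)).
  by apply: eq_bigr => k _; rewrite /c !iterD.
apply: (@le_trans _ _ (\sum_(0 + i <= j < 5 * L + i) \sum_(L <= k < 5 * L) (c x j - c x k) ^+ 2)).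
  apply: sum_nat_sub => //; last exact: leq_addr.
  by move=> j; apply: sumr_ge0 => k _; exact: sqr_ge0.
apply: ler_sum => j _.
by apply: sum_nat_sub => //; [move=> k; exact: sqr_ge0|exact: leq_addr].
Qed.

Let near_c x y j : (j + L < 8 * L)%N -> 0 <= x -> x <= y -> y < 1 -> y - x < e ->
  nosing T D (j + L) x y -> `|c y j - c x j| <= 4.
Proof. by move=> jL x0 xy y1 xye nd; exact: (birk_near E tA G). Qed.

(* If all values change by at most 4, all differences change by at most 8, and
   [(p + d)^2 <= 2 p^2 + 2 d^2]. *)
Let W_near x y : (forall j, (j < 5 * L)%N -> `|c x j - c y j| <= 4) ->
  W x <= 2 * W y + 2 ^+ 11 * L%:R ^+ 2.
Proof.
move=> near.
have -> : 2 * W y + 2 ^+ 11 * L%:R ^+ 2 =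
    \sum_(L <= j < 5 * L) \sum_(L <= k < 5 * L) (2 * (c y j - c y k) ^+ 2 + 128).
  under [RHS]eq_bigr do rewrite big_split -mulr_sumr /=.
  rewrite big_split -mulr_sumr /= !sumr_const_nat -/(W y).
  rewrite ar54.
  by rewrite -mulrnA -(mulr_natl 128) !natrM; ring.
apply: ler_sum_nat => j /andP[_ jL].
apply: ler_sum_nat => k /andP[_ kL].
have := near j jL; have := near k kL; rewrite !ler_norml.
move: (c x j) (c x k) (c y j) (c y k) => p q r s /andP[h1 h2] /andP[h3 h4].
have : 0 <= (8 - ((p - q) - (r - s))) * (8 + ((p - q) - (r - s))).
  by apply: mulr_ge0; lra.
have := sqr_ge0 ((p - q) - 2 * (r - s)); nra.
Qed.

(** Averaging the near invariance of [f L] over the tower above a cell bounds the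
variation of [f L] along every single orbit. *)
Let W_le x : 0 <= x < 1 -> W x <= L%:R ^+ 2 * Y.
Proof.
move=> x01; have [u [u0 /andP[ux xu] u1 nu]] := cell_ex E G epse x01.
pose C := `[u, u + eps[%classic.
have bC : bmeas \1_C by apply: bmeas_indic; exact: measurable_itv.
have tC : target C u (u + eps) by apply: target_itv; lra.
have IC : Int \1_C = eps by rewrite (Int_target tC); ring.
have nsp a b : u <= a -> b < u + eps -> nosing T D (6 * L) a b.
  move=> ua bu p sp; apply/negP => /andP[ap pb].
  have /nu : sing T D (2 * (4 * L)).-1 p by exact: sub_sing sp ar6.
  by rewrite (le_lt_trans ua ap) (le_lt_trans pb bu).
have close y j : C y -> (j < 5 * L)%N -> `|c x j - c y j| <= 4.
  rewrite /C /= in_itv /= => /andP[uy yu] jL.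
  have h a b : 0 <= a -> u <= a -> a <= b -> b < u + eps -> `|c b j - c a j| <= 4.
    move=> a0 ua ab bu; apply: near_c => //; [exact: ar58|lra|have := xie; lra|].
    exact: sub_nosing (nsp a b ua bu) (ar56 jL) (lexx _) (lexx _).
  have [xy|yx] := leP x y; last by apply: h => //; lra.
  by rewrite distrC; apply: h => //; lra.
have bCW := bmeasM bC bW.
have eW : eps * W x <= 2 * Int (fun y => \1_C y * W y) + 2 ^+ 11 * L%:R ^+ 2 * eps.
  have b1 : bmeas (fun y => W x * \1_C y) by exact: bmeasZ.
  have b2 : bmeas (fun y => 2 * (\1_C y * W y)) by exact: bmeasZ.
  have b3 : bmeas (fun y => 2 ^+ 11 * L%:R ^+ 2 * \1_C y) by exact: bmeasZ.
  have : Int (fun y => W x * \1_C y) <=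
      Int (fun y => 2 * (\1_C y * W y) + 2 ^+ 11 * L%:R ^+ 2 * \1_C y).
    apply: le_Int => //; first exact: bmeasD.
    move=> y y01; rewrite indicE; case: (boolP (y \in C)) => [|_]; last first.
      by rewrite !(mulr0, mul0r, addr0).
    rewrite inE => Cy; rewrite !mulr1 mul1r.
    by apply: W_near => j; exact: close.
  by rewrite IntD // !IntZ // IC mulrC.
have LW : L%:R * Int (fun y => \1_C y * W y) <= 2 * Int Ga.
  apply: le_trans (tower_le E G u bGa Ga_ge0 L4 epse).
  have -> : L%:R * Int (fun y => \1_C y * W y) =
      \sum_(0 <= i < L) Int (fun y => \1_C y * W y).
    by rewrite sumr_const_nat subn0 mulr_natl.
  apply: ler_sum_nat => i /andP[_ iL].
  apply: le_Int; first exact: bCW.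
    by apply: bmeasM => //; exact: (bmeas_iter E).
  move=> y y01; rewrite indicE; case: (y \in C); rewrite ?mul0r // !mul1r.
  by apply: W_le_Ga; exact: ltnW.
have G2 := Int_Ga; rewrite natrM in G2.
have e4 : eps * (4 * L%:R) = xi by rewrite -natrM divfK // pnatr_eq0 -lt0n muln_gt0.
rewrite -(ler_pM2l eps0); apply: le_trans eW _.
rewrite -(ler_pM2l L0R).
have -> : L%:R * (eps * (L%:R ^+ 2 * Y)) = 100 * L%:R ^+ 2 * Z + L%:R * (2 ^+ 11 * L%:R ^+ 2 * eps).
  have -> : Y = 100 * Z / (eps * L%:R) + 2 ^+ 11.
    by rewrite /Y -e4; field; rewrite !gt_eqF.
  by field; rewrite !gt_eqF.
by rewrite mulrDr lerD2r mulrCA; lra.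
Qed.

Let v_var x : 0 <= x < 1 -> \sum_(L <= j < 5 * L) (c x j - v x) ^+ 2 <= L%:R * Y / 4.
Proof.
move=> x01; apply: (@le_trans _ _ (W x / (4 * L)%:R)); last first.
  rewrite ler_pdivrMr ?ltr0n ?muln_gt0 // natrM.
  by have := W_le x01; lra.
rewrite /W mulr_suml; apply: ler_sum => j _.
have -> : c x j - v x = (\sum_(L <= k < 5 * L) (c x j - c x k)) / (4 * L)%:R.
  rewrite sumrB sumr_const_nat mulrBl -(mulr_natr (c x j)) /v.
  rewrite ar54.
  by rewrite mulfK // pnatr_eq0 -lt0n muln_gt0.
rewrite expr_div_n ler_pdivrMr ?exprn_gt0 ?ltr0n ?muln_gt0 //.
rewrite expr2 mulrA divfK ?pnatr_eq0 -?lt0n ?muln_gt0 //.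
have := sqr_sum_nat_le (fun k => c x j - c x (k + L)%N) (4 * L).
rewrite (sum_nat_shift (fun k => c x j - c x k)).
by rewrite (sum_nat_shift (fun k => (c x j - c x k) ^+ 2)) add0n ar4L mulrC.
Qed.

Let tau := Num.sqrt (2 * Y).

Let tau2 : tau ^+ 2 = 2 * Y.
Proof. by rewrite sqr_sqrtr //; have := Y_ge; lra. Qed.

Let tau0 : 0 < tau.
Proof. by rewrite sqrtr_gt0; have := Y_ge; lra. Qed.

(** Two orbits that run side by side, up to a delay [s], during one stretch of
length [L] have close mean values, because along each orbit the values deviate
little from their mean. *)
Let link x y s j0 : 0 <= x < 1 -> 0 <= y < 1 -> (L <= j0)%N -> (j0 + s <= 4 * L)%N ->
  (forall j, (j0 <= j < j0 + L)%N -> `|c x (j + s) - c y j| <= 4) ->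
  `|v x - v y| <= tau.
Proof.
move=> x01 y01 Lj js h.
have tau_ge0 := ltW tau0.
rewrite -(@ler_pXn2r _ 2) ?nnegrE // real_normK ?num_real // tau2.
have hx : \sum_(j0 <= j < j0 + L) (c x (j + s) - v x) ^+ 2 <= L%:R * Y / 4.
  apply: le_trans (v_var x01).
  rewrite (sum_nat_shift (fun j => (c x j - v x) ^+ 2)).
  by apply: sum_nat_sub; [move=> j; exact: sqr_ge0|exact: leq_trans (leq_addr _ _)|rewrite (ar45 js)].
have hy : \sum_(j0 <= j < j0 + L) (c y j - v y) ^+ 2 <= L%:R * Y / 4.
  apply: le_trans (v_var y01).
  by apply: sum_nat_sub; [move=> j; exact: sqr_ge0|exact: Lj|rewrite (ar45 js)].
rewrite -(ler_pM2l L0R).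
apply: (@le_trans _ _ (\sum_(j0 <= j < j0 + L)
   (3 * (c x (j + s) - v x) ^+ 2 + 3 * (c y j - v y) ^+ 2 + 48))).
  rewrite (_ : L%:R * _ = \sum_(j0 <= j < j0 + L) (v x - v y) ^+ 2); last first.
    by rewrite sumr_const_nat addKn mulr_natl.
  apply: ler_sum_nat => j /h.
  rewrite ler_norml; move: (c x _) (c y j) (v x) (v y) => p q r s' /andP[h1 h2].
  have : 0 <= (4 - (p - q)) * (4 + (p - q)) by apply: mulr_ge0; lra.
  have := sqr_ge0 ((p - r) + (p - q)); have := sqr_ge0 ((p - r) + (q - s')).
  have := sqr_ge0 ((p - q) - (q - s')); nra.
rewrite big_split /= [X in X + _ <= _]big_split -!mulr_sumr /= sumr_const_nat addKn.
rewrite -(mulr_natl 48).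
have : L%:R * 48 <= L%:R * (Y / 2) by rewrite ler_pM2l //; have := Y_ge; lra.
lra.
Qed.

Let link_shift x s : 0 <= x < 1 -> (s <= 3 * L)%N -> `|v x - v (iter s T x)| <= tau.
Proof.
move=> x01 sL; apply: (@link x (iter s T x) s L) => //.
- exact: (iterT01 E).
- exact: ar34.
- by move=> j _; rewrite /c -iterD subrr normr0.
Qed.

Let link_near x y : 0 <= x -> x <= y -> y < 1 -> y - x < e -> nosing T D (3 * L) x y ->
  `|v x - v y| <= tau.
Proof.
move=> x0 xy y1 xye nd.
apply: (@link x y 0 L); rewrite ?addn0 ?L4 //.
- by rewrite x0 (le_lt_trans xy).
- by rewrite y1 (le_trans x0).
- move=> j /andP[_ jL]; rewrite addn0 distrC; apply: near_c => //; first exact: ar28.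
  exact: sub_nosing nd (ar23 jL) (lexx _) (lexx _).
Qed.

(** When a singularity separates two close points, their orbits are traced back
to the time at which the singularity is still far in the future: there the
two orbits are not yet separated. *)
Let link_close x y : 0 <= x -> x <= y -> y < 1 -> y - x < eps ->
  `|v x - v y| <= 3 * tau.
Proof.
move=> x0 xy y1 xye; have tau_gt0 := tau0.
have xye' : y - x < e by apply: lt_trans xye _.
have [[p [sp /andP[xp py]]]|np] := pselect (exists p, sing T D (3 * L) p /\ x < p <= y); last first.
  apply: (@le_trans _ _ tau); last by lra.
  apply: link_near => // p sp; apply/negP => xpy; by apply: np; exists p.
have [p01 [i [iL Di]]] := sp.
pose s := (3 * L - i)%N; have is3 : (i + s = 3 * L)%N by rewrite /s addnC subnK // ltnW.
have sL : (s <= 3 * L)%N by rewrite /s leq_subr.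
pose p' := iter s S p.
have p'01 : 0 <= p' < 1 by exact: (iterS01 E).
have Tp' : iter s T p' = p by exact: (iterSK E).
have Dp' : D (iter (3 * L) T p') by rewrite -is3 iterD Tp'.
have sp' : sing T D (3 * L).+1 p' by split => //; exists (3 * L)%N.
have L8 := ar38.
have p'0 := sing_away_from_0 E G sp' L8; have p'1 := sing_away_from_1 E G sp' L8.
have two q : sing T D (3 * L) q -> sing T D (2 * (4 * L)) q.
  by move=> sq; exact: sub_sing sq ar38'.
have epse' := xie.
have nd : nosing T D (3 * L) (p' - (p - x)) (p' + (y - p)).
  move=> q sq; apply/negP => /andP[h1 h2].
  have qp : q = p'.
    apply: contrapT => /(gs_sep G (two _ sq) (sub_sing sp' (ltnW L8))).
    by rewrite leNgt => /negP; apply; rewrite ltr_norml; apply/andP; split; lra.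
  rewrite qp in sq; have [_ [k [kL Dk]]] := sq.
  apply: (ex_keane E (i := (3 * L - k).-1) Dk Dp').
  by rewrite prednK ?subn_gt0 // -iterD subnK // ltnW.
have x'0 : 0 <= p' - (p - x) by lra.
have x'p : p' - (p - x) <= p' by lra.
have py' : p' <= p' + (y - p) by lra.
have y'1 : p' + (y - p) < 1 by lra.
have p'ge0 : 0 <= p' by lra.
have p'lt1 : p' < 1 by lra.
have Tx : iter s T (p' - (p - x)) = x.
  have := rigid E x'0 x'p p'lt1 (sub_nosing nd (leqnn _) (lexx _) py') sL.
  rewrite Tp'; lra.
have Ty : iter s T (p' + (y - p)) = y.
  have := rigid E p'ge0 py' y'1 (sub_nosing nd (leqnn _) x'p (lexx _)) sL.
  rewrite Tp'; lra.
have h1 : `|v (p' - (p - x)) - v x| <= tau.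
  by rewrite -{2}Tx; apply: link_shift => //; apply/andP; split; lra.
have h2 : `|v (p' + (y - p)) - v y| <= tau.
  by rewrite -{2}Ty; apply: link_shift => //; apply/andP; split; lra.
have h3 : `|v (p' - (p - x)) - v (p' + (y - p))| <= tau.
  by apply: link_near => //; lra.
move: h1 h2 h3; rewrite !ler_norml => /andP[? ?] /andP[? ?] /andP[? ?].
by apply/andP; split; lra.
Qed.

Let link_close_norm x y : 0 <= x < 1 -> 0 <= y < 1 -> `|x - y| < eps ->
  `|v x - v y| <= 3 * tau.
Proof.
wlog xy : x y / x <= y => [hw|] /andP[x0 x1] /andP[y0 y1] xye.
  have [/hw|/ltW yx] := leP x y; first by apply => //; apply/andP.
  by rewrite distrC; apply: hw; rewrite ?x0 ?y0 // distrC.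
apply: link_close => //; move: xye; rewrite distrC ger0_norm //; lra.
Qed.

(* More than the number of disjoint families of orbit segments of length [L],
   separated by [xi / (4 L)], that fit in the unit interval. *)
Let M0 := (Num.truncn (4 / xi)).+2.

(** The mean values vary slowly and are almost constant along orbits: each
level between two of them is attained along a whole orbit segment, segments
at different levels stay apart, and there is room for boundedly many. *)
Let spread x y : 0 <= x < 1 -> 0 <= y < 1 -> `|v x - v y| <= 12 * M0%:R * tau.
Proof.
wlog xy : x y / x <= y => [hw|] x01 y01.
  have [/hw|/ltW yx] := leP x y; first exact.
  by rewrite distrC; exact: hw.
rewrite leNgt; apply/negP => big.
have tau_gt0 := tau0; have eps_gt0 := eps0.
pose N := (Num.truncn ((y - x) / eps)).+1.
have N0 : 0 < N%:R :> R by rewrite ltr0n.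
have stN : (y - x) / N%:R < eps.
  by rewrite ltr_pdivrMr // mulrC -ltr_pdivrMr // truncnS_gt.
pose z k := x + k%:R * ((y - x) / N%:R).
have z01 k : (k <= N)%N -> 0 <= z k < 1.
  move=> kN; have kN' : k%:R / N%:R <= 1 :> R by rewrite ler_pdivrMr // mul1r ler_nat.
  have k0 : 0 <= k%:R / N%:R :> R by rewrite divr_ge0.
  move: x01 y01 => /andP[x0 x1] /andP[y0 y1].
  have -> : z k = x + (k%:R / N%:R) * (y - x) by rewrite /z; ring.
  have h1 : 0 <= (k%:R / N%:R) * (y - x) by apply: mulr_ge0; lra.
  have h2 : (k%:R / N%:R) * (y - x) <= 1 * (y - x) by apply: ler_wpM2r; lra.
  by apply/andP; split; lra.
(* The sign [sg] makes the level grow from [x] to [y]. *)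
have [sg [sg1 sgE]] : exists sg : R, `|sg| = 1 /\ sg * (v y - v x) = `|v x - v y|.
  have [h|h] := leP (v x) (v y).
    by exists 1; rewrite normr1 mul1r distrC ger0_norm // subr_ge0.
  by exists (-1); rewrite normrN1 mulN1r opprB gtr0_norm // subr_gt0.
pose g k := sg * v (z k).
have g0 : g 0%N = sg * v x by rewrite /g /z mul0r addr0.
have gN : g N = sg * v y.
  suff zN : z N = y by rewrite /g zN.
  by rewrite /z mulrC divfK ?gt_eqF // addrC subrK.
have gstep k : (k < N)%N -> `|g k - g k.+1| <= 3 * tau.
  move=> kN; rewrite /g -mulrBr normrM sg1 mul1r.
  apply: link_close_norm; [exact: z01 (ltnW kN)|exact: z01|].
  have -> : z k - z k.+1 = - ((y - x) / N%:R) by rewrite /z -natr1; ring.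
  by rewrite normrN ger0_norm // divr_ge0 ?subr_ge0 // ltW.
(* Levels [12 tau] apart remain [4 tau] apart after the errors [4 tau] made at
   both ends, which exceeds the change [3 tau] between close points. *)
pose th (b : 'I_M0) := g 0%N + 12 * b%:R * tau.
have /choice[w hw] (b : 'I_M0) : exists wv, 0 <= wv < 1 /\ `|sg * v wv - th b| <= 3 * tau.
  have thb : g 0%N <= th b <= g N.
    have bM : b%:R * tau <= M0%:R * tau by rewrite ler_pM2r // ler_nat ltnW.
    have b0 : 0 <= b%:R * tau by rewrite mulr_ge0 // ltW.
    rewrite -sgE in big; rewrite /th; apply/andP; split; first lra.
    rewrite gN g0; lra.
  have [|k kN hk] := discrete_ivt gstep _ thb; first lra.
  by exists (z k); split; [exact: z01|].
pose pt (q : 'I_M0 * 'I_L) := iter q.2 T (w q.1).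
have pt01 q : 0 <= pt q < 1 by apply: (iterT01 E); case: (hw q.1).
have vpt q : `|sg * v (pt q) - th q.1| <= 4 * tau.
  have [w01 hwq] := hw q.1.
  have qL : (q.2 <= 3 * L)%N by rewrite ltnW // (leq_trans (ltn_ord q.2)) // leq_pmull.
  have := link_shift w01 qL; rewrite -/(pt q) => h.
  have : `|sg * v (w q.1) - sg * v (pt q)| <= tau by rewrite -mulrBr normrM sg1 mul1r.
  move: hwq; rewrite !ler_norml => /andP[? ?] /andP[? ?].
  by apply/andP; split; lra.
have : #|[pred q : 'I_M0 * 'I_L | true]|%:R <= 1 + (1 - 0) / eps.
  apply: (separated_card (y := pt) eps_gt0 _ _ ler01) => [q _|q q' _ _ qq'].
    by have /andP[-> /ltW] := pt01 q.
  have [b_eq|b_neq] := eqVneq q.1 q'.1.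
    have i_neq : q.2 != q'.2.
      by apply: contra qq' => /eqP i_eq; rewrite -pair_eqE /pair_eq /= b_eq i_eq !eqxx.
    have gen (i i' : 'I_L) (x' : R) : 0 <= x' < 1 -> (i < i')%N ->
        eps <= `|iter i' T x' - iter i T x'|.
      move=> x'01 ii'; apply: (@le_trans _ _ e); first exact: ltW xie.
      rewrite -(subnK (ltnW ii')) iterD; apply: (orbit_separation E G).
        exact: (iterT01 E).
      rewrite subn_gt0 ii' /= (leq_trans (leq_subr _ _)) // (leq_trans (ltnW (ltn_ord i'))) //.
    have w01 := (hw q.1).1.
    have : q.2 != q'.2 :> nat by [].
    rewrite /pt -b_eq neq_ltn => /orP[ii|ii]; [rewrite distrC|]; exact: gen.
  rewrite leNgt; apply/negP => /(link_close_norm (pt01 q) (pt01 q')) vv.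
  have : `|sg * v (pt q) - sg * v (pt q')| <= 3 * tau by rewrite -mulrBr normrM sg1 mul1r.
  have := vpt q; have := vpt q'.
  have : 12 * tau <= `|th q.1 - th q'.1|.
    rewrite /th [X in `|X|](_ : _ = 12 * tau * (q.1%:R - q'.1%:R)); last by ring.
    have t12 : 0 < 12 * tau by rewrite mulr_gt0.
    rewrite normrM (gtr0_norm t12) ler_pMr //.
    have : q.1 != q'.1 :> nat by [].
    rewrite neq_ltn => /orP[ii|ii].
      rewrite distrC -natrB 1?ltnW // normr_nat ler1n subn_gt0 //.
    by rewrite -natrB 1?ltnW // normr_nat ler1n subn_gt0.
  move: (th q.1) (th q'.1) (sg * v (pt q)) (sg * v (pt q')) => a b p q0.
  have := ler_normD (a - p) (p - q0); have := ler_normD (a - p + (p - q0)) (q0 - b).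
  rewrite [a - p + (p - q0) + (q0 - b)](_ : _ = a - b); last by ring.
  by rewrite (distrC a p); lra.
have -> : #|[pred q : 'I_M0 * 'I_L | true]| = (M0 * L)%N.
  by rewrite -[RHS](_ : #|{: 'I_M0 * 'I_L}| = _) // card_prod !card_ord.
have M0big : 4 / xi + 1 < M0%:R.
  have -> : M0%:R = (Num.truncn (4 / xi)).+1%:R + 1 :> R by rewrite natr1.
  by rewrite ltrD2r; exact: truncnS_gt.
have L1 : 1 <= L%:R :> R by rewrite ler1n.
rewrite subr0 div1r invf_div natrM natrM.
have h : (4 / xi + 1) * L%:R < M0%:R * L%:R by rewrite ltr_pM2r.
rewrite [X in _ <= 1 + X](_ : _ = 4 / xi * L%:R); last by ring.
lra.
Qed.

(** By [spread] the function [f L] is close to a constant; as its integral is zero,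
it is close to zero. *)
Lemma oscillation_bound :
  Int (fun x => f L x ^+ 2) <= (1 + 24 ^+ 2 * M0%:R ^+ 2) * Y.
Proof.
pose v0 := v 0.
have z01 : 0 <= (0 : R) < 1 by rewrite lexx ltr01.
have tau_gt0 := tau0.
have bL : bmeas (f L) by exact: (bf 0).
have bsq j : bmeas (fun x => (c x j - v0) ^+ 2).
  by apply: bmeasX; apply: bmeasB; [exact: bf|exact: bmeas_cst].
have pt x : 0 <= x < 1 -> \sum_(L <= j < 5 * L) (c x j - v0) ^+ 2 <=
    4 * L%:R * ((1 + 24 ^+ 2 * M0%:R ^+ 2) * Y).
  move=> x01; pose B := 12 * M0%:R * tau.
  have vB : (v x - v0) ^+ 2 <= B ^+ 2.
    have B0 : 0 <= B by rewrite !mulr_ge0 // ltW.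
    by rewrite -real_normK ?num_real // ler_pXn2r ?nnegrE //; exact: spread.
  apply: (@le_trans _ _ (\sum_(L <= j < 5 * L) (2 * (c x j - v x) ^+ 2 + 2 * B ^+ 2))).
    apply: ler_sum_nat => j _; move: vB; move: (c x j) (v x) (v0) => p q r vB.
    have := sqr_ge0 ((p - q) - (q - r)); nra.
  rewrite big_split -mulr_sumr /= sumr_const_nat ar54 -(mulr_natl (2 * _)) natrM.
  have := v_var x01; have := Y_ge; rewrite /B !exprMn tau2.
  move: (\sum_(_ <= _ < _) _) => s hY hs.
  have : L%:R * Y / 4 <= 2 * L%:R * Y by have := mulr_ge0 (ltW L0R) (le_trans _ hY); nra.
  nra.
have : Int (fun x => \sum_(L <= j < 5 * L) (c x j - v0) ^+ 2) <=
    4 * L%:R * ((1 + 24 ^+ 2 * M0%:R ^+ 2) * Y).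
  by rewrite -(Int_cst (4 * _ * _)); apply: le_Int => //; [exact: bmeas_sum|exact: bmeas_cst].
rewrite Int_sum //.
have sq : Int (fun x => (f L x - v0) ^+ 2) = Int (fun x => f L x ^+ 2) + v0 ^+ 2.
  have -> : Int (fun x => (f L x - v0) ^+ 2) =
      Int (fun x => f L x ^+ 2 + ((- 2 * v0) * f L x + v0 ^+ 2)).
    by apply: eq_Int => x _; ring.
  rewrite IntD; [|exact: bmeasX|by apply: bmeasD; [exact: bmeasZ|exact: bmeas_cst]].
  rewrite IntD; [|exact: bmeasZ|exact: bmeas_cst].
  by rewrite IntZ // (Int_birk E tA) Int_cst mulr0 add0r.
rewrite (eq_bigr (fun=> Int (fun x => f L x ^+ 2) + v0 ^+ 2)); last first.
  move=> j _; rewrite -sq.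
  have b0 : bmeas (fun x => (f L x - v0) ^+ 2).
    by apply: bmeasX; apply: bmeasB => //; exact: bmeas_cst.
  exact: (Int_iter E j b0).
rewrite sumr_const_nat ar54 -(mulr_natl (_ + _)) natrM ler_pM2l ?mulr_gt0 //.
have := sqr_ge0 v0; lra.
Qed.

End oscillation.

(** * Decay of the mean square discrepancy *)

Section contraction.
Context (R : realType) (T S : R -> R) (D : set R) (E : exchange T S D).

Lemma Int_sqrD (a b : R -> R) (t : R) : bmeas a -> bmeas b -> 0 < t ->
  Int (fun x => (a x + b x) ^+ 2) <=
    (1 + t) * Int (fun x => a x ^+ 2) + (1 + t^-1) * Int (fun x => b x ^+ 2).
Proof.
move=> ba bb t0; have ba2 := bmeasX 2 ba; have bb2 := bmeasX 2 bb.
rewrite -!IntZ // -IntD; [|exact: bmeasZ|exact: bmeasZ].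
apply: le_Int; first by apply: bmeasX; exact: bmeasD.
  by apply: bmeasD; exact: bmeasZ.
move=> x _; move: (a x) (b x) => p q.
have -> : (1 + t) * p ^+ 2 + (1 + t^-1) * q ^+ 2 = (p + q) ^+ 2 + t^-1 * (t * p - q) ^+ 2.
  by field; rewrite gt_eqF.
by rewrite lerDl mulr_ge0 ?sqr_ge0 // invr_ge0 ltW.
Qed.

Section oneTarget.
Context (A : set R) (al be : R) (tA : target A al be).
Local Notation f := (birk T A (be - al)).

Let bf L : bmeas (f L). Proof. exact: (bmeas_birk E tA). Qed.
Let bfi L j : bmeas (fun x => f L (iter j T x)). Proof. exact: (bmeas_iter E). Qed.
Let Inti (g : R -> R) j : bmeas g -> Int (fun x => g (iter j T x)) = Int g.
Proof. exact: (Int_iter E). Qed.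

(** Minkowski's inequality, for a sum cut into pieces of length at most [L]. *)
Lemma sq_birk_mul L q k j : 0 <= q -> (forall i, (i <= L)%N -> Int (fun x => f i x ^+ 2) <= q * L%:R ^+ 2) ->
  (j <= k * L)%N -> Int (fun x => f j x ^+ 2) <= q * (k * L)%:R ^+ 2.
Proof.
move=> q0 hq; elim: k j => [|k ih] j jk.
  move: jk; rewrite mul0n leqn0 => /eqP ->.
  rewrite (eq_Int (g := fun=> 0)) ?Int_cst ?mulr_ge0 ?sqr_ge0 // => x _.
  by rewrite /birk big_geq // expr0n.
have [jL|Lj] := leqP j L.
  apply: le_trans (hq j jL) _; rewrite ler_wpM2l // ler_pXn2r ?nnegrE //.
  by rewrite ler_nat mulSn leq_addr.
have jE : j = (L + (j - L))%N by rewrite subnKC // ltnW.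
case: k => [|k] in ih jk *; first by move: jk; rewrite mul1n leqNgt Lj.
have h1 : Int (fun x => f (j - L) x ^+ 2) <= q * (k.+1 * L)%:R ^+ 2.
  by apply: ih; move: jk; rewrite [X in (_ <= X)%N -> _]mulSn {1}jE leq_add2l.
rewrite jE; under eq_Int do rewrite birkD.
have k0 : 0 < k.+1%:R :> R by rewrite ltr0n.
apply: le_trans (Int_sqrD (t := k.+1%:R) (bf L) (bfi (j - L) L) k0) _.
rewrite (Inti (g := fun x => f (j - L) x ^+ 2)); last exact: bmeasX.
have h2 := hq L (leqnn L).
apply: (@le_trans _ _ ((1 + k.+1%:R) * (q * L%:R ^+ 2) + (1 + k.+1%:R^-1) * (q * (k.+1 * L)%:R ^+ 2))).
  by apply: lerD; apply: ler_wpM2l.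
rewrite !natrM -[k.+2%:R]natr1 le_eqVlt; apply/orP; left; apply/eqP.
by field; rewrite gt_eqF.
Qed.

Lemma birk_mul m L x : f (m * L) x = \sum_(0 <= k < m) f L (iter (k * L) T x).
Proof.
elim: m => [|m ih]; first by rewrite mul0n /birk !big_geq.
by rewrite mulSnr birkD ih big_nat_recr.
Qed.

(** The mean [F] of [m] successive values of [f L] is almost invariant, since it
changes only through its end terms. The mean square distance of these values to
[F] is the variance, that is, the decrease of the mean square of [f L] when it
is replaced by [F]. *)
Lemma near_invariance L m j : (0 < m)%N ->
  Int (fun x => (f L (iter j T x) - f L x) ^+ 2) <=
  6 * (Int (fun x => f L x ^+ 2) - Int (fun x => f (m * L) x ^+ 2) / m%:R ^+ 2)
  + 12 * Int (fun x => f j x ^+ 2) / m%:R ^+ 2.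
Proof.
move=> m0; have m0R : 0 < m%:R :> R by rewrite ltr0n.
pose F x := m%:R^-1 * f (m * L) x.
have bF : bmeas F by exact: bmeasZ.
pose h k x := f L (iter (k * L) T x).
have bh k : bmeas (h k) by exact: bfi.
have IF : Int (fun x => F x ^+ 2) = Int (fun x => f (m * L) x ^+ 2) / m%:R ^+ 2.
  rewrite mulrC -IntZ; last exact: bmeasX.
  by apply: eq_Int => x _; rewrite /F exprMn exprVn.
have vark : \sum_(0 <= k < m) Int (fun x => (h k x - F x) ^+ 2) =
    m%:R * (Int (fun x => f L x ^+ 2) - Int (fun x => F x ^+ 2)).
  rewrite -Int_sum; last by move=> k; apply: bmeasX; exact: bmeasB.
  have -> : Int (fun x => \sum_(0 <= k < m) (h k x - F x) ^+ 2) =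
      Int (fun x => \sum_(0 <= k < m) h k x ^+ 2 - m%:R * F x ^+ 2).
    apply: eq_Int => x _.
    have sumh : \sum_(0 <= k < m) h k x = m%:R * F x.
      by rewrite /F mulrA mulfV ?gt_eqF // mul1r birk_mul.
    transitivity (\sum_(0 <= k < m) (h k x ^+ 2 + (F x ^+ 2 - 2 * F x * h k x))).
      by apply: eq_bigr => k _; ring.
    have sum2 : \sum_(0 <= k < m) (2 * F x * h k x) = 2 * F x * (m%:R * F x).
      by rewrite -sumh mulr_sumr.
    rewrite big_split sumrB /= sum2 sumr_const_nat subn0 -(mulr_natl (F x ^+ 2)).
    by ring.
  rewrite IntB; [|by apply: bmeas_sum => k; exact: bmeasX|by apply: bmeasZ; exact: bmeasX].
  rewrite IntZ; last exact: bmeasX.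
  rewrite Int_sum; last by move=> k; exact: bmeasX.
  rewrite (eq_bigr (fun=> Int (fun x => f L x ^+ 2))); last first.
    move=> k _; exact: (Inti (g := fun x => f L x ^+ 2) _ (bmeasX 2 (bf L))).
  by rewrite sumr_const_nat subn0 -(mulr_natl (Int _)); ring.
have dF : Int (fun x => (F (iter j T x) - F x) ^+ 2) <= 4 * Int (fun x => f j x ^+ 2) / m%:R ^+ 2.
  have -> : Int (fun x => (F (iter j T x) - F x) ^+ 2) =
      Int (fun x => m%:R ^- 2 * (f j (iter (m * L) T x) + - f j x) ^+ 2).
    apply: eq_Int => x _; rewrite /F -mulrBr birk_shift exprMn exprVn //.
  rewrite IntZ; last by apply: bmeasX; apply: bmeasD; [exact: bfi|exact: bmeasN].
  rewrite mulrC ler_pM2r ?invr_gt0 ?exprn_gt0 //.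
  have := @Int_sqrD (fun x => f j (iter (m * L) T x)) (fun x => - f j x) 1 (bfi j _) (bmeasN (bf j)) ltr01.
  rewrite (Inti (g := fun x => f j x ^+ 2) _ (bmeasX 2 (bf j))).
  have -> : Int (fun x => (- f j x) ^+ 2) = Int (fun x => f j x ^+ 2).
    by apply: eq_Int => x _; rewrite sqrrN.
  by rewrite invr1; lra.
have bd : bmeas (fun x => (f L (iter j T x) - f L x) ^+ 2).
  by apply: bmeasX; apply: bmeasB.
have split3 k : Int (fun x => (f L (iter j T x) - f L x) ^+ 2) <=
    6 * Int (fun x => (h k x - F x) ^+ 2) + 3 * Int (fun x => (F (iter j T x) - F x) ^+ 2).
  have bFj : bmeas (fun x => F (iter j T x)) by exact: (bmeas_iter E).
  have bhj : bmeas (fun x => h k (iter j T x)) by exact: (bmeas_iter E).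
  have b1 : bmeas (fun x => (h k x - F x) ^+ 2) by apply: bmeasX; exact: bmeasB.
  have b1j : bmeas (fun x => (h k (iter j T x) - F (iter j T x)) ^+ 2).
    by apply: bmeasX; exact: bmeasB.
  have b2 : bmeas (fun x => (F (iter j T x) - F x) ^+ 2) by apply: bmeasX; exact: bmeasB.
  rewrite -(Inti (k * L) bd).
  have -> : 6 * Int (fun x => (h k x - F x) ^+ 2) =
      3 * Int (fun x => (h k (iter j T x) - F (iter j T x)) ^+ 2) + 3 * Int (fun x => (h k x - F x) ^+ 2).
    by rewrite (Inti (g := fun x => (h k x - F x) ^+ 2) j b1); ring.
  rewrite -!IntZ // -!IntD; try by do ?[apply: bmeasD|apply: bmeasZ].
  apply: le_Int; [exact: (bmeas_iter E (k * L)%N bd)|by do ?[apply: bmeasD|apply: bmeasZ]|].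
  move=> x _; rewrite -iterD addnC iterD -/(h k (iter j T x)) -/(h k x).
  move: (h k (iter j T x)) (h k x) (F (iter j T x)) (F x) => p q r s.
  have := sqr_ge0 ((p - r) - (r - s)); have := sqr_ge0 ((p - r) + (q - s)).
  have := sqr_ge0 ((r - s) + (q - s)); nra.
have : m%:R * Int (fun x => (f L (iter j T x) - f L x) ^+ 2) <=
    6 * (m%:R * (Int (fun x => f L x ^+ 2) - Int (fun x => F x ^+ 2)))
    + m%:R * (3 * Int (fun x => (F (iter j T x) - F x) ^+ 2)).
  rewrite -vark mulr_sumr.
  have -> : m%:R * (3 * Int (fun x => (F (iter j T x) - F x) ^+ 2)) =
     \sum_(0 <= k < m) (3 * Int (fun x => (F (iter j T x) - F x) ^+ 2)).
    by rewrite sumr_const_nat subn0 mulr_natl.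
  have -> : m%:R * Int (fun x => (f L (iter j T x) - f L x) ^+ 2) =
     \sum_(0 <= k < m) Int (fun x => (f L (iter j T x) - f L x) ^+ 2).
    by rewrite sumr_const_nat subn0 mulr_natl.
  by rewrite -big_split /=; apply: ler_sum => k _; exact: split3.
rewrite -IF mulrCA -mulrDr ler_pM2l //; lra.
Qed.

End oneTarget.
End contraction.

Lemma pow2_ge (R : realType) (x : R) : exists b : nat, x <= (2 ^ b)%:R.
Proof.
exists (Num.truncn x).+1; apply: le_trans (ltW (truncnS_gt x)) _.
by rewrite ler_nat ltnW // ltn_expl.
Qed.

Lemma contraction_constants (R : realType) (ka C x : R) : 0 <= C -> 0 <= x ->
  ka * C <= 1 / 12 * C -> 0 <= ka ^+ 2 * x ->
  (1 + ka / 2) * ((1 - ka) * x + C) + ka / 4 * x <= (1 - ka / 4) * x + 2 * C.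
Proof. by rewrite expr2; lra. Qed.

Section contractionConstants.
Context (R : realType) (T S : R -> R) (D : set R) (E : exchange T S D).

Lemma sq_birk_block (A : set R) (al be : R) (tA : target A al be) m N :
  Int (fun x => birk T A (be - al) (m * N) x ^+ 2) <=
    m%:R ^+ 2 * Int (fun x => birk T A (be - al) N x ^+ 2).
Proof.
have bN := bmeasX 2 (bmeas_birk E tA N).
have -> : m%:R ^+ 2 * Int (fun x => birk T A (be - al) N x ^+ 2) =
    m%:R * Int (fun x => \sum_(0 <= k < m) birk T A (be - al) N (iter (k * N) T x) ^+ 2).
  rewrite Int_sum => [|k]; last exact: (bmeas_iter E (k * N)%N bN).
  rewrite (eq_bigr (fun=> Int (fun x => birk T A (be - al) N x ^+ 2))); last first.
    by move=> k _; exact: (Int_iter E _ bN).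
  by rewrite sumr_const_nat subn0 -(mulr_natl (Int _)) mulrA expr2.
rewrite -IntZ; last by apply: bmeas_sum => k; exact: (bmeas_iter E (k * N)%N bN).
apply: le_Int.
- by apply: bmeasX; exact: (bmeas_birk E tA _).
- by apply: bmeasZ; apply: bmeas_sum => k; exact: (bmeas_iter E (k * N)%N bN).
- by move=> x _; rewrite birk_mul; exact: sqr_sum_nat_le.
Qed.

(** Either the mean square of [f L / L] decreases by a definite factor between [L]
and [r L], or [f L] is nearly invariant by [near_invariance]; in the latter case
[oscillation_bound] shows that it was small. For large [b] the
incomplete last block of length at most [r L] is negligible against [2 ^ b L]. *)
Lemma contraction (xi : R) : 0 < xi -> exists (b : nat) (rho K : R),
  [/\ 0 < rho < 1, 0 <= K & forall (A : set R) (al be : R) (L : nat) (e q : R),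
    target A al be -> good_scale T D (4 * L) e -> xi / (4 * L)%:R < e -> 0 <= q ->
    (forall j, (j <= L)%N -> Int (fun x => birk T A (be - al) j x ^+ 2) <= q * L%:R ^+ 2) ->
    forall j, (j <= 2 ^ b * L)%N -> Int (fun x => birk T A (be - al) j x ^+ 2) <=
       (rho * q + K / L%:R ^+ 2) * (2 ^ b * L)%:R ^+ 2].
Proof.
move=> xi0; pose M0 := (Num.truncn (4 / xi)).+2.
(* [C1], [C2] and [C3] turn [oscillation_bound] into [I L <= C2 Z + C3]; [ka]
   is such that [2 ka C2 Z = Z / 6] cancels the factor 6 of [near_invariance]. *)
pose C1 : R := 1 + 24 ^+ 2 * M0%:R ^+ 2.
have C1ge : 1 <= C1 by rewrite lerDl mulr_ge0 // sqr_ge0.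
pose C2 := 20 ^+ 2 * C1 / xi + 1.
have C2ge : 1 <= C2 by rewrite lerDr divr_ge0 ?mulr_ge0 ?sqr_ge0 // ?ltW //; lra.
pose C3 := 2 ^+ 11 * C1.
have C3ge : 0 <= C3 by rewrite mulr_ge0 ?exprn_ge0 //; lra.
pose ka := (12 * C2)^-1.
have C2gt : 0 < C2 by lra.
have kaE : 12 * C2 * ka = 1 by rewrite mulfV // gt_eqF // mulr_gt0.
have ka0 : 0 < ka by rewrite invr_gt0 mulr_gt0.
have ka1 : ka <= 1 / 12 by clearbody ka; nra.
have ka2 : 0 < ka / 2 by rewrite divr_gt0.
have ka3 : 0 <= 1 - 2 * ka by lra.
pose C4 := 2 * ka * C3.
have C4ge : 0 <= C4 by apply: mulr_ge0 => //; apply: mulr_ge0 => //; exact: ltW.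
(* [2 ^ b1] and [2 ^ b2] are the numbers of blocks at the two stages. *)
have [b1 hb1] := pow2_ge (50 / ka).
have [b2 hb2] := pow2_ge ((1 + 2 / ka) * (4 / ka)).
pose r := (2 ^ b1)%N; pose M := (2 ^ b2)%N.
have r1 : 1 <= r%:R :> R by rewrite /r ler1n expn_gt0.
have M1 : 1 <= M%:R :> R by rewrite /M ler1n expn_gt0.
have hr : 50 <= ka * r%:R ^+ 2.
  move: hb1; rewrite ler_pdivrMr // -/r => h.
  have : ka * r%:R <= ka * r%:R ^+ 2 by rewrite ler_pM2l // expr2 ler_peMl //; lra.
  lra.
have hM : 1 + 2 / ka <= ka / 4 * M%:R ^+ 2.
  move: hb2; rewrite mulrA ler_pdivrMr // -/M => h.
  have : ka * M%:R <= ka * M%:R ^+ 2 by rewrite ler_pM2l // expr2 ler_peMl //; lra.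
  lra.
exists (b2 + b1)%N, (1 - ka / 4), (2 * C4); split.
- by apply/andP; split; lra.
- by lra.
move=> A al be L e q tA G xie q0 hq j jL.
have L0 : (0 < L)%N by have := gs_n G; rewrite muln_gt0.
have L0R : 0 < L%:R :> R by rewrite ltr0n.
pose f := birk T A (be - al); pose I k := Int (fun x => f k x ^+ 2).
have r0 : (0 < r)%N by rewrite /r expn_gt0.
pose Z := 6 * (I L - I (r * L)%N / r%:R ^+ 2) + 300 * (q * L%:R ^+ 2) / r%:R ^+ 2.
have r2 : 0 < r%:R ^+ 2 :> R by rewrite exprn_gt0 // ltr0n.
have hZ i : (i < 5 * L)%N -> Int (fun x => (f L (iter i T x) - f L x) ^+ 2) <= Z.
  move=> iL; apply: le_trans (near_invariance E tA L i r0) _.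
  rewrite lerD2l ler_pM2r ?invr_gt0 //.
  have := sq_birk_mul E tA q0 hq (ltnW iL); rewrite natrM exprMn; lra.
have osc : I L <= C1 * (20 ^+ 2 * Z / xi + 2 ^+ 11).
  by have := oscillation_bound E tA G xi0 xie hZ.
have Z0 : 0 <= Z.
  apply: le_trans (hZ 0%N _); last by rewrite muln_gt0.
  by apply: Int_ge0 => x _; exact: sqr_ge0.
have IL : I L <= C2 * Z + C3.
  apply: le_trans osc _; rewrite /C2 /C3.
  have -> : C1 * (20 ^+ 2 * Z / xi + 2 ^+ 11) = 20 ^+ 2 * C1 / xi * Z + 2 ^+ 11 * C1 by ring.
  lra.
have hIL := hq L (leqnn L); rewrite -/f -/(I L) in hIL.
have hbeta : I (r * L)%N / r%:R ^+ 2 <= (1 - ka) * (q * L%:R ^+ 2) + C4.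
  have h1 : 0 <= (ka - 50 / r%:R ^+ 2) * (q * L%:R ^+ 2).
    apply: mulr_ge0; last by rewrite mulr_ge0 // sqr_ge0.
    by rewrite subr_ge0 ler_pdivrMr.
  have h2 : 2 * ka * I L <= 2 * ka * (C2 * Z + C3) by rewrite ler_pM2l // mulr_gt0.
  have h3 : 2 * ka * (C2 * Z + C3) = Z / 6 + C4.
    have -> : 2 * ka * (C2 * Z + C3) = (12 * C2 * ka) * Z / 6 + 2 * ka * C3 by field.
    by rewrite kaE mul1r.
  have h4 : (1 - 2 * ka) * I L <= (1 - 2 * ka) * (q * L%:R ^+ 2) by rewrite ler_wpM2l.
  rewrite h3 /Z in h2; lra.
pose m := (j %/ (r * L))%N; pose i := (j %% (r * L))%N.
have rL0 : (0 < r * L)%N by rewrite muln_gt0 r0.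
have jE : j = (m * (r * L) + i)%N by exact: divn_eq.
have mM : (m <= M)%N.
  by rewrite -(leq_pmul2r rL0) mulnA mulnA -expnD (leq_trans _ jL) // -mulnA leq_trunc_div.
have hi : I i <= q * (r * L)%:R ^+ 2.
  by apply: (sq_birk_mul E tA q0 hq); rewrite ltnW // ltn_mod.
have hm : I (m * (r * L))%N <= M%:R ^+ 2 * I (r * L)%N.
  apply: le_trans (sq_birk_block tA _ _) _; rewrite ler_wpM2r //.
    by apply: Int_ge0 => x _; exact: sqr_ge0.
  by rewrite ler_pXn2r ?nnegrE // ler_nat.
have hj : I j <= (1 + ka / 2) * I (m * (r * L))%N + (1 + 2 / ka) * I i.
  rewrite {1}jE /I; under eq_Int do rewrite /f birkD -/f.
  have bfk k : bmeas (f k) by exact: (bmeas_birk E tA).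
  apply: le_trans (Int_sqrD (bfk _) (bmeas_iter E _ (bfk i)) ka2) _.
  by rewrite (Int_iter E (g := fun x => f i x ^+ 2) _ (bmeasX 2 (bfk i))) invf_div.
rewrite -/f -/(I j); apply: le_trans hj _.
have -> : (2 ^ (b2 + b1) * L)%:R = M%:R * r%:R * L%:R :> R by rewrite expnD !natrM.
rewrite natrM in hi.
have hb' : I (r * L)%N <= r%:R ^+ 2 * ((1 - ka) * (q * L%:R ^+ 2) + C4).
  by move: hbeta; rewrite ler_pdivrMr // mulrC.
have M2 : 0 <= M%:R ^+ 2 :> R by exact: sqr_ge0.
have k1 : 0 <= 1 + ka / 2 by rewrite addr_ge0 // ltW.
have t1 : (1 + ka / 2) * I (m * (r * L))%N <=
    (1 + ka / 2) * (M%:R ^+ 2 * (r%:R ^+ 2 * ((1 - ka) * (q * L%:R ^+ 2) + C4))).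
  by rewrite ler_wpM2l // (le_trans hm) // ler_wpM2l.
have t2 : (1 + 2 / ka) * I i <= ka / 4 * M%:R ^+ 2 * (q * (r%:R * L%:R) ^+ 2).
  apply: ler_pM => //; first by rewrite addr_ge0 // divr_ge0 // ltW.
  by apply: Int_ge0 => x _; exact: sqr_ge0.
apply: le_trans (lerD t1 t2) _.
have qL0 : 0 <= q * L%:R ^+ 2 by rewrite mulr_ge0 // sqr_ge0.
have -> : (((1 - ka / 4) * q + 2 * C4 / L%:R ^+ 2) * (M%:R * r%:R * L%:R) ^+ 2) =
    M%:R ^+ 2 * r%:R ^+ 2 * ((1 - ka / 4) * (q * L%:R ^+ 2) + 2 * C4).
  by field; rewrite gt_eqF.
have -> : (1 + ka / 2) * (M%:R ^+ 2 * (r%:R ^+ 2 * ((1 - ka) * (q * L%:R ^+ 2) + C4))) +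
   ka / 4 * M%:R ^+ 2 * (q * (r%:R * L%:R) ^+ 2) = M%:R ^+ 2 * r%:R ^+ 2 *
   ((1 + ka / 2) * ((1 - ka) * (q * L%:R ^+ 2) + C4) + ka / 4 * (q * L%:R ^+ 2)).
  by ring.
rewrite ler_wpM2l ?mulr_ge0 ?sqr_ge0 //.
have kaC : ka * C4 <= 1 / 12 * C4 by rewrite ler_wpM2r.
have kq : 0 <= ka ^+ 2 * (q * L%:R ^+ 2) by rewrite mulr_ge0 ?sqr_ge0.
exact: contraction_constants.
Qed.

(** From a mean to a pointwise bound: the values of [f L] along an orbit segment
of length [L] are shared, up to 4, by all points of the tower over the cell of
its initial point, and this tower fills a part of the space of size at least
[xi / 8]. Longer sums are averages of such values, up to end terms. *)
Lemma sup_from_mean (A : set R) (al be xi e p B : R) (L : nat) :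
  target A al be -> 0 < xi -> good_scale T D (4 * L) e -> xi / (4 * L)%:R < e -> 0 < p ->
  Int (fun x => birk T A (be - al) L x ^+ 2) <= p ^+ 2 * L%:R ^+ 2 ->
  (forall k x, (k <= L)%N -> 0 <= x < 1 -> `|birk T A (be - al) k x| <= B) ->
  forall M x, (L <= M)%N -> 0 <= x < 1 ->
   `|birk T A (be - al) M x| <= M%:R * (16 * p / xi + 8 / L%:R) + 2 * B.
Proof.
move=> tA xi0 G xie p0 hp hB M x LM x01.
have L0 : (0 < L)%N by have := gs_n G; rewrite muln_gt0.
have L0R : 0 < L%:R :> R by rewrite ltr0n.
pose f := birk T A (be - al).
have bf k : bmeas (f k) by exact: (bmeas_birk E tA).
have I1 : Int (fun y => `|f L y|) <= p * L%:R.
  have pL : 0 < p * L%:R by rewrite mulr_gt0.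
  have h : Int (fun y => 2 * (p * L%:R) * `|f L y|) <=
      Int (fun y => (p * L%:R) ^+ 2 + f L y ^+ 2).
    apply: le_Int.
    - by apply: bmeasZ; exact: bmeas_norm.
    - by apply: bmeasD; [exact: bmeas_cst|exact: bmeasX].
    move=> y _; rewrite -[f L y ^+ 2]real_normK ?num_real //.
    have := sqr_ge0 (p * L%:R - `|f L y|); lra.
  rewrite IntZ in h; last exact: bmeas_norm.
  rewrite IntD ?Int_cst in h; [|exact: bmeas_cst|exact: bmeasX].
  rewrite -exprMn in hp; rewrite -(ler_pM2l pL).
  have := le_trans h (lerD (lexx _) hp); lra.
pose eps := xi / (4 * L)%:R.
have eps0 : 0 < eps by rewrite divr_gt0 // ltr0n muln_gt0.
have epse : 0 < eps < e by rewrite eps0.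
have epsL : 4 * L%:R * eps = xi.
  by rewrite /eps natrM mulrC divfK // gt_eqF // mulr_gt0.
have L4 : (L <= 4 * L)%N by rewrite leq_pmull.
have L2 i : (i < L)%N -> (i + L <= (2 * (4 * L)).-1)%N by clear -L0; lia.
have tower y : 0 <= y < 1 -> \sum_(0 <= i < L) `|f L (iter i T y)| <= L%:R * (8 * p * L%:R / xi + 4).
  move=> y01; have [u [u0 /andP[uy yu] u1 nu]] := cell_ex E G epse y01.
  pose C := `[u, u + eps[%classic.
  have bC : bmeas \1_C by apply: bmeas_indic; exact: measurable_itv.
  have tC : target C u (u + eps) by apply: target_itv; lra.
  have IC : Int \1_C = eps by rewrite (Int_target tC); ring.
  have := tower_le E G u (bmeas_norm (bf L)) (fun z => normr_ge0 _) L4 epse.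
  rewrite -/C => tw.
  have near z i : C z -> (i < L)%N -> `|f L (iter i T y)| <= `|f L (iter i T z)| + 4.
    rewrite /C /= in_itv /= => /andP[uz zu] iL.
    suff : `|f L (iter i T y) - f L (iter i T z)| <= 4.
      move=> h; have := ler_normD (f L (iter i T y) - f L (iter i T z)) (f L (iter i T z)).
      rewrite subrK; lra.
    have h a b : u <= a -> a <= b -> b < u + eps -> `|f L (iter i T b) - f L (iter i T a)| <= 4.
      move=> ua ab bu; apply: (birk_near E tA G) => //.
      - exact: le_trans ua.
      - exact: lt_le_trans u1.
      - by move: epse => /andP[_ h]; lra.
      move=> s ss; apply/negP => /andP[a_s sb].
      have /nu : sing T D (2 * (4 * L)).-1 s by exact: sub_sing ss (L2 i iL).
      by rewrite (le_lt_trans ua a_s) (le_lt_trans sb bu).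
    have [yz|/ltW zy] := leP y z; last exact: h.
    by rewrite distrC; apply: h.
  have b1 i : bmeas (fun z => \1_C z * `|f L (iter i T z)|).
    by apply: bmeasM => //; exact: (bmeas_iter E i (bmeas_norm (bf L))).
  have : eps * \sum_(0 <= i < L) `|f L (iter i T y)| <=
     \sum_(0 <= i < L) Int (fun z => \1_C z * `|f L (iter i T z)|) + L%:R * (4 * eps).
    rewrite mulr_sumr.
    have -> : L%:R * (4 * eps) = \sum_(0 <= i < L) 4 * eps by rewrite sumr_const_nat subn0 mulr_natl.
    rewrite -big_split /=; apply: ler_sum_nat => i /andP[_ iL].
    rewrite -IC -IntZ // mulrC -IntZ // -IntD //; last exact: bmeasZ.
    apply: le_Int; [exact: bmeasZ|by apply: bmeasD => //; exact: bmeasZ|].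
    move=> z z01; rewrite indicE; case: (boolP (z \in C)) => [|_]; last by rewrite !(mulr0, mul0r, addr0).
    by rewrite inE => Cz; rewrite !mulr1 mul1r; exact: near.
  move=> hh; rewrite -(ler_pM2l eps0); apply: le_trans hh _.
  have -> : eps * (L%:R * (8 * p * L%:R / xi + 4)) = 2 * (p * L%:R) + L%:R * (4 * eps).
    by rewrite -epsL; field; rewrite !gt_eqF.
  by rewrite lerD2r (le_trans tw) // ler_pM2l.
pose m := (M %/ L)%N.
have Bge0 : 0 <= B by apply: le_trans (normr_ge0 _) (hB 0%N x _ x01).
have c0 : 0 <= 8 * p * L%:R / xi + 4.
  by rewrite addr_ge0 // divr_ge0 ?mulr_ge0 // ltW.
have blocks k : \sum_(0 <= i < k * L) `|f L (iter i T x)| <= k%:R * (L%:R * (8 * p * L%:R / xi + 4)).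
  elim: k => [|k ih]; first by rewrite mul0n big_geq // mul0r.
  rewrite mulSnr (big_cat_nat (n := (k * L)%N)) ?leq_addr //= -natr1 mulrDl mul1r lerD //.
  have -> : \sum_(k * L <= i < k * L + L) `|f L (iter i T x)| =
      \sum_(0 <= i < L) `|f L (iter i T (iter (k * L) T x))|.
    rewrite [in LHS]addnC -[X in \sum_(X <= _ < _) _]add0n.
    rewrite -(sum_nat_shift (fun i => `|f L (iter i T x)|)).
    by apply: eq_bigr => i _; rewrite iterD.
  by apply: tower; exact: (iterT01 E).
have sumM : \sum_(0 <= i < M) `|f L (iter i T x)| <= m.+1%:R * (L%:R * (8 * p * L%:R / xi + 4)).
  apply: le_trans (blocks m.+1); apply: sum_nat_sub => //.
  by rewrite ltnW // -ltn_divLR // ltnSn.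
have swap : L%:R * f M x = \sum_(0 <= i < M) f L (iter i T x) - \sum_(0 <= k < L) (f M (iter k T x) - f M x).
  have -> : \sum_(0 <= i < M) f L (iter i T x) = \sum_(0 <= k < L) f M (iter k T x).
    rewrite /f /birk exchange_big /=; apply: eq_bigr => k _; apply: eq_bigr => i _.
    by rewrite -!iterD addnC.
  by rewrite -sumrB; under eq_bigr do rewrite subKr; rewrite sumr_const_nat subn0 mulr_natl.
have ends : `|\sum_(0 <= k < L) (f M (iter k T x) - f M x)| <= L%:R * (2 * B).
  apply: le_trans (ler_norm_sum _ _ _) _.
  have -> : L%:R * (2 * B) = \sum_(0 <= k < L) 2 * B by rewrite sumr_const_nat subn0 mulr_natl.
  apply: ler_sum_nat => k /andP[_ kL]; rewrite /f birk_shift.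
  have h1 := hB k _ (ltnW kL) (iterT01 E M x01); have h2 := hB k _ (ltnW kL) x01.
  apply: le_trans (ler_normB _ _) _; lra.
have m2 : m.+1%:R * L%:R <= 2 * M%:R :> R.
  by rewrite -!natrM ler_nat mulSnr mul2n -addnn leq_add // leq_trunc_div.
rewrite -(ler_pM2l L0R) -{1}(gtr0_norm L0R) -normrM -/f swap.
apply: le_trans (ler_normB _ _) _.
apply: le_trans (lerD (ler_norm_sum _ _ _) ends) _.
rewrite mulrDr lerD2r; apply: le_trans sumM _.
have -> : L%:R * (M%:R * (16 * p / xi + 8 / L%:R)) = (2 * M%:R) * (8 * p * L%:R / xi + 4).
  by field; rewrite !gt_eqF.
by rewrite mulrA ler_wpM2r.
Qed.

End contractionConstants.

(** * Effective equidistribution along the sequence of good scales *)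

Record scale_seq (R : realType) (T : R -> R) (D : set R) (xi : R) (ns : nat -> nat) : Prop :=
  ScaleSeq {
  ss_xi : 0 < xi;
  ss_0 : ns 0%N = 1%N;
  ss_pow : forall s, exists k, ns s = (2 ^ k)%N;
  ss_lt : forall s, (ns s < ns s.+1)%N;
  ss_good : forall s, exists2 e, good_scale T D (ns s.+1) e & xi / (ns s.+1)%:R < e }.

Section scaleSequence.
Context (R : realType) (T S : R -> R) (D : set R) (E : exchange T S D).
Context (xi : R) (ns : nat -> nat) (Hns : scale_seq T D xi ns).

Lemma ns_dvd s k : exists2 m, (k <= m)%N & ns (s + k) = (2 ^ m * ns s)%N.
Proof.
elim: k => [|k [m km nE]]; first by exists 0%N; rewrite ?addn0 ?mul1n.
have [a aE] := ss_pow Hns (s + k); have [b bE] := ss_pow Hns (s + k).+1.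
have ab : (a < b)%N.
  by have := ss_lt Hns (s + k); rewrite aE bE ltn_exp2l.
exists (b - a + m)%N; first by have : (0 < b - a)%N; [rewrite subn_gt0|lia].
by rewrite addnS bE expnD -mulnA -nE aE -expnD subnK // ltnW.
Qed.

Lemma ns_gt0 s : (0 < ns s)%N.
Proof. by have [k ->] := ss_pow Hns s; rewrite expn_gt0. Qed.

Lemma ns_growth s k : (2 ^ k * ns s <= ns (s + k))%N.
Proof.
have [m km ->] := ns_dvd s k; rewrite leq_pmul2r ?ns_gt0 //.
by rewrite leq_exp2l.
Qed.

Lemma ns_mono s t : (s <= t)%N -> (ns s <= ns t)%N.
Proof.
move=> st; rewrite -(subnKC st); apply: leq_trans (ns_growth _ _).
by rewrite leq_pmull // expn_gt0.
Qed.

Lemma visits_scale (A : set R) (al be : R) t M x : target A al be -> (M <= ns t.+1)%N ->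
  0 <= x < 1 ->
  \sum_(0 <= m < M) (\1_A (iter m T x) : R) <= 1 + (be - al) * (ns t.+1)%:R / xi.
Proof.
move=> tA Mt x01; have [e Ge xie] := ss_good Hns t.
apply: le_trans (visits_le E Ge Mt x01 (tg_sub tA) (tg_le tA)) _.
have xi0 := ss_xi Hns; have e0 := gs_e Ge.
rewrite lerD2l -mulrA; apply: ler_wpM2l; first by rewrite subr_ge0 (tg_le tA).
rewrite -[leRHS]invf_div lef_pV2 ?posrE ?divr_gt0 ?ltr0n ?ns_gt0 //.
exact: ltW.
Qed.

Lemma birk_crude (A : set R) (al be c0 : R) t i M x : target A al be -> (M <= ns t.+1)%N ->
  0 <= x < 1 -> 0 <= c0 -> (0 < i <= ns t.+1)%N -> be - al <= c0 / i%:R ->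
  `|birk T A (be - al) M x| <= (1 + c0 * (xi^-1 + 1)) * (ns t.+1)%:R / i%:R.
Proof.
move=> tA Mt x01 c00 /andP[i0 it] hA.
have xi0 := ss_xi Hns; have A0 : 0 <= be - al by rewrite subr_ge0 (tg_le tA).
have i0R : 0 < i%:R :> R by rewrite ltr0n.
have V := visits_scale tA Mt x01.
rewrite /birk sumrB sumr_const_nat subn0 -(mulr_natr (be - al)).
have V0 : 0 <= \sum_(0 <= m < M) (\1_A (iter m T x) : R) by apply: sumr_ge0.
have MA : (be - al) * M%:R <= (be - al) * (ns t.+1)%:R by rewrite ler_wpM2l // ler_nat.
have MA0 : 0 <= (be - al) * M%:R by rewrite mulr_ge0.
have h1 : 1 <= (ns t.+1)%:R / i%:R :> R by rewrite ler_pdivlMr // mul1r ler_nat.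
have h2 : (be - al) * (ns t.+1)%:R * (xi^-1 + 1) <= c0 / i%:R * (ns t.+1)%:R * (xi^-1 + 1).
  rewrite ler_wpM2r ?ler_wpM2r // addr_ge0 // invr_ge0 ltW //.
have -> : (1 + c0 * (xi^-1 + 1)) * (ns t.+1)%:R / i%:R =
    (ns t.+1)%:R / i%:R + c0 / i%:R * (ns t.+1)%:R * (xi^-1 + 1) by ring.
have h3 : 0 <= (be - al) * (ns t.+1)%:R / xi by rewrite divr_ge0 ?mulr_ge0 // ltW.
rewrite mulrDr mulr1 in h2; rewrite ler_norml; apply/andP; split; lra.
Qed.

Let index_step s b j : ((s + 2 + j * b.+1).+1 + b.+1 = (s + 2 + j.+1 * b.+1).+1)%N.
Proof. by rewrite mulSn; lia. Qed.

Let index_shift s b k : ((s + 2 + k * b.+1).+1 = s + 3 + k * b.+1)%N.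
Proof. lia. Qed.

(** [contraction] is applied at every [q]-th good scale after [s], which leaves
room for the growth by the factor [2 ^ b] that it requires. The additional
[k] scales of waiting absorb the end terms of [sup_from_mean]. *)
Lemma discrepancy_decay (c0 : R) : 0 <= c0 -> exists (C tau : R) (q : nat),
  [/\ 0 < C, 0 < tau < 1 & forall (A : set R) (al be : R) s i k M x,
    target A al be -> (0 < i <= ns s.+1)%N -> be - al <= c0 / i%:R ->
    (ns (s + 3 + k * q + k) <= M)%N -> 0 <= x < 1 ->
    `|birk T A (be - al) M x| <= M%:R * (C * tau ^+ k / i%:R)].
Proof.
move=> c00; have xi0 := ss_xi Hns.
have [b [rho [K [/andP[rho0 rho1] K0 contr]]]] := contraction E xi0.
(* The additive term [K / L^2] of the contraction is absorbed by a rate [sg] larger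
   than [rho], and larger than [1/2], as [L] is at least doubled at each step. *)
pose sg := (1 + Num.max rho 2^-1) / 2.
have [sg1 sgr sgh] : [/\ sg < 1, rho < sg & 2^-1 < sg].
  have m1 : Num.max rho 2^-1 < 1 by rewrite gt_max rho1 /=; lra.
  have m2 : rho <= Num.max rho 2^-1 by rewrite le_max lexx.
  have m3 : 2^-1 <= Num.max rho 2^-1 by rewrite le_max lexx orbT.
  by rewrite /sg; split; lra.
pose tau := (1 + sg) / 2.
have [tau1 tauh] : tau < 1 /\ 2^-1 < tau by rewrite /tau; split; lra.
have tau2 : sg <= tau ^+ 2 by rewrite /tau; have := sqr_ge0 (1 - sg); lra.
clearbody tau; clearbody sg.
have sgp : 0 < sg by lra.
have sg2 : 1 <= 2 * sg by lra.
have sg0 := ltW sgp.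
have tau0 : 0 < tau by lra.
have tau0' := ltW tau0.
have half_tau : 2^-1 <= tau := ltW tauh.
have sg_tau : sg <= tau ^+ 2 := tau2.
have srp : 0 < sg - rho by rewrite subr_gt0.
pose c1 := 1 + c0 * (xi^-1 + 1).
have c1ge : 1 <= c1 by rewrite lerDl mulr_ge0 // addr_ge0 // invr_ge0 ltW.
pose C0 := c1 ^+ 2 + K / (sg - rho).
have C0ge : 1 <= C0.
  have : 1 <= c1 ^+ 2 by rewrite expr_ge1 //; lra.
  have : 0 <= K / (sg - rho) by rewrite divr_ge0 // subr_ge0 ltW.
  by rewrite /C0; lra.
have C0c : c1 ^+ 2 <= C0 by rewrite lerDl divr_ge0 // ltW.
have C0K : K <= (sg - rho) * C0.
  have -> : (sg - rho) * C0 = (sg - rho) * c1 ^+ 2 + K.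
    by rewrite /C0; field; rewrite gt_eqF.
  by rewrite lerDr mulr_ge0 ?sqr_ge0 // ltW.
have c10 : 0 <= c1 by lra.
clearbody C0.
have C00 : 0 <= C0 by lra.
have C0p : 0 < C0 by lra.
exists (16 * C0 / xi + 8 + 2 * c1), tau, b.+1; split.
- have : 0 <= 16 * C0 / xi by rewrite divr_ge0 ?mulr_ge0 ?ltW //; lra.
  lra.
- by apply/andP; split; lra.
move=> A al be s i k M x tA /andP[i0 is_] hA nM x01.
have i0R : 0 < i%:R :> R by rewrite ltr0n.
pose t j := (s + 2 + j * b.+1)%N; pose L j := (ns (t j).+1 %/ 4)%N.
pose f := birk T A (be - al).
have nt4 j : ns (t j).+1 = (4 * L j)%N.
  have [m hm nE] := ns_dvd s (2 + j * b.+1).+1.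
  have m2 : (2 <= m)%N by apply: leq_trans hm.
  rewrite /L /t -addnA -addnS nE -(subnK m2) expnD.
  by rewrite mulnAC mulnK // mulnC mulnA.
have L_ge j : (2 ^ j * i <= L j)%N.
  rewrite -(@leq_pmul2l 4) // -nt4.
  apply: leq_trans (_ : 2 ^ (2 + j) * ns s.+1 <= _)%N; first by rewrite expnD -mulnA !leq_pmul2l ?expn_gt0.
  have nsE : ns (s.+1 + (2 + j * b.+1)) = ns (t j).+1 by rewrite addSn addnA.
  rewrite -nsE; apply: leq_trans (ns_growth _ _).
  by rewrite leq_pmul2r ?ns_gt0 // leq_exp2l // leq_add2l leq_pmulr.
have L0 j : (0 < L j)%N by apply: leq_trans (L_ge j); rewrite muln_gt0 expn_gt0.
have LR j : 2 ^+ j * i%:R <= (L j)%:R :> R by rewrite -natrX -natrM ler_nat.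
have L0R j : 0 < (L j)%:R :> R by rewrite ltr0n.
have two0 j : 0 < 2 ^+ j :> R by rewrite exprn_gt0.
have Lstep j : exists m, L j.+1 = (m * (2 ^ b * L j))%N /\ (0 < m)%N.
  have [m hm nE] := ns_dvd (t j).+1 b.+1.
  have tE : ((t j).+1 + b.+1 = (t j.+1).+1)%N by exact: index_step.
  exists (2 ^ (m - b))%N; split; last by rewrite expn_gt0.
  apply/eqP; rewrite -(eqn_pmul2l (_ : 0 < 4)%N) // -nt4 -tE nE nt4.
  by rewrite mulnCA (mulnA (2 ^ (m - b))%N) -expnD subnK // ltnW.
have init j : (j <= L 0)%N -> Int (fun x => f j x ^+ 2) <= (C0 / i%:R ^+ 2) * (L 0)%:R ^+ 2.
  have [m hm nE] := ns_dvd s.+1 2.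
  have LE : (L 0 = 2 ^ (m - 2) * ns s.+1)%N.
    rewrite /L /t mul0n addn0 -addSn nE -{1}(subnK hm) expnD.
    by rewrite mulnAC mulnK.
  have base l : (l <= ns s.+1)%N -> Int (fun x => f l x ^+ 2) <= (C0 / i%:R ^+ 2) * (ns s.+1)%:R ^+ 2.
    move=> ls; have bl := bmeas_birk E tA l.
    rewrite -[leRHS]Int_cst; apply: le_Int; [exact: bmeasX|exact: bmeas_cst|].
    move=> y y01; have := birk_crude tA ls y01 c00 (_ : 0 < i <= ns s.+1)%N hA.
    rewrite i0 is_ => /(_ isT) h.
    rewrite -real_normK ?num_real //.
    have h' : `|f l y| ^+ 2 <= (c1 * (ns s.+1)%:R / i%:R) ^+ 2.
      by rewrite ler_pXn2r ?nnegrE // divr_ge0 ?mulr_ge0.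
    apply: le_trans h' _; rewrite !exprMn exprVn mulrAC ler_wpM2r ?sqr_ge0 //.
    by rewrite ler_pM2r ?invr_gt0 ?exprn_gt0.
  move=> jL; rewrite LE in jL *; apply: (sq_birk_mul E tA _ base jL).
  by rewrite divr_ge0 ?sqr_ge0.
have decay j : forall l, (l <= L j)%N ->
    Int (fun x => f l x ^+ 2) <= (C0 * sg ^+ j / i%:R ^+ 2) * (L j)%:R ^+ 2.
  elim: j => [|j ih]; first by rewrite expr0 mulr1; exact: init.
  have [e Ge xie] := ss_good Hns (t j).
  rewrite nt4 in Ge xie.
  have sgj : 0 <= sg ^+ j by rewrite exprn_ge0.
  have qj0 : 0 <= C0 * sg ^+ j / i%:R ^+ 2 by rewrite divr_ge0 ?sqr_ge0 ?mulr_ge0.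
  have step := contr A al be (L j) e _ tA Ge xie qj0 ih.
  have [m [mE m0]] := Lstep j.
  have hq : rho * (C0 * sg ^+ j / i%:R ^+ 2) + K / (L j)%:R ^+ 2 <= C0 * sg ^+ j.+1 / i%:R ^+ 2.
    have h1 : K / (L j)%:R ^+ 2 <= K * sg ^+ j / i%:R ^+ 2.
      rewrite -mulrA ler_wpM2l // -[leRHS]invf_div lef_pV2 ?posrE ?divr_gt0 ?exprn_gt0 //.
      rewrite ler_pdivrMr ?exprn_gt0 //.
      have hL : (2 ^+ j * i%:R) ^+ 2 <= (L j)%:R ^+ 2 :> R.
        by rewrite ler_pXn2r ?nnegrE // mulr_ge0 // ltW.
      have h2s : 1 <= 2 ^+ j * sg ^+ j by rewrite -exprMn exprn_ege1.
      have h2 : 1 <= 2 ^+ j :> R by rewrite exprn_ege1 // ler1n.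
      have : 1 <= (2 ^+ j) ^+ 2 * sg ^+ j.
        by rewrite expr2 -mulrA -[leLHS]mulr1; apply: ler_pM.
      have i2 : 0 < i%:R ^+ 2 :> R by rewrite exprn_gt0.
      rewrite -(ler_pM2r i2) mul1r => /le_trans; apply.
      by rewrite mulrAC -exprMn ler_wpM2r.
    have h2 : K * sg ^+ j / i%:R ^+ 2 <= (sg - rho) * (C0 * sg ^+ j / i%:R ^+ 2).
      by rewrite !mulrA ler_wpM2r ?invr_ge0 ?sqr_ge0 // ler_wpM2r.
    have -> : C0 * sg ^+ j.+1 / i%:R ^+ 2 = sg * (C0 * sg ^+ j / i%:R ^+ 2) by rewrite exprS; ring.
    lra.
  have step' l : (l <= 2 ^ b * L j)%N -> Int (fun x => f l x ^+ 2) <=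
      C0 * sg ^+ j.+1 / i%:R ^+ 2 * (2 ^ b * L j)%:R ^+ 2.
    by move=> lL; apply: le_trans (step l lL) _; rewrite ler_wpM2r ?sqr_ge0.
  move=> l; rewrite mE => lL; apply: (sq_birk_mul E tA _ step' lL).
  by rewrite divr_ge0 ?sqr_ge0 ?mulr_ge0 ?exprn_ge0.
have [e Ge xie] := ss_good Hns (t k).
rewrite nt4 in Ge xie.
pose p := C0 * tau ^+ k / i%:R.
have tauk : 0 < tau ^+ k by rewrite exprn_gt0.
have p0 : 0 < p by rewrite divr_gt0 ?mulr_gt0.
have hp : Int (fun x => f (L k) x ^+ 2) <= p ^+ 2 * (L k)%:R ^+ 2.
  apply: le_trans (decay k _ (leqnn _)) _; rewrite ler_wpM2r ?sqr_ge0 //.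
  rewrite /p !exprMn exprVn ler_wpM2r ?invr_ge0 ?sqr_ge0 //.
  apply: ler_pM; [by []|exact: exprn_ge0|by rewrite expr2 ler_peMl|].
  by rewrite -exprM mulnC exprM lerXn2r // nnegrE sqr_ge0.
have iLk : (i <= ns (t k).+1)%N.
  by rewrite nt4 (leq_trans _ (leq_pmull _ _)) // (leq_trans _ (L_ge k)) // leq_pmull ?expn_gt0.
pose B := c1 * (ns (t k).+1)%:R / i%:R.
have hB l y : (l <= L k)%N -> 0 <= y < 1 -> `|birk T A (be - al) l y| <= B.
  move=> ll y01; apply: birk_crude => //; last by rewrite i0 iLk.
  by rewrite nt4 (leq_trans ll) // leq_pmull.
have tE : ((t k).+1 = s + 3 + k * b.+1)%N by exact: index_shift.
have nkM : (2 ^ k * ns (t k).+1 <= M)%N.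
  by apply: leq_trans nM; rewrite -tE; exact: ns_growth.
have LM : (L k <= M)%N.
  apply: leq_trans nkM; rewrite nt4 mulnA leq_pmull // muln_gt0 expn_gt0 //.
apply: le_trans (sup_from_mean E tA xi0 Ge xie p0 hp hB LM x01) _.
have M0 : 0 <= M%:R :> R by [].
have half : (2 ^+ k)^-1 <= tau ^+ k by rewrite -exprVn lerXn2r // nnegrE.
have h8 : 8 / (L k)%:R <= 8 * tau ^+ k / i%:R.
  rewrite -mulrA ler_wpM2l // (le_trans _ (ler_wpM2r _ half)) ?invr_ge0 //.
  by rewrite -invfM lef_pV2 ?posrE ?mulr_gt0.
have hBM : B <= M%:R * (c1 * tau ^+ k / i%:R).
  have c1i : 0 <= c1 / i%:R by rewrite divr_ge0.
  have hn : (ns (t k).+1)%:R <= M%:R * tau ^+ k.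
    apply: le_trans (_ : M%:R * (2 ^+ k)^-1 <= _); last by rewrite ler_wpM2l.
    by rewrite ler_pdivlMr // mulrC -natrX -natrM ler_nat.
  have := ler_wpM2l c1i hn; rewrite /B.
  have -> : c1 / i%:R * (M%:R * tau ^+ k) = M%:R * (c1 * tau ^+ k / i%:R) by ring.
  by have -> : c1 / i%:R * (ns (t k).+1)%:R = c1 * (ns (t k).+1)%:R / i%:R by ring.
have h8M := ler_wpM2l M0 h8.
have -> : M%:R * ((16 * C0 / xi + 8 + 2 * c1) * tau ^+ k / i%:R) =
   M%:R * (16 * p / xi) + M%:R * (8 * tau ^+ k / i%:R) + 2 * (M%:R * (c1 * tau ^+ k / i%:R)).
  by rewrite /p; ring.
rewrite mulrDr; lra.
Qed.

End scaleSequence.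

(** * The variance of the number of visits to nested targets *)

Lemma initial_segment (b : nat -> bool) n : (forall m m', (m <= m')%N -> b m' -> b m) ->
  exists2 K, (K <= n)%N & forall m, (m < n)%N -> b m = (m < K)%N.
Proof.
move=> anti; elim: n => [|n [K Kn bK]]; first by exists 0%N.
have [bn|nbn] := boolP (b n).
  by exists n.+1 => // m; rewrite ltnS => mn; rewrite (anti _ _ mn bn) mn.
exists K; first exact: leqW.
move=> m; rewrite ltnS leq_eqVlt => /orP[/eqP ->|]; last exact: bK.
by rewrite (negbTE nbn); apply/esym/negbTE; rewrite -leqNgt.
Qed.

Lemma sqr_sum_split (R : realType) (F : nat -> R) N :
  (\sum_(1 <= i < N.+1) F i) ^+ 2 = \sum_(1 <= i < N.+1) F i ^+ 2 +
    2 * \sum_(1 <= i < N.+1) \sum_(i.+1 <= j < N.+1) F i * F j.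
Proof.
elim: N => [|N ih]; first by rewrite !big_geq // expr0n mulr0 addr0.
rewrite big_nat_recr //= sqrrD ih [in RHS]big_nat_recr //=.
rewrite [X in _ = _ + 2 * X]big_nat_recr //= [X in _ = _ + 2 * (_ + X)]big_geq // addr0.
have -> : \sum_(1 <= i < N.+1) \sum_(i.+1 <= j < N.+2) F i * F j =
    \sum_(1 <= i < N.+1) \sum_(i.+1 <= j < N.+1) F i * F j + (\sum_(1 <= i < N.+1) F i) * F N.+1.
  rewrite mulr_suml -big_split /=; apply: eq_big_nat => i /andP[i1 iN].
  by rewrite big_nat_recr.
by rewrite -mulr_natl; ring.
Qed.

(** [idx m] is the index of the last term of [ns] up to [m], and from the time [N0 i]
on the discrepancy of the [i]-th target is effectively bounded, with rate
[th i]. *)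
Section variance.
Context (R : realType) (T S : R -> R) (D : set R) (E : exchange T S D).
Context (xi : R) (ns : nat -> nat) (Hns : scale_seq T D xi ns).
Context (A : nat -> set R) (al be a : nat -> R).
Hypothesis aE : forall j, be j - al j = a j.
Hypothesis tA : forall j, target (A j) (al j) (be j).
Hypothesis nestA : forall i j, (i <= j)%N -> A j `<=` A i.
Context (idx N0 : nat -> nat) (th : nat -> R).
Hypothesis idxP : forall m, (0 < m)%N -> (ns (idx m) <= m < ns (idx m).+1)%N.
Hypothesis th0 : forall i, 0 <= th i.
Hypothesis discr : forall i K x, (0 < i)%N -> (N0 i <= K)%N -> 0 <= x < 1 ->
  `|birk T (A i) (a i) K x| <= K%:R * th i.

Local Notation cl := (fun i => ns (idx i).+1).
Local Notation ind j := (\1_(A j) : R -> R).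

Let a0 j : 0 <= a j. Proof. by rewrite -aE subr_ge0 (tg_le (tA j)). Qed.
Let xi0 : 0 < xi. Proof. exact: ss_xi Hns. Qed.

Let bind j : bmeas (ind j).
Proof. by apply: bmeas_indic; exact: (tg_m (tA j)). Qed.

Let bindT j k : bmeas (fun x => ind j (iter k T x)).
Proof. exact: (bmeas_iter E k (bind j)). Qed.

Let bindS j k : bmeas (fun x => ind j (iter k S x)).
Proof. exact: (bmeas_iterS E k (bind j)). Qed.

Let ind_ge0 j z : 0 <= ind j z. Proof. by rewrite indicE. Qed.

Let visits_chunks i t k x : (0 < t)%N -> 0 <= x < 1 ->
  \sum_(0 <= m < k * ns t) ind i (iter m T x) <= k%:R * (1 + a i * (ns t)%:R / xi).
Proof.
case: t => // t _; elim: k x => [|k ih] x x01; first by rewrite mul0n big_geq // mul0r.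
rewrite mulSn (big_cat_nat (n := ns t.+1)) ?leq_addr //= -natr1 mulrDl mul1r addrC lerD //.
  have -> : \sum_(ns t.+1 <= m < ns t.+1 + k * ns t.+1) ind i (iter m T x) =
      \sum_(0 <= m < k * ns t.+1) ind i (iter m T (iter (ns t.+1) T x)).
    rewrite [in LHS]addnC -[X in \sum_(X <= _ < _) _]add0n.
    rewrite -(sum_nat_shift (fun m => ind i (iter m T x))).
    by apply: eq_bigr => m _; rewrite iterD.
  by apply: ih; exact: (iterT01 E).
by rewrite -aE; exact: (visits_scale E Hns (tA i)).
Qed.

Let W (i K : nat) : R := \sum_(cl i <= m < K.+1) (ns (idx m))%:R^-1.

(** Below the time [N0 i], separation at the good scales bounds the number of
visits: an orbit segment of length [K] is cut into segments whose length is the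
last good scale [ns t] up to [K]. The number of these segments is absorbed
into [W], whose terms with [ns t <= m <= K] amount to at least
[K / ns t - 1]. *)
Let birk_upper i K x : (0 < i)%N -> (0 < K)%N -> 0 <= x < 1 ->
  birk T (A i) (a i) K x <= 2 + a i * (cl i)%:R / xi + W i K
     + 2 / xi * a i * (minn K (N0 i))%:R + K%:R * th i.
Proof.
move=> i0 K0 x01; have ai := a0 i; have xp := xi0.
have W0 : 0 <= W i K by apply: sumr_ge0 => m _; rewrite invr_ge0.
have t1 : 0 <= a i * (cl i)%:R / xi by rewrite divr_ge0 ?mulr_ge0 // ltW.
have t2 (k : nat) : 0 <= 2 / xi * a i * k%:R by rewrite !mulr_ge0 // invr_ge0 ltW.
have t3 : 0 <= K%:R * th i by rewrite mulr_ge0.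
have [NK|KN] := leqP (N0 i) K.
  have := discr i0 NK x01; rewrite ler_norml => /andP[_ h].
  by apply: le_trans h _; rewrite lerDr !addr_ge0.
have bv : birk T (A i) (a i) K x <= \sum_(0 <= m < K) ind i (iter m T x).
  by rewrite /birk sumrB gerBl sumr_ge0.
apply: le_trans bv _.
have [Kcl|clK] := ltnP K (cl i).
  have := visits_scale E Hns (tA i) (ltnW Kcl) x01; rewrite aE; have := t2 K; lra.
have /andP[nK Kn] := idxP K0.
have it : (idx i < idx K)%N.
  rewrite ltnNge; apply/negP => h; have := ns_mono Hns (_ : (idx K).+1 <= (idx i).+1)%N.
  by rewrite ltnS => /(_ h) h'; have := leq_trans Kn h'; rewrite ltnNge clK.
have t0 : (0 < idx K)%N by exact: leq_ltn_trans it.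
set t := idx K in nK Kn it t0 *.
have nt0 : (0 < ns t)%N by exact: (ns_gt0 Hns).
have nt0R : 0 < (ns t)%:R :> R by rewrite ltr0n.
pose k := (K %/ ns t).+1.
have hk : k%:R * (ns t)%:R <= K%:R + (ns t)%:R :> R.
  by rewrite -natrM -natrD ler_nat mulSnr leq_add2r leq_trunc_div.
have kk : k%:R <= K%:R / (ns t)%:R + 1 :> R.
  by rewrite -(ler_pM2r nt0R) mulrDl mul1r divfK ?gt_eqF.
have v1 : \sum_(0 <= m < K) ind i (iter m T x) <= k%:R * (1 + a i * (ns t)%:R / xi).
  apply: le_trans (visits_chunks i k t0 x01); apply: sum_nat_sub => //.
  by rewrite ltnW // /k -ltn_divLR // ltnSn.
have v2 : k%:R * (a i * (ns t)%:R / xi) <= 2 / xi * a i * K%:R.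
  have -> : k%:R * (a i * (ns t)%:R / xi) = (k%:R * (ns t)%:R) * (a i / xi) by ring.
  have -> : 2 / xi * a i * K%:R = (2 * K%:R) * (a i / xi) by ring.
  apply: ler_wpM2r; first exact: divr_ge0 ai (ltW xp).
  apply: le_trans hk _.
  have : (ns t)%:R <= K%:R :> R by rewrite ler_nat.
  lra.
have v3 : K%:R / (ns t)%:R <= 1 + W i K.
  apply: le_trans (_ : 1 + \sum_(ns t <= m < K.+1) (ns t)%:R^-1 <= _).
    rewrite sumr_const_nat -[(ns t)%:R^-1 *+ _]mulr_natl.
    rewrite -(ler_pM2r nt0R) mulrDl !divfK ?gt_eqF // mul1r -natrD ler_nat.
    by rewrite subnKC ?leqnSn // ltnW.
  rewrite lerD2l; apply: (@le_trans _ _ (\sum_(ns t <= m < K.+1) (ns (idx m))%:R^-1)).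
    apply: ler_sum_nat => m /andP[tm mK].
    have m0 : (0 < m)%N by exact: leq_trans tm.
    have /andP[im mi] := idxP m0.
    rewrite lef_pV2 ?posrE ?ltr0n ?(ns_gt0 Hns) // ler_nat.
    apply: (ns_mono Hns); rewrite leqNgt; apply/negP => h.
    have : (ns t.+1 <= ns (idx m))%N by exact: (ns_mono Hns).
    by move=> h'; have := leq_trans h' im; rewrite leqNgt (leq_ltn_trans _ Kn).
  by apply: sum_nat_sub => //; exact: (ns_mono Hns).
have := t2 K.
rewrite mulrDr mulr1 in v1; lra.
Qed.

(** The targets being nested, the times [j > i] at which a given point [z] lies in
the [j]-th target form an initial segment, of length [K] say. Carrying the
[j]-th term of the covariance sum to the time [j] by invariance, one is left
with the integral over [z] of the discrepancy of the orbit segment of length [K]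
that ends just before [z], which [birk_upper] bounds from above. *)
Let cov_le N i : (0 < i <= N)%N ->
  \sum_(i.+1 <= j < N.+1) (Int (fun x => ind i (iter i T x) * ind j (iter j T x)) - a i * a j)
  <= a i * (2 + a i * (cl i)%:R / xi) + \sum_(cl i <= m < N.+1) (ns (idx m))%:R^-1 * a m
     + 2 / xi * a i * (\sum_(0 <= m < N0 i) a (i.+1 + m)%N)
     + th i * \sum_(1 <= j < N.+1) a j.
Proof.
move=> /andP[i0 iN].
have Iind j : Int (ind j) = a j by rewrite (Int_target (tA j)) aE.
pose Gj m z := ind (i.+1 + m) z * (ind i (iter m.+1 S z) - a i).
have bG m : bmeas (Gj m).
  by apply: bmeasM => //; apply: bmeasB; [exact: bindS|exact: bmeas_cst].
have IG m : Int (Gj m) = Int (fun x => ind i (iter i T x) * ind (i.+1 + m) (iter (i.+1 + m) T x))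
    - a i * a (i.+1 + m)%N.
  have -> : Int (Gj m) = Int (fun z => ind i (iter m.+1 S z) * ind (i.+1 + m) z)
      - Int (fun z => a i * ind (i.+1 + m) z).
    rewrite -IntB; [|by apply: bmeasM; [exact: bindS|exact: bind]|exact: bmeasZ].
    by apply: eq_Int => z _; rewrite /Gj; ring.
  rewrite IntZ // Iind; congr (_ - _).
  rewrite -(@Int_iter _ T S D E (fun z => ind i (iter m.+1 S z) * ind (i.+1 + m) z) (i.+1 + m)); last first.
    by apply: bmeasM; [exact: bindS|exact: bind].
  apply: eq_Int => z _; congr (ind i _ * _).
  by rewrite addSnnS addnC iterD (iterTK E).
have -> : \sum_(i.+1 <= j < N.+1) (Int (fun x => ind i (iter i T x) * ind j (iter j T x)) - a i * a j)
    = Int (fun z => \sum_(0 <= m < N - i) Gj m z).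
  rewrite Int_sum // -{1}[i.+1]add0n big_addn subSS; apply: eq_bigr => m _.
  by rewrite IG addnC.
pose V z := (2 + a i * (cl i)%:R / xi) * ind i z
  + (\sum_(cl i <= m < N.+1) (ns (idx m))%:R^-1 * ind m z)
  + (2 / xi * a i) * (\sum_(0 <= m < N0 i) ind (i.+1 + m) z)
  + th i * \sum_(1 <= j < N.+1) ind j z.
have bV1 : bmeas (fun z => (2 + a i * (cl i)%:R / xi) * ind i z) by exact: bmeasZ.
have bV2 : bmeas (fun z => \sum_(cl i <= m < N.+1) (ns (idx m))%:R^-1 * ind m z).
  by apply: bmeas_sum => m; exact: bmeasZ.
have bV3 : bmeas (fun z => (2 / xi * a i) * (\sum_(0 <= m < N0 i) ind (i.+1 + m) z)).
  by apply: bmeasZ; exact: bmeas_sum.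
have bV4 : bmeas (fun z => th i * \sum_(1 <= j < N.+1) ind j z).
  by apply: bmeasZ; exact: bmeas_sum.
apply: (@le_trans _ _ (Int V)); last first.
  rewrite le_eqVlt; apply/orP; left; apply/eqP; rewrite /V.
  rewrite IntD //; last by apply: bmeasD => //; exact: bmeasD.
  rewrite IntD //; last exact: bmeasD.
  rewrite IntD // IntZ // Iind IntZ; last exact: bmeas_sum.
  rewrite IntZ; last exact: bmeas_sum.
  rewrite !Int_sum //; last by move=> m; exact: bmeasZ.
  rewrite [(2 + _) * _]mulrC; congr (_ + _ + _ * _ + _ * _).
  - by apply: eq_bigr => m _; rewrite IntZ // Iind.
  - by apply: eq_bigr => m _; rewrite Iind.
  - by apply: eq_bigr => m _; rewrite Iind.
apply: le_Int; first exact: bmeas_sum.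
  by rewrite /V; do !apply: bmeasD.
move=> z z01.
have anti m m' : (m <= m')%N -> z \in A (i.+1 + m') -> z \in A (i.+1 + m).
  by move=> mm; rewrite !inE; apply: nestA; rewrite leq_add2l.
have [K Kn bK] := @initial_segment (fun m => z \in A (i.+1 + m)) (N - i) anti.
have hK (F : nat -> R) : \sum_(0 <= m < N - i) ind (i.+1 + m) z * F m = \sum_(0 <= m < K) F m.
  rewrite (big_cat_nat (n := K)) //= [X in _ + X]big1_seq ?addr0 => [|m].
    apply: eq_big_nat => m /andP[_ mK]; rewrite indicE bK ?mK ?mul1r //.
    exact: leq_trans Kn.
  rewrite mem_index_iota => /andP[_ /andP[Km mN]].
  by rewrite indicE bK // ltnNge Km mul0r.
have -> : \sum_(0 <= m < N - i) Gj m z = birk T (A i) (a i) K (iter K S z).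
  rewrite /Gj hK /birk big_nat_rev /= add0n; apply: eq_big_nat => m /andP[_ mK].
  congr (ind i _ - _); rewrite -iterS subnSK //.
  by rewrite -[in RHS](subnK (ltnW mK)) addnC iterD (iterSK E).
have indV m : 0 <= (ns (idx m))%:R^-1 * ind m z by rewrite mulr_ge0 // invr_ge0.
have [K0|K0] := posnP K.
  rewrite K0 /birk big_geq // /V !addr_ge0 ?mulr_ge0 ?sumr_ge0 ?addr_ge0 //.
  - by rewrite divr_ge0 ?mulr_ge0 // ltW.
  - by rewrite invr_ge0 ltW.
have := birk_upper i0 K0 (iterS01 E K z01); move=> /le_trans; apply.
have Kz : (i.+1 + K.-1 = i + K)%N by rewrite addSnnS prednK.
have zK : A (i + K)%N z.
  have : z \in A (i.+1 + K.-1) by rewrite bK ?prednK //; apply: leq_trans Kn; rewrite prednK.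
  by rewrite inE Kz.
have zA m : (m <= i + K)%N -> ind m z = 1.
  by move=> mK; rewrite indicE mem_set //; exact: nestA zK.
have KN : (K <= N)%N by apply: leq_trans Kn _; exact: leq_subr.
rewrite /V zA ?leq_addr // mulr1 !lerD //.
- apply: (@le_trans _ _ (\sum_(cl i <= m < K.+1) (ns (idx m))%:R^-1 * ind m z)).
    apply: ler_sum_nat => m /andP[_]; rewrite ltnS => mK; rewrite zA ?mulr1 //.
    by apply: leq_trans mK _; rewrite leq_addl.
  exact: sum_nat_sub.
- apply: ler_wpM2l; first by apply: mulr_ge0 => //; exact: divr_ge0 (ltW xi0).
  apply: (@le_trans _ _ (\sum_(0 <= m < minn K (N0 i)) ind (i.+1 + m) z)).
    rewrite (eq_big_nat _ _ (F2 := fun=> 1)) ?sumr_const_nat ?subn0 // => m /andP[_].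
    rewrite leq_min => /andP[mK _]; rewrite zA // addSnnS leq_add2l //.
  by apply: sum_nat_sub => //; exact: geq_minr.
- rewrite mulrC; apply: ler_wpM2l => //.
  apply: (@le_trans _ _ (\sum_(1 <= j < K.+1) ind j z)).
    rewrite (eq_big_nat _ _ (F2 := fun=> 1)) ?sumr_const_nat ?subn1 // => m /andP[_]; rewrite ltnS => mK.
    by rewrite zA //; apply: leq_trans mK _; rewrite leq_addl.
  exact: sum_nat_sub.
Qed.

Context (r : nat -> R) (Th : R).
Hypothesis ar : forall j, (0 < j)%N -> a j <= r j.
Hypothesis thT : forall N, \sum_(1 <= i < N.+1) th i <= Th.

Let r0 j : (0 < j)%N -> 0 <= r j.
Proof. by move=> j0; apply: le_trans (a0 j) (ar j0). Qed.

Lemma variance_bound N :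
  Int (fun x => (\sum_(1 <= j < N.+1) (ind j (iter j T x) - a j)) ^+ 2) <=
   (7 + 2 * Th + 4 / xi) * (\sum_(1 <= i < N.+1) r i +
     \sum_(1 <= i < N.+1) (r i ^+ 2 * (cl i)%:R +
        r i * \sum_(0 <= m < N0 i) r (i.+1 + m)%N)).
Proof.
have Iind j : Int (ind j) = a j by rewrite (Int_target (tA j)) aE.
have b1 j : bmeas (fun x => ind j (iter j T x) - a j).
  by apply: bmeasB; [exact: bindT|exact: bmeas_cst].
have bb i j : bmeas (fun x => ind i (iter i T x) * ind j (iter j T x)).
  by apply: bmeasM; exact: bindT.
have II i j : Int (fun x => (ind i (iter i T x) - a i) * (ind j (iter j T x) - a j)) =
    Int (fun x => ind i (iter i T x) * ind j (iter j T x)) - a i * a j.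
  have -> : Int (fun x => (ind i (iter i T x) - a i) * (ind j (iter j T x) - a j)) =
     Int (fun x => ind i (iter i T x) * ind j (iter j T x) -
       (a i * ind j (iter j T x) + (a j * ind i (iter i T x) - a i * a j))).
    by apply: eq_Int => x _; ring.
  rewrite IntB //; last first.
    by apply: bmeasD; [exact: bmeasZ|apply: bmeasB; [exact: bmeasZ|exact: bmeas_cst]].
  rewrite IntD; [|exact: bmeasZ|by apply: bmeasB; [exact: bmeasZ|exact: bmeas_cst]].
  rewrite IntB; [|exact: bmeasZ|exact: bmeas_cst].
  rewrite Int_cst (IntZ _ (bindT j j)) (IntZ _ (bindT i i)).
  rewrite (Int_iter E j (bind j)) (Int_iter E i (bind i)) !Iind; ring.
under eq_Int do rewrite sqr_sum_split.
rewrite IntD; last 2 first.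
- by apply: bmeas_sum => i; exact: bmeasX.
- apply: bmeasZ; apply: bmeas_sum => i; apply: bmeas_sum => j; exact: bmeasM.
rewrite IntZ; last by apply: bmeas_sum => i; apply: bmeas_sum => j; exact: bmeasM.
rewrite Int_sum; last by move=> i; exact: bmeasX.
rewrite Int_sum; last by move=> i; apply: bmeas_sum => j; exact: bmeasM.
set SR := \sum_(1 <= i < N.+1) r i.
set SU1 := \sum_(1 <= i < N.+1) r i ^+ 2 * (cl i)%:R.
set SU2 := \sum_(1 <= i < N.+1) r i * \sum_(0 <= m < N0 i) r (i.+1 + m)%N.
have xp := xi0.
have SR0 : 0 <= SR by rewrite /SR big_nat_cond; apply: sumr_ge0 => j /andP[/andP[? _] _]; exact: r0.
have SU10 : 0 <= SU1.
  by rewrite /SU1 big_nat_cond; apply: sumr_ge0 => j _; rewrite mulr_ge0 ?sqr_ge0.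
have SU20 : 0 <= SU2.
  rewrite /SU2 big_nat_cond; apply: sumr_ge0 => j /andP[/andP[j0 _] _].
  by rewrite mulr_ge0 ?r0 // sumr_ge0 // => m _; exact: r0.
have diag : \sum_(1 <= i < N.+1) Int (fun x => (ind i (iter i T x) - a i) ^+ 2) <= SR.
  apply: ler_sum_nat => i /andP[i0 _]; apply: le_trans (ar i0).
  under eq_Int do rewrite expr2.
  rewrite II.
  have -> : Int (fun x => ind i (iter i T x) * ind i (iter i T x)) = Int (fun x => ind i (iter i T x)).
    by apply: eq_Int => x _; rewrite indicE; case: (_ \in _); rewrite ?mul1r ?mul0r.
  rewrite (Int_iter E i (bind i)) Iind; have := sqr_ge0 (a i); lra.
have aSR : \sum_(1 <= j < N.+1) a j <= SR by apply: ler_sum_nat => j /andP[j0 _]; exact: ar.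
have off : \sum_(1 <= i < N.+1) Int (fun x => \sum_(i.+1 <= j < N.+1)
     (ind i (iter i T x) - a i) * (ind j (iter j T x) - a j)) <=
   3 * SR + SU1 / xi + 2 / xi * SU2 + Th * SR.
  apply: (@le_trans _ _ (\sum_(1 <= i < N.+1) (2 * r i + r i ^+ 2 * (cl i)%:R / xi
      + (\sum_(cl i <= m < N.+1) (ns (idx m))%:R^-1 * a m)
      + 2 / xi * (r i * \sum_(0 <= m < N0 i) r (i.+1 + m)%N) + th i * SR))).
    apply: ler_sum_nat => i /andP[i0 iN].
    rewrite Int_sum; last by move=> j; exact: bmeasM.
    under eq_bigr do rewrite II.
    apply: le_trans (cov_le (N := N) _) _; first by rewrite i0.
    have ai := a0 i; have ari := ar i0; have ri := r0 i0.
    have e1 : a i * (2 + a i * (cl i)%:R / xi) <= 2 * r i + r i ^+ 2 * (cl i)%:R / xi.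
      have : a i * a i * ((cl i)%:R / xi) <= r i ^+ 2 * ((cl i)%:R / xi).
        by apply: ler_wpM2r; [exact: divr_ge0 (ltW xp)|rewrite expr2 ler_pM].
      lra.
    have e3 : 2 / xi * a i * (\sum_(0 <= m < N0 i) a (i.+1 + m)%N) <=
        2 / xi * (r i * \sum_(0 <= m < N0 i) r (i.+1 + m)%N).
      rewrite -mulrA; apply: ler_wpM2l; first exact: divr_ge0 (ltW xp).
      apply: ler_pM => //; first by apply: sumr_ge0.
      by apply: ler_sum => m _; exact: ar.
    have e4 : th i * \sum_(1 <= j < N.+1) a j <= th i * SR by rewrite ler_wpM2l.
    lra.
  rewrite !big_split /= -!mulr_suml -!mulr_sumr -/SR -/SU1 -/SU2.
  (* For each [m] fewer than [ns (idx m)] indices [i] contribute, each [a m / ns (idx m)]. *)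
  have w : \sum_(1 <= i < N.+1) \sum_(cl i <= m < N.+1) (ns (idx m))%:R^-1 * a m <= SR.
    apply: le_trans aSR.
    have wm m : 0 <= (ns (idx m))%:R^-1 * a m by rewrite mulr_ge0 // invr_ge0.
    apply: (@le_trans _ _ (\sum_(1 <= i < N.+1) \sum_(1 <= m < N.+1)
        (if (i < ns (idx m))%N then (ns (idx m))%:R^-1 * a m else 0))).
      apply: ler_sum_nat => i /andP[i0 _].
      apply: (@le_trans _ _ (\sum_(cl i <= m < N.+1)
         (if (i < ns (idx m))%N then (ns (idx m))%:R^-1 * a m else 0))).
        apply: ler_sum_nat => m /andP[cm _]; rewrite ifT //.
        have m0 : (0 < m)%N by apply: leq_trans cm; exact: (ns_gt0 Hns).
        have /andP[_ mi] := idxP m0; have /andP[_ ii] := idxP i0.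
        apply: leq_trans ii _; apply: (ns_mono Hns); rewrite ltnNge; apply/negP => h.
        have : (ns (idx m).+1 <= ns (idx i).+1)%N by exact: (ns_mono Hns).
        by move=> h'; have := leq_trans mi (leq_trans h' cm); rewrite ltnn.
      by apply: sum_nat_sub => //; [move=> m; case: ifP|exact: (ns_gt0 Hns)].
    rewrite exchange_big /=; apply: ler_sum_nat => m /andP[m0 _].
    rewrite -big_mkcond /=.
    have nm0 : 0 < (ns (idx m))%:R :> R by rewrite ltr0n (ns_gt0 Hns).
    apply: (@le_trans _ _ (\sum_(0 <= i < ns (idx m)) (ns (idx m))%:R^-1 * a m)); last first.
      by rewrite sumr_const_nat subn0 -(mulr_natl (_ * _)) mulrA mulfV ?gt_eqF // mul1r.
    apply: (@le_trans _ _ (\sum_(0 <= i < N.+1) (if (i < ns (idx m))%N then (ns (idx m))%:R^-1 * a m else 0))).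
      by rewrite big_mkcond /=; apply: sum_nat_sub => // i; case: ifP.
    exact: sum_nat_below.
  have tt : (\sum_(1 <= i < N.+1) th i) * SR <= Th * SR by rewrite ler_wpM2r.
  lra.
rewrite big_split /= -/SU1 -/SU2.
have Th0 : 0 <= Th by apply: le_trans (thT 0); rewrite big_geq.
have p1 : 0 <= SU1 / xi by rewrite divr_ge0 // ltW.
have p2 : 0 <= SU2 / xi by rewrite divr_ge0 // ltW.
have p3 : 0 <= SR / xi by rewrite divr_ge0 // ltW.
have p4 : 0 <= Th * SU1 by rewrite mulr_ge0.
have p5 : 0 <= Th * SU2 by rewrite mulr_ge0.
apply: le_trans (lerD diag (ler_wpM2l (_ : 0 <= 2) off)) _ => //.
have -> : (7 + 2 * Th + 4 / xi) * (SR + (SU1 + SU2)) = 7 * SR + 7 * SU1 + 7 * SU2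
   + 2 * (Th * SR) + 2 * (Th * SU1) + 2 * (Th * SU2) + 4 * (SR / xi) + 4 * (SU1 / xi) + 4 * (SU2 / xi) by ring.
have -> : 2 / xi * SU2 = 2 * (SU2 / xi) by ring.
lra.
Qed.

End variance.

(** * Sums over blocks between consecutive good scales *)

Lemma succ_expn_le n L : (0 < n)%N -> (L.+1 ^ n <= n ^ n * 2 ^ L)%N.
Proof.
move=> n0; apply: (@leq_trans ((n * 2 ^ (L %/ n)) ^ n)).
  rewrite leq_exp2r // mulnC; apply: leq_trans (ltn_ceil L n0) _.
  by rewrite leq_mul2r ltn_expl ?orbT.
by rewrite expnMn -expnM leq_mul2l leq_exp2l // leq_trunc_div orbT.
Qed.

Section inverseSums.
Context (R : realType).

Lemma sum_inv_dyadic_le p k :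
  \sum_(2 ^ p <= i < 2 ^ (p + k)) (i%:R^-1 : R) <= k%:R.
Proof.
elim: k => [|k ih]; first by rewrite addn0 big_geq.
rewrite (big_cat_nat (n := 2 ^ (p + k))) ?leq_exp2l ?leq_addr ?addnS //=.
rewrite -natr1 lerD //.
have q0 : 0 < (2 ^ (p + k))%:R :> R by rewrite ltr0n expn_gt0.
apply: (@le_trans _ _ (\sum_(2 ^ (p + k) <= i < 2 ^ (p + k).+1) ((2 ^ (p + k))%:R^-1 : R))).
  apply: ler_sum_nat => i /andP[pi _].
  by rewrite lef_pV2 ?posrE ?ler_nat // ltr0n (leq_trans _ pi) ?expn_gt0.
by rewrite sumr_const_nat expnS mul2n -addnn addnK -(mulr_natl _^-1) mulfV ?gt_eqF.
Qed.

Lemma sum_inv_dyadic_ge p :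
  1 + p%:R / 2 <= \sum_(1 <= i < (2 ^ p).+1) (i%:R^-1 : R).
Proof.
elim: p => [|p ih]; first by rewrite mul0r addr0 big_nat1 invr1.
rewrite (big_cat_nat (n := (2 ^ p).+1)) //=; last by rewrite ltnS leq_exp2l.
rewrite -natr1 mulrDl addrA lerD //.
have q0 : 0 < (2 ^ p.+1)%:R :> R by rewrite ltr0n expn_gt0.
apply: (@le_trans _ _ (\sum_((2 ^ p).+1 <= i < (2 ^ p.+1).+1) ((2 ^ p.+1)%:R^-1 : R))); last first.
  apply: ler_sum_nat => i /andP[pi i2].
  by rewrite lef_pV2 ?posrE ?ler_nat // ltr0n (leq_trans _ pi).
rewrite sumr_const_nat subSS -(mulr_natl _^-1) expnS mul2n -addnn addnK.
rewrite natrD -mulr2n -(mulr_natl _%:R) invfM mulrCA mulfV ?mulr1 ?mul1r //.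
Qed.

Lemma sum_inv_sqr_le n m : (0 < n)%N ->
  \sum_(n <= i < m) ((i%:R ^+ 2)^-1 : R) <= 2 / n%:R.
Proof.
move=> n0; have [mn|nm] := leqP m n; first by rewrite big_geq ?divr_ge0.
apply: (@le_trans _ _ (2 / n%:R - 2 / m%:R)); last by rewrite gerBl divr_ge0.
rewrite -(subnKC (ltnW nm)); elim: (m - n)%N => [|k ih].
  by rewrite addn0 big_geq // subrr.
rewrite addnS big_nat_recr ?leq_addr //=.
have : (((n + k)%:R : R) ^+ 2)^-1 <= 2 / (n + k)%:R - 2 / (n + k).+1%:R.
  have p1 : 1 <= (n + k)%:R :> R by rewrite ler1n addn_gt0 n0.
  rewrite -(natr1 (n + k)); set z : R := (n + k)%:R in p1 *.
  have -> : 2 / z - 2 / (z + 1) = 2 / (z * (z + 1)).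
    by field; rewrite !gt_eqF //; lra.
  rewrite ler_pdivlMr; last by nra.
  rewrite mulrC ler_pdivrMr; nra.
by move/(lerD ih); rewrite addrA subrK.
Qed.

(** Telescoping, with [2 / sqrt k]. *)
Lemma sum_inv_32_le N :
  \sum_(1 <= k < N.+1) ((k%:R * Num.sqrt k%:R)^-1 : R) <= 3.
Proof.
case: N => [|N]; first by rewrite big_geq.
apply: (@le_trans _ _ (3 - 2 / Num.sqrt N.+1%:R)); last first.
  by rewrite gerBl divr_ge0 ?sqrtr_ge0.
elim: N => [|N ih]; first by rewrite big_nat1 sqrtr1; lra.
rewrite big_nat_recr //=.
have : (N.+2%:R * Num.sqrt N.+2%:R)^-1 <=
    2 / Num.sqrt N.+1%:R - 2 / Num.sqrt N.+2%:R :> R.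
  have x2 : Num.sqrt N.+1%:R ^+ 2 = N.+1%:R :> R by rewrite sqr_sqrtr.
  have y2 : Num.sqrt N.+2%:R ^+ 2 = N.+1%:R + 1 :> R by rewrite sqr_sqrtr // natr1.
  have x0 : 0 < Num.sqrt N.+1%:R :> R by rewrite sqrtr_gt0.
  have xy : Num.sqrt N.+1%:R <= Num.sqrt N.+2%:R :> R by rewrite ler_sqrt // ler_nat.
  rewrite -{1}(natr1 N.+1) -y2; move: x2 y2 x0 xy.
  set x : R := Num.sqrt N.+1%:R; set y : R := Num.sqrt N.+2%:R => x2 y2 x0 xy.
  have y0 : 0 < y by lra.
  have -> : 2 / x - 2 / y = 2 / (x * y * (x + y)).
    have yx : (y - x) * (y + x) = 1 by rewrite -subr_sqr y2 x2; ring.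
    have -> : 2 / x - 2 / y = 2 * ((y - x) * (y + x)) / (x * y * (x + y)).
      by field; rewrite !gt_eqF //; lra.
    by rewrite yx mulr1.
  have p1 : 0 < x * y * (x + y) by rewrite !mulr_gt0 // addr_gt0.
  have p2 : 0 < y ^+ 2 * y by rewrite mulr_gt0 // exprn_gt0.
  rewrite ler_pdivlMr // mulrC ler_pdivrMr //.
  have h : x * (x + y) <= 2 * y ^+ 2 by nra.
  have -> : x * y * (x + y) = x * (x + y) * y by ring.
  by rewrite mulrA ler_wpM2r // ltW.
by move/(lerD ih); rewrite addrA subrK.
Qed.

End inverseSums.

Lemma bracket (f : nat -> nat) N : (forall k, (f k < f k.+1)%N) -> (f 0 <= N)%N ->
  exists k, (f k <= N < f k.+1)%N.
Proof.
move=> fS f0; have fk k : (k <= f k)%N by elim: k => [|k ih] //; exact: leq_ltn_trans (fS k).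
have ex : exists k, (N < f k)%N by exists N.+1; exact: fk.
have := find_ex_minn ex; case=> s Ns smin; case: s Ns smin => [|s] Ns smin.
  by move: Ns; rewrite ltnNge f0.
exists s; rewrite Ns andbT leqNgt; apply/negP => h.
by have := smin _ h; rewrite ltnn.
Qed.

Lemma nat_seq_mono (f : nat -> nat) j k : (forall k, (f k < f k.+1)%N) -> (j <= k)%N -> (f j <= f k)%N.
Proof.
move=> fS jk; rewrite -(subnKC jk); elim: (_ - _)%N => [|i ih]; first by rewrite addn0.
by rewrite addnS (leq_trans ih) // ltnW.
Qed.

Section blocks.
Context (R : realType) (ns e idx : nat -> nat).
Hypothesis nsE : forall s, ns s = (2 ^ e s)%N.
Hypothesis e0 : e 0 = 0%N.
Hypothesis e_lt : forall s, (e s < e s.+1)%N.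
Hypothesis idxP : forall m, (0 < m)%N -> (ns (idx m) <= m < ns (idx m).+1)%N.

Lemma exponent_mono s t : (s <= t)%N -> (e s <= e t)%N.
Proof. exact: nat_seq_mono. Qed.

Lemma exponent_ge s : (s <= e s)%N.
Proof. by elim: s => [|s ih] //; exact: leq_ltn_trans (e_lt s). Qed.

Lemma index_unique s m : (ns s <= m < ns s.+1)%N -> idx m = s.
Proof.
move=> /andP[sm ms]; have m0 : (0 < m)%N by rewrite (leq_trans _ sm) // nsE expn_gt0.
have /andP[im mi] := idxP m0.
have lt t t' : (ns t < ns t'.+1)%N -> (t <= t')%N.
  rewrite !nsE ltn_exp2l // => h; rewrite leqNgt; apply/negP => /exponent_mono h'.
  by have := leq_trans h h'; rewrite ltnn.
apply/eqP; rewrite eqn_leq; apply/andP; split; apply: lt; first exact: leq_ltn_trans ms.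
exact: leq_ltn_trans mi.
Qed.

Lemma sum_blocks_le (F : nat -> R) (G : nat -> R) W N :
  (forall i, (0 < i)%N -> 0 <= F i) ->
  (forall s, \sum_(ns s <= i < ns s.+1) F i <= G s) ->
  (forall n, \sum_(0 <= s < n) G s <= W) ->
  \sum_(1 <= i < N.+1) F i <= W.
Proof.
move=> F0 FG GW; apply: le_trans (GW N.+1).
have step n : \sum_(1 <= i < ns n) F i <= \sum_(0 <= s < n) G s.
  elim: n => [|n ih]; first by rewrite nsE e0 !big_geq.
  rewrite (big_cat_nat (n := ns n)) /=; first by rewrite big_nat_recr //= lerD.
    by rewrite nsE expn_gt0.
  by rewrite !nsE leq_exp2l // ltnW.
apply: le_trans (step N.+1).
have NN : (N.+1 <= ns N.+1)%N.
  by rewrite nsE (leq_trans (exponent_ge _)) // ltnW // ltn_expl.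
rewrite [leRHS](big_cat_nat (n := N.+1)) //= lerDl big_nat_cond.
by apply: sumr_ge0 => i /andP[/andP[h _] _]; apply: F0; exact: leq_trans h.
Qed.

Context (W : R).
Hypothesis W_bound : forall n,
  \sum_(0 <= s < n) (2 ^ (e s.+1 - e s))%:R / s.+1%:R ^+ 2 <= W.

Local Notation lg s := (trunc_log 2 s.+1).

Lemma lg_bounds s : (2 ^ lg s <= s.+1 < 2 ^ (lg s).+1)%N.
Proof. exact: trunc_log_bounds. Qed.

Lemma lg_lt s : (lg s < s.+1)%N.
Proof. by have /andP[h _] := lg_bounds s; apply: leq_trans h; exact: ltn_expl. Qed.

(** A convergent series has bounded terms, so that the ratio of two consecutive
scales grows at most quadratically. *)
Lemma gap_le : exists B, forall s, (e s.+1 - e s <= B + 2 * lg s)%N.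
Proof.
pose K := (Num.truncn W).+1; have WK : W < K%:R by exact: truncnS_gt.
exists (K + 2)%N => s.
have t1 : (2 ^ (e s.+1 - e s))%:R / s.+1%:R ^+ 2 <= W.
  apply: le_trans (W_bound s.+1); rewrite big_nat_recr //= lerDr.
  by apply: sumr_ge0 => i _; rewrite divr_ge0 ?exprn_ge0.
have t2 : (2 ^ (e s.+1 - e s) < K * s.+1 ^ 2)%N.
  rewrite -(ltr_nat R) natrM (natrX _ s.+1) -ltr_pdivrMr ?exprn_gt0 //.
  exact: le_lt_trans t1 WK.
have /andP[_ h] := lg_bounds s.
have t3 : (2 ^ (e s.+1 - e s) < 2 ^ (K + 2 + 2 * lg s))%N.
  apply: leq_trans t2 _; rewrite -addnA expnD leq_mul //; first exact: ltnW (ltn_expl _ _).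
  have -> : (2 + 2 * lg s = (lg s).+1 * 2)%N by lia.
  by rewrite expnM leq_exp2r // ltnW.
by rewrite ltnW //; move: t3; rewrite ltn_exp2l.
Qed.

Lemma lg_far c : exists g, forall s t, (t <= s + c * s.+1)%N -> (lg t <= g + lg s)%N.
Proof.
exists (c.+1).+1 => s t ts.
have /andP[h _] := lg_bounds t; have /andP[_ h'] := lg_bounds s.
have : (2 ^ lg t < 2 ^ (c.+2 + lg s).+1)%N.
  rewrite -addnS expnD.
  apply: leq_ltn_trans h _; apply: (@leq_ltn_trans (c.+1 * s.+1)).
    by rewrite mulSn addSn ltnS.
  by apply: ltn_mul h'; apply: ltn_trans (ltn_expl _ (ltnSn 1)) _; rewrite ltn_exp2l.
by rewrite ltn_exp2l.
Qed.

Lemma far_exponent_le c : exists B, forall s,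
  (e (s + c * (lg s).+1) + 1 - e s <= B * (lg s).+1 ^ 2)%N.
Proof.
have [B gapB] := gap_le; have [g lgg] := lg_far c.
exists (c * (B + 2 * g + 2) + 1)%N => s.
have h k : (k <= c * (lg s).+1)%N -> (e (s + k) <= e s + k * (B + 2 * (g + lg s)))%N.
  elim: k => [|k ih] kc; first by rewrite addn0 leq_addr.
  have := ih (ltnW kc); have := gapB (s + k)%N.
  have : (lg (s + k) <= g + lg s)%N.
    apply: lgg; rewrite leq_add2l (leq_trans (ltnW kc)) // leq_mul2l lg_lt orbT //.
  rewrite addnS mulSn; lia.
have := h _ (leqnn _); nia.
Qed.

End blocks.

Lemma lg_pow_le (R : realType) n s : (0 < n)%N ->
  ((trunc_log 2 s.+1).+1 ^ n)%:R <= (n + n)%:R ^+ n * Num.sqrt s.+1%:R :> R.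
Proof.
move=> n0; have := @succ_expn_le (n + n) (trunc_log 2 s.+1).
rewrite addn_gt0 n0 => /(_ isT) h.
have /andP[h' _] := lg_bounds s.
have sE (x : R) : 0 <= x -> x = Num.sqrt (x ^+ 2) by move=> x0; rewrite sqrtr_sqr ger0_norm.
rewrite [leLHS]sE // [X in X * _]sE ?exprn_ge0 // -sqrtrM ?sqr_ge0 //.
rewrite ler_sqrt ?mulr_ge0 ?sqr_ge0 // natrX -!exprM muln2 -addnn -!natrX -natrM ler_nat.
by apply: leq_trans h _; rewrite leq_mul2l h' orbT.
Qed.

Lemma small_power (R : realType) (tau : R) : 0 < tau < 1 -> exists c, tau ^+ c <= 4^-1.
Proof.
move=> /andP[t0 t1].
have /cvgrPdist_le/(_ 4^-1) : (fun n => tau ^+ n) @ \oo --> 0.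
  by apply: cvg_expr; rewrite ger0_norm // ltW.
move=> /(_ _)[|c _ h]; first by rewrite invr_gt0.
by exists c; have := h c (leqnn c); rewrite sub0r normrN ger0_norm // exprn_ge0 // ltW.
Qed.

Section khinchinSums.
Context (R : realType) (ns e idx : nat -> nat).
Hypothesis nsE : forall s, ns s = (2 ^ e s)%N.
Hypothesis e0 : e 0 = 0%N.
Hypothesis e_lt : forall s, (e s < e s.+1)%N.
Hypothesis idxP : forall m, (0 < m)%N -> (ns (idx m) <= m < ns (idx m).+1)%N.
Context (W : R).
Hypothesis W_bound : forall n,
  \sum_(0 <= s < n) (2 ^ (e s.+1 - e s))%:R / s.+1%:R ^+ 2 <= W.

Local Notation lg s := (trunc_log 2 s.+1).

Let ns0 s : (0 < ns s)%N. Proof. by rewrite nsE expn_gt0. Qed.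

Let emono s t : (s <= t)%N -> (e s <= e t)%N. Proof. exact: exponent_mono. Qed.

Let block_idx i s : (ns s <= i < ns s.+1)%N -> idx i = s. Proof. exact: index_unique. Qed.

Let sum_block_inv s : \sum_(ns s <= i < ns s.+1) (i%:R^-1 : R) <= (e s.+1 - e s)%:R.
Proof.
rewrite !nsE -[in leLHS](subnKC (ltnW (e_lt s))); exact: sum_inv_dyadic_le.
Qed.

(** The choice of [c] makes the decay over [c log s] scales beat the ratios of
consecutive scales, so that the rates are summable. *)
Lemma sum_decay_le (C tau : R) c : 0 <= C -> 0 < tau -> tau ^+ c <= 4^-1 -> forall N,
  \sum_(1 <= i < N.+1) C * tau ^+ (c * (lg (idx i)).+1) / i%:R <= C * W.
Proof.
move=> C0 t0 tc N.
apply: (sum_blocks_le nsE e0 e_lt (G := fun s => C * ((2 ^ (e s.+1 - e s))%:R / s.+1%:R ^+ 2))).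
- by move=> i _; rewrite divr_ge0 // mulr_ge0 // exprn_ge0 // ltW.
- move=> s.
  apply: (@le_trans _ _ (\sum_(ns s <= i < ns s.+1) C * tau ^+ (c * (lg s).+1) * i%:R^-1)).
    by apply: ler_sum_nat => i /block_idx ->.
  rewrite -mulr_sumr -mulrA; apply: ler_wpM2l => //.
  rewrite [leRHS]mulrC; apply: ler_pM.
  + by rewrite exprn_ge0 // ltW.
  + by apply: sumr_ge0 => i _; rewrite invr_ge0.
  + rewrite exprM; apply: (@le_trans _ _ (4^-1 ^+ (lg s).+1)).
      by rewrite lerXn2r ?nnegrE ?exprn_ge0 // ltW.
    rewrite exprVn lef_pV2 ?posrE ?exprn_gt0 //.
    have /andP[_ h] := lg_bounds s.
    have -> : 4 = 2 ^+ 2 :> R by rewrite expr2; ring.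
    rewrite -exprM mulnC exprM lerXn2r ?nnegrE ?exprn_ge0 //.
    by rewrite -natrX ler_nat ltnW.
  + apply: le_trans (sum_block_inv s) _.
    by rewrite ler_nat ltnW // ltn_expl.
- by move=> n; rewrite -mulr_sumr ler_wpM2l.
Qed.

Context (c : nat) (r : nat -> R).
Hypothesis c0 : (0 < c)%N.
Hypothesis r_gt0 : forall j, (0 < j)%N -> 0 < r j.
Hypothesis r_mono : forall i j, (0 < i)%N -> (i <= j)%N -> j%:R * r j <= i%:R * r i.

Local Notation N0 i := (ns (idx i + c * (lg (idx i)).+1)).
Local Notation EE i := (\sum_(1 <= j < i.+1) r j).
Local Notation u i := (r i ^+ 2 * (ns (idx i).+1)%:R + r i * \sum_(0 <= m < N0 i) r (i.+1 + m)%N).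

(* Since [j r_j] is nonincreasing, [phi s / j] compares with [r j] on either side of
   [ns s]. *)
Let phi s := (ns s)%:R * r (ns s).

Let phi_gt0 s : 0 < phi s. Proof. by rewrite mulr_gt0 ?ltr0n ?r_gt0. Qed.

Let r_le s i : (ns s <= i)%N -> r i <= phi s / i%:R.
Proof.
move=> si; have i0 : (0 < i)%N by exact: leq_trans si.
by rewrite ler_pdivlMr ?ltr0n // mulrC; exact: r_mono.
Qed.

(* For [j <= ns s] one has [r j >= phi s / j], and the harmonic sum up to
   [ns s >= 2 ^ s] is at least [1 + s / 2]. *)
Let E_ge s i : (ns s <= i)%N -> phi s * (s.+1%:R / 2) <= EE i.
Proof.
move=> si; apply: (@le_trans _ _ (EE (ns s))); last first.
  rewrite [leRHS](big_cat_nat (n := (ns s).+1)) //= lerDl big_nat_cond.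
  by apply: sumr_ge0 => j /andP[/andP[h _] _]; apply: ltW; apply: r_gt0; exact: leq_ltn_trans h.
apply: (@le_trans _ _ (phi s * \sum_(1 <= j < (ns s).+1) j%:R^-1)).
  apply: ler_wpM2l; first exact: ltW.
  rewrite nsE; apply: le_trans (sum_inv_dyadic_ge _ _).
  have : s%:R <= (e s)%:R :> R by rewrite ler_nat (exponent_ge e_lt).
  by rewrite -(natr1 s); lra.
rewrite mulr_sumr; apply: ler_sum_nat => j /andP[j0 js].
by rewrite ler_pdivrMr ?ltr0n // mulrC; apply: r_mono.
Qed.

(* The binary logarithm of twice the ratio of the waiting time to the beginning of
   the [s]-th block. *)
Let Lam s := (e (s + c * (lg s).+1) + 1 - e s)%N.

Let gap_Lam s : (e s.+1 - e s <= Lam s)%N.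
Proof.
apply: leq_sub2r; apply: (@leq_trans (e (s + c * (lg s).+1))%N); last exact: leq_addr.
by apply: emono; rewrite -addn1 leq_add2l muln_gt0 c0.
Qed.

Let window_le s i : (ns s <= i < ns s.+1)%N ->
  \sum_(0 <= m < ns (s + c * (lg s).+1)) r (i.+1 + m)%N <= phi s * (Lam s)%:R.
Proof.
move=> /andP[si is1]; set n' := ns _.
apply: (@le_trans _ _ (phi s * \sum_(0 <= m < n') (i.+1 + m)%:R^-1)).
  rewrite mulr_sumr; apply: ler_sum => m _; apply: r_le.
  by rewrite (leq_trans si) // addSn leqW // leq_addr.
apply: ler_wpM2l; first exact: ltW.
have -> : \sum_(0 <= m < n') ((i.+1 + m)%:R^-1 : R) = \sum_(i.+1 <= j < i.+1 + n') j%:R^-1.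
  rewrite -{2}[i.+1]add0n big_addn addKn; apply: eq_bigr => m _; by rewrite addnC.
have n1 : (ns s.+1 <= n')%N.
  by rewrite /n' !nsE leq_exp2l // emono // -addn1 leq_add2l muln_gt0 c0.
apply: (@le_trans _ _ (\sum_(2 ^ e s <= j < 2 ^ (e s + Lam s)) j%:R^-1)).
  apply: sum_nat_sub => //; first by rewrite -nsE leqW.
  rewrite /Lam subnKC; last first.
    by apply: leq_trans (_ : (e (s + c * (lg s).+1) <= _)%N); [exact/emono/leq_addr|exact: leq_addr].
  rewrite addn1 expnS mul2n -addnn -nsE -/n' leq_add2r (leq_trans _ n1) //.
exact: sum_inv_dyadic_le.
Qed.

Let block_le s : \sum_(ns s <= i < ns s.+1) u i / EE i ^+ 2 <=
  8 * ((2 ^ (e s.+1 - e s))%:R / s.+1%:R ^+ 2) + 4 * ((Lam s)%:R ^+ 2 / s.+1%:R ^+ 2).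
Proof.
have ph := phi_gt0 s; have s1 : 0 < s.+1%:R :> R by [].
have nsp i : (ns s <= i)%N -> 0 < i%:R :> R by move=> h; rewrite ltr0n (leq_trans _ h).
set k : R := 4 / s.+1%:R ^+ 2.
have k0 : 0 <= k by rewrite divr_ge0 ?exprn_ge0.
apply: (@le_trans _ _ (\sum_(ns s <= i < ns s.+1)
   k * ((ns s.+1)%:R * (i%:R ^+ 2)^-1 + (Lam s)%:R * i%:R^-1))).
  apply: ler_sum_nat => i si; have /andP[ni _] := si; rewrite (block_idx si).
  have ip := nsp i ni; have ri := r_le ni.
  have i0 : (0 < i)%N by rewrite -(ltr_nat R).
  have rp := r_gt0 i0.
  have x0 : 0 < phi s * (s.+1%:R / 2) by rewrite mulr_gt0 // divr_gt0.
  have EEp : 0 < EE i by exact: lt_le_trans (E_ge ni).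
  rewrite ler_pdivrMr ?exprn_gt0 //.
  have uu : r i ^+ 2 * (ns s.+1)%:R + r i * \sum_(0 <= m < ns (s + c * (lg s).+1)) r (i.+1 + m)%N <=
     phi s ^+ 2 * ((ns s.+1)%:R * (i%:R ^+ 2)^-1 + (Lam s)%:R * i%:R^-1).
    rewrite mulrDr; apply: lerD.
      have -> : phi s ^+ 2 * ((ns s.+1)%:R * (i%:R ^+ 2)^-1) = (phi s / i%:R) ^+ 2 * (ns s.+1)%:R.
        by rewrite expr_div_n; ring.
      have q0 : 0 <= phi s / i%:R by exact: ltW (divr_gt0 ph ip).
      by apply: ler_wpM2r => //; rewrite lerXn2r // nnegrE ltW.
    have -> : phi s ^+ 2 * ((Lam s)%:R * i%:R^-1) = (phi s / i%:R) * (phi s * (Lam s)%:R) by ring.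
    apply: ler_pM (window_le si) => //; first exact: ltW.
    by rewrite sumr_ge0 // => m _; rewrite ltW // r_gt0.
  apply: le_trans uu _.
  set Z := (_ * _ + _ * _).
  have Z0 : 0 <= Z by rewrite addr_ge0 // mulr_ge0 // invr_ge0 ?sqr_ge0.
  have -> : phi s ^+ 2 * Z = k * Z * (phi s * (s.+1%:R / 2)) ^+ 2.
    by rewrite /k; field; rewrite gt_eqF.
  apply: ler_wpM2l; first exact: mulr_ge0.
  rewrite lerXn2r ?nnegrE ?(ltW x0) ?(ltW EEp) //; exact: E_ge.
rewrite -mulr_sumr big_split /= -!mulr_sumr.
have t1 : (ns s.+1)%:R * \sum_(ns s <= i < ns s.+1) (i%:R ^+ 2)^-1 <= 2 * (2 ^ (e s.+1 - e s))%:R :> R.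
  apply: (@le_trans _ _ ((ns s.+1)%:R * (2 / (ns s)%:R))).
    by apply: ler_wpM2l => //; exact: sum_inv_sqr_le.
  rewrite mulrCA ler_wpM2l // ler_pdivrMr ?ltr0n // -natrM ler_nat !nsE -expnD subnK //.
  exact: ltnW.
have t2 : (Lam s)%:R * \sum_(ns s <= i < ns s.+1) i%:R^-1 <= (Lam s)%:R ^+ 2 :> R.
  rewrite expr2; apply: ler_wpM2l => //; apply: le_trans (sum_block_inv s) _.
  by rewrite ler_nat.
apply: le_trans (ler_wpM2l k0 (lerD t1 t2)) _.
by rewrite /k le_eqVlt; apply/orP; left; apply/eqP; ring.
Qed.

(** On the [s]-th block, where [r i <= phi s / i] and [E_i >= phi s (s + 1) / 2], the
terms sum up to at most a multiple of the ratio of the two scales over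
[(s + 1)^2] and of a power of [log s] over [(s + 1)^2]. *)
Lemma sum_error_le : exists U, forall N, \sum_(1 <= i < N.+1) u i / EE i ^+ 2 <= U.
Proof.
have [B LB] := far_exponent_le e0 W_bound c.
pose H : R := (4 + 4)%:R ^+ 4.
exists (8 * W + 4 * (B%:R ^+ 2 * H) * 3) => N.
apply: (sum_blocks_le nsE e0 e_lt _ _ block_le).
  move=> i i0; apply: divr_ge0; last exact: sqr_ge0.
  have ri := ltW (r_gt0 i0).
  rewrite addr_ge0 // mulr_ge0 ?sqr_ge0 //.
  by apply: sumr_ge0 => m _; rewrite ltW ?r_gt0.
move=> n; rewrite big_split /= -!mulr_sumr; apply: lerD; first by rewrite ler_wpM2l.
rewrite -mulrA; apply: ler_wpM2l => //.
have H0 : 0 <= B%:R ^+ 2 * H :> R by rewrite mulr_ge0 // ?exprn_ge0.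
apply: (@le_trans _ _ (\sum_(0 <= s < n) B%:R ^+ 2 * H * (s.+1%:R * Num.sqrt s.+1%:R)^-1)).
  apply: ler_sum_nat => s _.
  have s0 : 0 < s.+1%:R :> R by [].
  have q2 : Num.sqrt s.+1%:R ^+ 2 = s.+1%:R :> R by rewrite sqr_sqrtr.
  have q0 : 0 < Num.sqrt s.+1%:R :> R by rewrite sqrtr_gt0.
  have L2 : (Lam s)%:R ^+ 2 <= B%:R ^+ 2 * H * Num.sqrt s.+1%:R :> R.
    apply: (@le_trans _ _ ((B * (lg s).+1 ^ 2)%:R ^+ 2)).
      by rewrite lerXn2r ?nnegrE // ler_nat; exact: LB.
    rewrite natrM exprMn -mulrA ler_wpM2l ?sqr_ge0 //.
    by rewrite -natrX -expnM; exact: (@lg_pow_le R 4 s).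
  rewrite ler_pdivrMr ?exprn_gt0 //; apply: le_trans L2 _.
  rewrite le_eqVlt; apply/orP; left; apply/eqP.
  move: q2 q0 s0; set q := Num.sqrt _; set z := _.+1%:R => <- q0 s0.
  by field; rewrite gt_eqF.
rewrite -mulr_sumr; apply: ler_wpM2l => //.
by have := sum_inv_32_le R n; rewrite big_add1.
Qed.

End khinchinSums.

(** * From the growth conditions to a second moment bound *)

Lemma scale_seq_of_is_nseq (R : realType) (d : nat) (l : 'I_d -> R) (pi : 'S_d) xi n :
  0 < xi -> is_nseq l pi xi n -> scale_seq (iet l pi) (disc l) xi n.
Proof.
move=> xi0 [n0 nS].
have key s : exists k, [/\ n s.+1 = (2 ^ k)%N, (n s < n s.+1)%N &
    xi / 2 ^+ k < e_T l pi (2 * 2 ^ k)].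
  by have [[k [nk nlt h]] _] := nS s; exists k.
split => //.
- case=> [|s]; first by exists 0%N.
  by have [k [nk _ _]] := key s; exists k.
- by move=> s; have [k []] := key s.
move=> s; have [k [nk _ h]] := key s.
exists (e_T l pi (2 * n s.+1)); last by rewrite nk natrX.
have e0 : 0 < e_T l pi (2 * 2 ^ k) by apply: lt_trans h; rewrite divr_gt0 ?exprn_gt0.
rewrite nk; move: e0; rewrite /e_T; case: asboolP => [_|nc]; first by rewrite ltxx.
set X := [set t | _] => X0.
split => //; first by rewrite expn_gt0.
  have : X !=set0 by apply/set0P/eqP => XE; move: X0; rewrite XE inf0 ltxx.
  by move=> [t [p [q [[i [_ pD]] _ _ _]]]]; exists (iter i (iet l pi) p); move: pD; rewrite inE.
move=> p q [_ [i [im pD]]] [_ [j [jm qD]]] pq; apply: ge_inf.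
  by exists 0 => t [p' [q' [_ _ _ ->]]].
exists p, q; split => //; first by exists i; rewrite inE.
by exists j; rewrite inE.
Qed.

(** If [a k <= k^(1/2)], the term is at most [k^(-3/2)]. Otherwise
[a k <= k^(4/3)] bounds it by [k^(-2/3)] for large [k], hence by a multiple of
[ln k / k^(2/3)]. *)
Lemma ratio_sum_bounded (R : realType) (a : nat -> R) : (forall i, 0 <= a i) ->
  (\forall i \near \oo, a i <= i%:R `^ (4 / 3)) ->
  (\sum_(1 <= k <oo | (k%:R `^ (1 / 2) < a k)%R)
             (ln (k%:R : R) / k%:R `^ (2 / 3))%:E < +oo)%E ->
  exists W, forall N, \sum_(1 <= k < N.+1) a k / k%:R ^+ 2 <= W.
Proof.
move=> a0 [k0 _ ak] fin.
pose b k := ln (k%:R : R) / k%:R `^ (2 / 3).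
have b0 k : (1 <= k)%N -> 0 <= b k.
  by move=> k1; rewrite divr_ge0 ?powR_ge0 // ln_ge0 // ler1n.
set S := (X in (X < _)%E) in fin.
have S0 : (0 <= S)%E.
  by apply: nneseries_ge0 => k k1 _; rewrite lee_fin; apply: b0.
have Sfin : S \is a fin_num by rewrite ge0_fin_numE.
have bS N : \sum_(1 <= k < N.+1 | (k%:R `^ (1 / 2) < a k)) b k <= fine S.
  rewrite -lee_fin fineK // -sumEFin.
  apply: (@nneseries_lim_ge R (fun k => (b k)%:E) (fun k => k%:R `^ (1 / 2) < a k) 1 N.+1).
  by move=> k k1 _; rewrite lee_fin; exact: b0.
pose k1 := (k0 + 2)%N.
have l2 : 0 < ln (2 : R) by rewrite ln_gt0 // ltr1n.
exists (\sum_(0 <= k < k1) a k + 3 + (ln 2)^-1 * fine S) => N.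
apply: (@le_trans _ _ (\sum_(1 <= k < N.+1) (if (k < k1)%N then a k else 0)
   + \sum_(1 <= k < N.+1) (k%:R * Num.sqrt k%:R)^-1
   + (ln 2)^-1 * \sum_(1 <= k < N.+1 | (k%:R `^ (1 / 2) < a k)) b k)); last first.
  apply: lerD; last by rewrite ler_wpM2l // invr_ge0 ltW.
  apply: lerD; last exact: sum_inv_32_le.
  apply: (@le_trans _ _ (\sum_(0 <= k < N.+1) (if (k < k1)%N then a k else 0))).
    by apply: sum_nat_sub => // k; case: ifP.
  exact: sum_nat_below.
rewrite [X in _ + _ * X]big_mkcond /= mulr_sumr -!big_split /=.
apply: ler_sum_nat => k /andP[kp _].
have kR : 0 < k%:R :> R by rewrite ltr0n.
have i32 : 0 <= (k%:R * Num.sqrt k%:R)^-1 :> R by rewrite invr_ge0 mulr_ge0 // sqrtr_ge0.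
have bt : 0 <= (ln 2)^-1 * (if k%:R `^ (1 / 2) < a k then b k else 0).
  by rewrite mulr_ge0 ?invr_ge0 ?(ltW l2) //; case: ifP => // _; exact: b0.
case: ltnP => kk.
  have : a k / k%:R ^+ 2 <= a k.
    by rewrite ler_pdivrMr ?exprn_gt0 // ler_peMr // exprn_ege1 // ler1n.
  by move=> h; apply: le_trans h _; rewrite -addrA lerDl addr_ge0.
move: bt; case: ltP => akk bt.
  have h : a k / k%:R ^+ 2 <= (ln 2)^-1 * b k.
    apply: (@le_trans _ _ ((k%:R `^ (2 / 3))^-1)).
      rewrite ler_pdivrMr ?exprn_gt0 // mulrC ler_pdivlMr ?powR_gt0 //.
      have -> : k%:R ^+ 2 = k%:R `^ (4 / 3) * k%:R `^ (2 / 3) :> R.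
        rewrite -powRD; last by rewrite (gt_eqF kR) implybT.
        by rewrite -powR_mulrn ?(ltW kR) //; congr (_ `^ _); lra.
      by rewrite ler_wpM2r ?powR_ge0 //; apply: ak; rewrite /= (leq_trans _ kk) // leq_addr.
    rewrite /b mulrA -[leLHS]mul1r ler_wpM2r ?invr_ge0 ?powR_ge0 //.
    rewrite mulrC ler_pdivlMr // mul1r ler_ln ?posrE // ler_nat.
    by rewrite (leq_trans _ kk) // leq_addl.
  by apply: le_trans h _; rewrite add0r lerDr.
have h : a k / k%:R ^+ 2 <= (k%:R * Num.sqrt k%:R)^-1.
  have q2 : Num.sqrt k%:R ^+ 2 = k%:R :> R by rewrite sqr_sqrtr // ltW.
  have q0 : 0 < Num.sqrt k%:R :> R by rewrite sqrtr_gt0.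
  move: akk; rewrite mul1r powR12_sqrt ?(ltW kR) // => akk.
  apply: (@le_trans _ _ (Num.sqrt k%:R / k%:R ^+ 2)).
    by rewrite ler_wpM2r // invr_ge0 sqr_ge0.
  rewrite le_eqVlt; apply/orP; left; apply/eqP.
  by move: q2 q0; set q := Num.sqrt _ => <- q0; field; rewrite gt_eqF.
by apply: le_trans h _; rewrite add0r mulr0 addr0.
Qed.

Section khinchinVariance.
Context (R : realType) (T S : R -> R) (D : set R) (E : exchange T S D).
Context (xi : R) (ns : nat -> nat) (Hns : scale_seq T D xi ns).
Context (W : R).
Hypothesis W_bound : forall N, \sum_(1 <= k < N.+1) ratio_seq R ns k / k%:R ^+ 2 <= W.

Lemma scale_index : exists idx, forall m, (0 < m)%N -> (ns (idx m) <= m < ns (idx m).+1)%N.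
Proof.
suff /choice[idx idxP] : forall m, exists s, (0 < m)%N -> (ns s <= m < ns s.+1)%N.
  by exists idx.
move=> m; have [m0|m0] := posnP m; first by exists 0%N; rewrite m0.
by have [|s] := @bracket ns m (ss_lt Hns); [rewrite (ss_0 Hns)|exists s].
Qed.

Context (A : nat -> set R) (al be r : nat -> R).
Hypothesis r_gt0 : forall j, (0 < j)%N -> 0 < r j.
Hypothesis r_mono : forall i j, (0 < i)%N -> (i <= j)%N -> j%:R * r j <= i%:R * r i.
Hypothesis tA : forall j, target (A j) (al j) (be j).
Hypothesis nestA : forall i j, (i <= j)%N -> A j `<=` A i.
Hypothesis A_le : forall j, (0 < j)%N -> be j - al j <= r j.

Local Notation EE i := (\sum_(1 <= j < i.+1) r j).

(** Equidistribution of the [i]-th target is used from [c log s] good scales after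
[i] on, where [s] is the index of the scale of [i]. *)
Lemma khinchin_variance : exists (C : R) (u : nat -> R) (U : R),
  [/\ 0 <= C, forall i, (0 < i)%N -> 0 <= u i,
      forall N, \sum_(1 <= i < N.+1) u i / EE i ^+ 2 <= U &
      forall N, Int (fun x => (\sum_(1 <= j < N.+1)
          (\1_(A j) (iter j T x) - (be j - al j))) ^+ 2) <=
        C * (EE N + \sum_(1 <= i < N.+1) u i)].
Proof.
have [e nsE] := choice (ss_pow Hns).
have e0 : e 0%N = 0%N.
  have := ss_0 Hns; rewrite nsE => /eqP; rewrite -{2}(expn0 2) eqn_exp2l //.
  by move/eqP.
have e_lt s : (e s < e s.+1)%N by have := ss_lt Hns s; rewrite !nsE ltn_exp2l.
have [idx idxP] := scale_index.
have W_bound' n : \sum_(0 <= s < n) (2 ^ (e s.+1 - e s))%:R / s.+1%:R ^+ 2 <= W.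
  apply: le_trans (W_bound n); rewrite big_add1 /=.
  apply: ler_sum => s _; rewrite /ratio_seq /= ler_wpM2r ?invr_ge0 ?sqr_ge0 //.
  by rewrite !nsE expnB ?natf_div ?dvdn_exp2l //; exact: ltnW.
have r1 : 0 <= r 1%N by exact/ltW/r_gt0.
have [C [tau [q [C0 /andP[t0 t1] decay]]]] := discrepancy_decay E Hns r1.
have [c tc] : exists c, tau ^+ c <= 4^-1 by apply: small_power; rewrite t0.
pose lg s := trunc_log 2 s.+1.
pose c' := (3 + c * q.+1)%N.
pose N0 i := ns (idx i + c' * (lg (idx i)).+1).
pose th i := C * tau ^+ (c * (lg (idx i)).+1) / i%:R.
have th0 i : 0 <= th i.
  by rewrite divr_ge0 // mulr_ge0 ?exprn_ge0 // ltW.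
have discr i K x : (0 < i)%N -> (N0 i <= K)%N -> 0 <= x < 1 ->
    `|birk T (A i) (be i - al i) K x| <= K%:R * th i.
  move=> i0 NK x01; apply: (decay _ _ _ (idx i)) => //.
  - by rewrite i0; have /andP[_ /ltnW] := idxP i i0.
  - apply: le_trans (A_le i0) _; rewrite ler_pdivlMr ?ltr0n // mulrC.
    by have := @r_mono 1%N i isT i0; rewrite mul1r.
  - apply: leq_trans NK; apply: (ns_mono Hns).
    by rewrite -!addnA leq_add2l /c'; nia.
have [U UE] := @sum_error_le R ns e idx nsE e0 e_lt idxP W W_bound' c' r isT r_gt0 r_mono.
exists (7 + 2 * (C * W) + 4 / xi),
  (fun i => r i ^+ 2 * (ns (idx i).+1)%:R + r i * \sum_(0 <= m < N0 i) r (i.+1 + m)%N), U.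
split.
- have W0 : 0 <= W by apply: le_trans (W_bound 0); rewrite big_geq.
  by rewrite !addr_ge0 ?mulr_ge0 ?invr_ge0 // ?(ltW C0) // ltW // (ss_xi Hns).
- move=> i i0; have ri := ltW (r_gt0 i0).
  rewrite addr_ge0 // mulr_ge0 ?sqr_ge0 //.
  by apply: sumr_ge0 => m _; rewrite ltW ?r_gt0.
- exact: UE.
- move=> N; apply: (@variance_bound R T S D E xi ns Hns A al be
      (fun j => be j - al j) (fun=> erefl) tA nestA idx N0 th idxP th0 discr r (C * W) A_le).
  exact: (sum_decay_le nsE e0 e_lt idxP W_bound' (ltW C0) t0 tc).
Qed.

End khinchinVariance.

(** * From the variance to almost sure convergence *)

(** Between two consecutive times of a sequence along which [E] grows by a factor
close to 1, monotonicity of [S] confines the ratio. *)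
Lemma ratio_cvg (R : realType) (S E : nat -> R) (b : R) : 0 <= b ->
  (forall N, S N <= S N.+1) -> 0 <= S 0%N ->
  (forall N, E N <= E N.+1) -> 0 < E 1%N -> E @ \oo --> +oo ->
  (forall m : nat, exists f : nat -> nat, [/\ (0 < f 0)%N, forall k, (f k < f k.+1)%N,
     forall k, E (f k.+1) <= (1 + m.+1%:R^-1) * E (f k) + b &
     (fun k => S (f k) / E (f k)) @ \oo --> (1 : R)]) ->
  (fun N => S N / E N) @ \oo --> (1 : R).
Proof.
move=> b0 SS S0 ES E1 Eoo sub; apply/cvgrPdist_le => eps eps0.
have Smono := homo_leq (@lexx _ R) le_trans SS.
have Emono := homo_leq (@lexx _ R) le_trans ES.
have Spos N : 0 <= S N by apply: le_trans S0 (Smono _ _ (leq0n N)).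
have Epos N : (0 < N)%N -> 0 < E N by move=> N0; apply: lt_le_trans E1 (Emono _ _ N0).
pose m := Num.truncn (5 / eps).
pose dl : R := m.+1%:R^-1.
have dl0 : 0 < dl by rewrite invr_gt0.
have dl1 : dl <= 1 by rewrite invf_le1 // ler1n.
have dle : 5 * dl <= eps.
  rewrite ler_pdivrMr // -ler_pdivrMl // mulrC; exact: ltW (truncnS_gt _).
have [f [f0 fS fE fcvg]] := sub m.
have [K1 _ hK1] := (iffLR (cvgrPdist_le _ _) fcvg) dl dl0.
have [K2 _ hK2] := (iffLR (cvgryPge _) Eoo) (b / dl).
exists (f (maxn K1 K2)) => // N /= fN.
have [k /andP[fk kf]] : exists k, (f k <= N < f k.+1)%N.
  by apply: bracket => //; apply: leq_trans fN; exact: nat_seq_mono.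
have kK : (maxn K1 K2 <= k)%N.
  rewrite leqNgt; apply/negP => h; have := nat_seq_mono fS h.
  by move=> h'; have := leq_trans (leq_ltn_trans fN kf) h'; rewrite ltnn.
have fkk j : (j <= f j)%N by elim: j => [|j ih] //; exact: leq_ltn_trans (fS j).
have fk0 : (0 < f k)%N by apply: leq_trans f0 _; exact: nat_seq_mono.
have N0 : (0 < N)%N by exact: leq_trans fk.
have Ek := Epos _ fk0; have EN := Epos _ N0.
have Ek1 : 0 < E (f k.+1) by apply: Epos; exact: ltn_trans (fS k).
have h0 := hK1 k (leq_trans (leq_maxl _ _) kK).
have h1 := hK1 k.+1 (leqW (leq_trans (leq_maxl _ _) kK)).
have h2 : b / dl <= E (f k).
  by apply: hK2 => /=; apply: leq_trans (leq_maxr _ _) (leq_trans kK (fkk k)).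
have bE : E (f k.+1) <= (1 + 2 * dl) * E (f k).
  apply: le_trans (fE k) _; rewrite -/dl.
  move: h2; rewrite ler_pdivrMr // => h2; lra.
move: h0 h1; rewrite /= !ler_distl => /andP[_ l0] /andP[u1 _].
have {}l0 : (1 - dl) * E (f k) <= S (f k).
  by rewrite -ler_pdivlMr // lerBlDr.
have {}u1 : S (f k.+1) <= (1 + dl) * E (f k.+1).
  by rewrite -ler_pdivrMr // -lerBlDr.
have s1 := Smono _ _ fk; have s2 := Smono _ _ (ltnW kf).
have e1 := Emono _ _ fk; have e2 := Emono _ _ (ltnW kf).
have up : S N <= (1 + 5 * dl) * E N.
  apply: le_trans s2 (le_trans u1 _).
  apply: (@le_trans _ _ ((1 + dl) * ((1 + 2 * dl) * E (f k)))).
    by apply: ler_wpM2l => //; lra.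
  rewrite mulrA; apply: ler_pM => //; [nra|exact: ltW|nra].
have lo : (1 - 5 * dl) * E N <= S N.
  have [neg|pos] := leP (1 - 5 * dl) 0.
    by apply: le_trans (Spos N); apply: mulr_le0_ge0 => //; exact: ltW.
  apply: le_trans s1; apply: le_trans l0.
  apply: (@le_trans _ _ ((1 - 5 * dl) * ((1 + 2 * dl) * E (f k)))).
    by apply: ler_wpM2l; [exact: ltW|exact: le_trans e2 bE].
  by rewrite mulrA ler_wpM2r ?(ltW Ek) //; nra.
apply/andP; split.
  have : S N / E N <= 1 + 5 * dl by rewrite ler_pdivrMr.
  lra.
have : 1 - 5 * dl <= S N / E N by rewrite ler_pdivlMr.
lra.
Qed.

(** By induction, [(1 - q)] times the sum of the first [n] terms plus [y n] is at most
[y 0 + \sum_(k < n) w k]. *)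
Lemma recursion_sum_le (R : realType) (q : R) (y w : nat -> R) n : 0 <= q < 1 ->
  (forall k, 0 <= y k) -> (forall k, y k.+1 <= q * y k + w k) ->
  \sum_(0 <= k < n) y k <= (y 0%N + \sum_(0 <= k < n) w k) / (1 - q).
Proof.
move=> /andP[q0 q1] y0 yw; have q1' : 0 < 1 - q by lra.
rewrite ler_pdivlMr //.
suff : (\sum_(0 <= k < n) y k) * (1 - q) + y n <= y 0%N + \sum_(0 <= k < n) w k.
  by have := y0 n; lra.
elim: n => [|n ih]; first by rewrite !big_geq //; lra.
by rewrite !big_nat_recr //= mulrDl; have := yw n; lra.
Qed.

Section almostSure.
Context (R : realType).
Notation mu := (@lebesgue_measure R).

Lemma Int_summable_ae (Z : nat -> R -> R) B : (forall k, bmeas (Z k)) ->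
  (forall k x, 0 <= Z k x) -> (forall n, \sum_(0 <= k < n) Int (Z k) <= B) ->
  {ae mu, forall x : R, 0 <= x < 1 -> (fun k => Z k x) @ \oo --> (0 : R)}.
Proof.
move=> bZ Z0 ZB.
have mZ k : measurable_fun (`[0%R, 1%R[%classic : set R) (EFin \o Z k).
  by apply: measurable_funTS; apply/measurable_EFinP; case: (bZ k).
have EI k : (\int[mu]_(x in `[0%R, 1%R[) (Z k x)%:E = (Int (Z k))%:E)%E.
  rewrite /Int /Rintegral fineK //; apply: integrable_fin_num => //.
  exact: bmeas_integrable.
pose G x := (\sum_(0 <= k <oo) (Z k x)%:E)%E.
have G0 x : (0 <= G x)%E by apply: nneseries_ge0 => k _ _; rewrite lee_fin.
have iG : mu.-integrable `[0%R, 1%R[%classic G.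
  apply/integrableP; split.
    apply: (@ge0_emeasurable_sum _ _ _ _ _ predT) => k; last by move=> _; exact: mZ.
    by move=> x _ _; rewrite lee_fin.
  under eq_integral do rewrite gee0_abs //.
  rewrite integral_nneseries //; last by move=> k x _; rewrite lee_fin.
  under eq_eseriesr do rewrite EI.
  apply: (@le_lt_trans _ _ B%:E); last exact: ltry.
  apply: lime_le.
    apply: is_cvg_nneseries => k _ _; rewrite lee_fin.
    by apply: Int_ge0 => x _.
  by apply: nearW => n; rewrite sumEFin lee_fin.
have : {ae mu, forall x, (`[0%R, 1%R[%classic : set R) x -> G x \is a fin_num}.
  by apply: (integrable_ae _ iG); exact: measurable_itv.
apply: filterS; first exact: (ae_filter_ringOfSetsType mu).
move=> x h x01.
have Gx : G x \is a fin_num by apply: h; rewrite /= in_itv.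
suff : cvgn (series (fun k => Z k x)) by exact: cvg_series_cvg_0.
apply: (@nondecreasing_is_cvgn R).
  by apply: nondecreasing_series => k _ _.
exists (fine (G x)) => _ [n _ <-]; rewrite -lee_fin fineK // /series /= -sumEFin.
by apply: nneseries_lim_ge => k _ _; rewrite lee_fin.
Qed.

End almostSure.

Lemma geometric_times (R : realType) (E : nat -> R) (b rho : R) :
  (forall N, E N <= E N.+1) -> 0 < E 1%N -> E @ \oo --> +oo ->
  (forall N, E N.+1 <= E N + b) -> 1 < rho ->
  exists f : nat -> nat, [/\ f 0%N = 1%N, forall k, (f k < f k.+1)%N,
    forall k, rho * E (f k) <= E (f k.+1) & forall k, E (f k.+1) <= rho * E (f k) + b].
Proof.
move=> ES E1 Eoo Eb rho1.
have Emono := homo_leq (@lexx _ R) le_trans ES.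
have next N : exists M, rho * E N <= E M /\ forall M', (M' < M)%N -> E M' < rho * E N.
  have ex : exists M, rho * E N <= E M.
    have [K _ hK] := (iffLR (cvgryPge _) Eoo) (rho * E N).
    by exists K; exact: (hK K (leqnn K)).
  have := find_ex_minn ex; case=> M EM Mmin; exists M; split => // M' M'M.
  by rewrite ltNge; apply/negP => /Mmin; rewrite leqNgt M'M.
have [g gP] := choice next.
pose f k := iter k g 1%N.
have gt N : (0 < N)%N -> (N < g N)%N.
  move=> N0; rewrite ltnNge; apply/negP => /Emono gN.
  have [h _] := gP N; have EN : 0 < E N by exact: lt_le_trans (Emono _ _ N0).
  have := le_trans h gN; apply/negP; rewrite -ltNge; nra.
have f0 k : (0 < f k)%N.
  by elim: k => [|k ih] //; apply: leq_trans (gt _ ih).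
exists f; split => //.
- by move=> k; exact: gt.
- by move=> k; have [] := gP (f k).
- move=> k; have [_ h] := gP (f k); rewrite /f iterS -/(f k).
  have gp : (0 < g (f k))%N by exact: leq_trans (gt _ (f0 k)).
  move: h; rewrite -(prednK gp) => /(_ _ (ltnSn _)) h.
  by apply: le_trans (Eb _) _; rewrite lerD2r ltW.
Qed.

Section strongLaw.
Context (R : realType).
Notation mu := (@lebesgue_measure R).
Context (F : nat -> R -> R) (a r u : nat -> R) (C c U : R).
Hypothesis bF : forall j, bmeas (F j).
Hypothesis F0 : forall j x, 0 <= F j x.
Hypothesis r_gt0 : forall j, (0 < j)%N -> 0 < r j.
Hypothesis r_le : forall j, (0 < j)%N -> r j <= r 1%N.
Hypothesis r_oo : (fun N => \sum_(1 <= j < N.+1) r j) @ \oo --> +oo.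
Hypothesis u0 : forall j, (0 < j)%N -> 0 <= u j.
Hypothesis C0 : 0 <= C.

Local Notation EE N := (\sum_(1 <= j < N.+1) r j).

Hypothesis mean : forall N, `|\sum_(1 <= j < N.+1) a j - EE N| <= c.
Hypothesis uU : forall N, \sum_(1 <= i < N.+1) u i / EE i ^+ 2 <= U.
Hypothesis variance : forall N, Int (fun x => (\sum_(1 <= j < N.+1) (F j x - a j)) ^+ 2) <=
  C * (EE N + \sum_(1 <= i < N.+1) u i).

Let ES N : EE N <= EE N.+1.
Proof. by rewrite [leRHS]big_nat_recr //= lerDl ltW // r_gt0. Qed.

Let E1 : 0 < EE 1. Proof. by rewrite big_nat1 r_gt0. Qed.

Let Emono i j : (i <= j)%N -> EE i <= EE j.
Proof. exact: (homo_leq (@lexx _ R) le_trans ES). Qed.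

Let Epos N : (0 < N)%N -> 0 < EE N.
Proof. by move=> N0; apply: lt_le_trans E1 (Emono N0). Qed.

Let Eb N : EE N.+1 <= EE N + r 1%N.
Proof. by rewrite [leLHS]big_nat_recr //= lerD2l; exact: r_le. Qed.

(* With [y k] the bound on the normalized variance at the time [f k] up to the
   factor [C], the geometric growth of [E] yields a linear recursion for [y], with
   ratio [rho^-1] and with an error that is a block of the convergent series of the
   [u i / E_i^2]. *)
Let deviation_summable (f : nat -> nat) rho : 1 < rho -> f 0%N = 1%N ->
  (forall k, (f k < f k.+1)%N) -> (forall k, rho * EE (f k) <= EE (f k.+1)) ->
  exists B, forall n, \sum_(0 <= k < n)
    Int (fun x => (EE (f k) ^+ 2)^-1 * (\sum_(1 <= j < (f k).+1) (F j x - a j)) ^+ 2) <= B.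
Proof.
move=> rho1 f0 fS fE.
have fp k : (0 < f k)%N by apply: leq_trans (nat_seq_mono fS (leq0n k)); rewrite f0.
have Ef k : 0 < EE (f k) by exact: Epos.
have rho0 : 0 < rho by lra.
pose V k := \sum_(1 <= i < (f k).+1) u i.
have V0 k : 0 <= V k.
  by rewrite /V big_nat_cond; apply: sumr_ge0 => i /andP[/andP[i1 _] _]; exact: u0.
pose y k := (EE (f k))^-1 + V k / EE (f k) ^+ 2.
pose w k := \sum_((f k).+1 <= i < (f k.+1).+1) u i / EE i ^+ 2.
have y0 k : 0 <= y k by rewrite addr_ge0 ?divr_ge0 ?invr_ge0 ?sqr_ge0 // ltW.
have q01 : 0 <= rho^-1 < 1 by rewrite invr_ge0 (ltW rho0) /= invf_lt1.
have yw k : y k.+1 <= rho^-1 * y k + w k.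
  have e1 : (EE (f k.+1))^-1 <= rho^-1 * (EE (f k))^-1.
    by rewrite -invfM lef_pV2 ?posrE ?mulr_gt0.
  have e2 : (EE (f k.+1) ^+ 2)^-1 <= rho^-1 * (EE (f k) ^+ 2)^-1.
    rewrite -invfM lef_pV2 ?posrE ?mulr_gt0 ?exprn_gt0 //.
    have Ek := ltW (Ef k); rewrite !expr2 mulrA; apply: ler_pM => //.
      by rewrite mulr_ge0 // ltW.
    exact: Emono (ltnW (fS k)).
  have -> : y k.+1 = (EE (f k.+1))^-1 + (V k * (EE (f k.+1) ^+ 2)^-1 +
      \sum_((f k).+1 <= i < (f k.+1).+1) u i / EE (f k.+1) ^+ 2).
    rewrite /y -mulr_suml -mulrDl /V -big_cat_nat //=; exact: ltnW (fS k).
  have e3 : V k * (EE (f k.+1) ^+ 2)^-1 <= rho^-1 * (V k / EE (f k) ^+ 2).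
    by rewrite [leRHS]mulrCA ler_wpM2l.
  have e4 : \sum_((f k).+1 <= i < (f k.+1).+1) u i / EE (f k.+1) ^+ 2 <= w k.
    apply: ler_sum_nat => i /andP[fi i1].
    have i0 : (0 < i)%N by exact: leq_trans fi.
    apply: ler_wpM2l; first exact: u0.
    have Ei := Epos i0; have Ek := Ef k.+1.
    rewrite lef_pV2 ?posrE ?exprn_gt0 // lerXn2r ?nnegrE ?(ltW Ei) ?(ltW Ek) //.
    exact: Emono.
  rewrite /y mulrDr; lra.
have wU n : V 0%N / EE (f 0%N) ^+ 2 + \sum_(0 <= k < n) w k =
    \sum_(1 <= i < (f n).+1) u i / EE i ^+ 2.
  elim: n => [|n ih]; first by rewrite [X in _ + X]big_geq // addr0 /V f0 !big_nat1.
  rewrite [X in _ + X]big_nat_recr //= addrA ih [RHS](big_cat_nat (n := (f n).+1)) //=.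
  exact: ltnW (fS n).
exists (C * (((EE 1)^-1 + U) / (1 - rho^-1))) => n.
have bS N : bmeas (fun x => (\sum_(1 <= j < N.+1) (F j x - a j)) ^+ 2).
  by apply: bmeasX; apply: bmeas_sum => j; apply: bmeasB => //; exact: bmeas_cst.
apply: (@le_trans _ _ (C * \sum_(0 <= k < n) y k)).
  rewrite mulr_sumr; apply: ler_sum => k _; rewrite IntZ //.
  rewrite mulrC ler_pdivrMr ?exprn_gt0 //; apply: le_trans (variance _) _.
  rewrite -mulrA ler_wpM2l // /y le_eqVlt; apply/orP; left; apply/eqP.
  rewrite -/(V k); set z := EE (f k); field; rewrite gt_eqF //; exact: Ef.
apply: ler_wpM2l => //; apply: le_trans (recursion_sum_le n q01 y0 yw) _.
rewrite ler_wpM2r //; first by case/andP: q01 => _ h; rewrite invr_ge0; lra.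
by have := wU n; rewrite f0 => h; rewrite /y f0 -addrA lerD2l h.
Qed.

Lemma strong_law :
  {ae mu, forall x : R, 0 <= x < 1 ->
    (fun N => (\sum_(1 <= j < N.+1) F j x) / EE N) @ \oo --> (1 : R)}.
Proof.
have rho1 (m : nat) : 1 < 1 + m.+1%:R^-1 :> R by rewrite ltrDl invr_gt0.
have [f fP] := choice (fun m => geometric_times ES E1 r_oo Eb (rho1 m)).
pose Z m k x := (EE (f m k) ^+ 2)^-1 * (\sum_(1 <= j < (f m k).+1) (F j x - a j)) ^+ 2.
have aeZ m : {ae mu, forall x : R, 0 <= x < 1 -> (fun k => Z m k x) @ \oo --> (0 : R)}.
  have [f0 fS fE _] := fP m.
  have [B HB] := deviation_summable (rho1 m) f0 fS fE.
  apply: (Int_summable_ae (B := B)) => //.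
    move=> k; apply: bmeasZ; apply: bmeasX; apply: bmeas_sum => j.
    by apply: bmeasB => //; exact: bmeas_cst.
  by move=> k x; rewrite mulr_ge0 ?invr_ge0 ?sqr_ge0.
have : {ae mu, forall x : R, forall m, 0 <= x < 1 -> (fun k => Z m k x) @ \oo --> (0 : R)}.
  exact: ae_foralln.
apply: filterS; first exact: (ae_filter_ringOfSetsType mu).
move=> x Zx x01.
have c0 : 0 <= c by apply: le_trans (mean 0).
apply: (ratio_cvg (ltW (r_gt0 (ltnSn 0))) _ _ ES E1 r_oo).
- by move=> N; rewrite [leRHS]big_nat_recr //= lerDl.
- by rewrite big_geq.
move=> m; have [f0 fS fE fb] := fP m; exists (f m); split => //; first by rewrite f0.
have fp k : (0 < f m k)%N by apply: leq_trans (nat_seq_mono fS (leq0n k)); rewrite f0.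
have fk k : (k <= f m k)%N by elim: k => [|k ih] //; exact: leq_ltn_trans (fS k).
apply/cvgrPdist_le => eps eps0.
have e2 : 0 < (eps / 2) ^+ 2 by rewrite exprn_gt0 // divr_gt0.
have [K1 _ h1] := (iffLR (cvgrPdist_le _ _) (Zx m x01)) _ e2.
have [K2 _ h2] := (iffLR (cvgryPge _) r_oo) (2 * c / eps).
exists (maxn K1 K2) => // k /=; rewrite geq_max => /andP[k1 k2].
have := h1 k k1; rewrite /= sub0r normrN => {}h1.
have {}h2 : 2 * c / eps <= EE (f m k) by apply: h2; exact: leq_trans (fk k).
have Ep : 0 < EE (f m k) by exact: Epos.
set z := EE (f m k) in h1 h2 Ep *.
set s := \sum_(1 <= j < (f m k).+1) F j x.
set t := \sum_(1 <= j < (f m k).+1) a j.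
have st : \sum_(1 <= j < (f m k).+1) (F j x - a j) = s - t by rewrite sumrB.
have d1 : `|(s - t) / z| <= eps / 2.
  have e0 : 0 <= eps / 2 by rewrite divr_ge0 // ltW.
  rewrite -(@ler_pXn2r _ 2) ?nnegrE // -normrX expr_div_n mulrC.
  by move: h1; rewrite /Z st -/z.
have d2 : `|(t - z) / z| <= eps / 2.
  rewrite normrM normfV (gtr0_norm Ep) ler_pdivrMr //.
  apply: le_trans (mean _) _; move: h2; rewrite ler_pdivrMr //; lra.
have -> : 1 - s / z = - ((s - t) / z + (t - z) / z) by field; rewrite gt_eqF.
rewrite normrN; apply: le_trans (ler_normD _ _) _; lra.
Qed.

End strongLaw.

(** * Shrinking targets *)

Section khinchin.
Context (R : realType) (r : nat -> R) (kr : khinchin_seq r).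

(** A nonpositive term would make all later ones nonpositive, and the series would
be bounded above. *)
Lemma khinchin_gt0 j : (0 < j)%N -> 0 < r j.
Proof.
have [mono oo] := kr; move=> j0; rewrite ltNge; apply/negP => rj.
have neg i : (j <= i)%N -> r i <= 0.
  move=> ji; have i0 : 0 < i%:R :> R by rewrite ltr0n (leq_trans j0).
  rewrite -(pmulr_rle0 _ i0); apply: le_trans (mono _ _ j0 ji) _.
  by rewrite mulr_ge0_le0.
have [K _ hK] := (iffLR (cvgryPgt _) oo) (\sum_(1 <= i < j) r i).
have := hK (maxn K j) (leq_maxl _ _); rewrite /= [ltRHS](big_cat_nat (n := j)) ?leqW ?leq_maxr //=.
rewrite ltrDl; apply/negP; rewrite -leNgt big_nat_cond.
by apply: sumr_le0 => i /andP[/andP[ji _] _]; exact: neg.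
Qed.

Lemma khinchin_le i j : (0 < i)%N -> (i <= j)%N -> r j <= r i.
Proof.
have [mono _] := kr; move=> i0 ij; have j0 : 0 < j%:R :> R by rewrite ltr0n (leq_trans i0).
rewrite -(ler_pM2l j0); apply: le_trans (mono _ _ i0 ij) _.
by rewrite ler_wpM2r ?ler_nat // ltW // khinchin_gt0.
Qed.

Lemma khinchin_small e : 0 < e -> exists2 j0, (0 < j0)%N & forall j, (j0 <= j)%N -> r j <= e.
Proof.
have [mono _] := kr; move=> e0; exists (Num.truncn (r 1%N / e)).+1 => // j hj.
have j1 : (0 < j)%N by exact: leq_trans hj.
have jR : 0 < j%:R :> R by rewrite ltr0n.
rewrite -(ler_pM2l jR); apply: le_trans (mono 1%N j isT j1) _.
rewrite mul1r -ler_pdivrMr //; apply: le_trans (ltW (truncnS_gt _)) _.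
by rewrite ler_nat.
Qed.

End khinchin.

Section nestedTargets.
Context (R : realType) (T S : R -> R) (D : set R) (E : exchange T S D).
Context (xi : R) (ns : nat -> nat) (Hns : scale_seq T D xi ns) (W : R).
Hypothesis W_bound : forall N, \sum_(1 <= k < N.+1) ratio_seq R ns k / k%:R ^+ 2 <= W.
Context (r : nat -> R) (kr : khinchin_seq r).

(** Replacing the first targets by the one of index [j0] changes the sums by a
bounded amount only. *)
Lemma nested_targets_law (B : nat -> set R) (al be : nat -> R) (j0 : nat) : (0 < j0)%N ->
  (forall j, (j0 <= j)%N -> target (B j) (al j) (be j)) ->
  (forall j, (j0 <= j)%N -> be j - al j = r j) ->
  (forall i j, (j0 <= i)%N -> (i <= j)%N -> B j `<=` B i) ->
  {ae (@lebesgue_measure R), forall x : R, 0 <= x < 1 ->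
    (fun N => (\sum_(1 <= j < N.+1) \1_(B (maxn j j0)) (iter j T x))
      / (\sum_(1 <= j < N.+1) r j)) @ \oo --> (1 : R)}.
Proof.
move=> j00 tB rB nB; have [mono oo] := kr.
have rp := khinchin_gt0 kr.
pose A j := B (maxn j j0); pose al' j := al (maxn j j0); pose be' j := be (maxn j j0).
have tA j : target (A j) (al' j) (be' j) by apply: tB; exact: leq_maxr.
have nA i j : (i <= j)%N -> A j `<=` A i.
  move=> ij; apply: nB; first exact: leq_maxr.
  by rewrite geq_max leq_maxr andbT (leq_trans ij) // leq_maxl.
have lA j : be' j - al' j = r (maxn j j0) by apply: rB; exact: leq_maxr.
have Ale j : (0 < j)%N -> be' j - al' j <= r j.
  by move=> jp; rewrite lA; apply: khinchin_le => //; exact: leq_maxl.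
have [C [u [U [C0 u0 uU var]]]] :=
  khinchin_variance E Hns W_bound rp mono tA nA Ale.
apply: (strong_law (F := fun j x => \1_(A j) (iter j T x)) (a := fun j => be' j - al' j)
  (c := \sum_(1 <= j < j0) r j) _ _ rp _ oo u0 C0 _ uU var).
- by move=> j; apply: (bmeas_iter E j); apply: bmeas_indic; exact: (tg_m (tA j)).
- by move=> j x; rewrite indicE.
- by move=> j jp; exact: khinchin_le.
- move=> N; rewrite -sumrB; apply: le_trans (ler_norm_sum _ _ _) _.
  apply: (@le_trans _ _ (\sum_(1 <= j < N.+1) (if (j < j0)%N then r j else 0))).
    apply: ler_sum_nat => j /andP[jp _]; rewrite lA; case: ltnP => jj.
      have := khinchin_le kr jp (ltnW jj); have := rp _ j00; have := rp _ jp.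
      by move=> *; rewrite ler0_norm ?subr_le0 //; lra.
    by rewrite subrr normr0.
  by apply: sum_nat_below => j jp; exact/ltW/rp.
Qed.

End nestedTargets.

Lemma int_between (m : int) : -1 < m -> m < 2 -> m = 0 \/ m = 1.
Proof. by lia. Qed.

(** For [a = 0] the left half of the ball lies at the other end of the unit
interval, below [a' = 1]. *)
Lemma circle_ball_halves (R : realType) (a a' r y : R) :
  0 <= a < 1 -> a' = (if a == 0 then 1 else a) -> r <= 1 - a -> r <= a' -> r <= 2^-1 ->
  0 <= y < 1 ->
  \1_(circle_ball a r) y = \1_(`[a, a + r[%classic) y + \1_(`]a' - r, a'[%classic) y :> R.
Proof.
move=> /andP[a0 a1] a'E ra ra' r2 /andP[y0 y1]; rewrite !indicE.
have memP (P : set R) (b : bool) : (P y <-> b) -> (y \in P) = b.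
  move=> h; apply/idP/idP; first by rewrite inE => /h.
  by move=> /h; rewrite inE.
have hH : (y \in (`[a, a + r[%classic : set R)) = (a <= y < a + r).
  by apply: memP; rewrite /= in_itv.
have hL : (y \in (`]a' - r, a'[%classic : set R)) = (a' - r < y < a').
  by apply: memP; rewrite /= in_itv.
have hB : (y \in circle_ball a r) = (a <= y < a + r) || (a' - r < y < a').
  apply: memP; split.
    case=> m; rewrite ltr_norml => /andP[m1 m2].
    have mlt : (m < 2)%R by rewrite -(ltr_int R); move: a'E; case: eqP => h1 h2; lra.
    have mgt : (- 1 < m)%R by rewrite -(ltr_int R); move: a'E; case: eqP => h1 h2; lra.
    have [m0|m0] := int_between mgt mlt.
      move: m1 m2; rewrite m0 subr0 => m1 m2.
      have [ya|ya] := leP a y; first by apply/orP; left; lra.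
      apply/orP; right; move: a'E ra'; case: eqP => [h1|_] -> ra'; first lra.
      by apply/andP; split => //; lra.
    move: m1 m2; rewrite m0 => m1 m2.
    apply/orP; right; move: a'E ra'; case: eqP => h1 -> ra'; last lra.
    by apply/andP; split => //; lra.
  case/orP => /andP[h1 h2].
    by exists 0; rewrite subr0 ltr_norml; apply/andP; split; lra.
  move: a'E ra' h1 h2; case: eqP => h -> ra' h1 h2.
    by exists 1; rewrite ltr_norml; apply/andP; split; lra.
  by exists 0; rewrite subr0 ltr_norml; apply/andP; split; lra.
rewrite hH hL hB.
case: (boolP (a <= y < a + r)) => [/andP[h1 h2]|_]; last by rewrite orFb add0r.
case: (boolP (a' - r < y < a')) => [/andP[h3 h4]|_]; last by rewrite addr0.
move: a'E ra' h3 h4; case: eqP => h -> ra' h3 h4; lra.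
Qed.

Lemma bool_excess_le (R : realType) (b1 b2 b3 : bool) : `|b1%:R + b2%:R - b3%:R| <= 2 :> R.
Proof. by case: b1; case: b2; case: b3; rewrite /= ler_norml; lra. Qed.

Theorem theorem2p3 (R : realType) (d : nat) (l : 'I_d -> R) (pi : 'S_d)
  (l_ge0 : forall i, 0 <= l i) (l_sum1 : \sum_(i < d) l i = 1)
  (keane_T : keane l pi)
  (hyp : forall eps : R, 0 < eps ->
    exists (xi C : R) (n : nat -> nat),
      let a := ratio_seq R n in
      [/\ 0 < xi,
          is_nseq l pi xi n,
          (\forall i \near \oo, a i <= i%:R `^ (4 / 3)),
          (limn_esup (fun N : nat =>
             ((N%:R : R)^-1 * (\sum_(1 <= i < N.+1) ln (a i)
                         - \sum_(1 <= i < N.+1 | a i < C) ln (a i)))%:E)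
           < eps%:E)%E
        & (\sum_(1 <= k <oo | (k%:R `^ (1 / 2) < a k)%R)
             (ln (k%:R : R) / k%:R `^ (2 / 3))%:E < +oo)%E])
  (r : nat -> R) (khinchin_r : khinchin_seq r)
  (a : R) (a01 : 0 <= a < 1) :
  {ae (@lebesgue_measure R), forall x : R, 0 <= x < 1 ->
    (fun N : nat =>
       (\sum_(1 <= j < N.+1) \1_(circle_ball a (r j)) (iter j (iet l pi) x))
       / (\sum_(1 <= j < N.+1) 2 * r j)) @ \oo --> (1 : R)}.
Proof.
have [xi [_ [n [xi0 nseq a43 _ bad]]]] := hyp 1 ltr01.
have Hns := scale_seq_of_is_nseq xi0 nseq.
have ratio0 i : 0 <= ratio_seq R n i by rewrite divr_ge0.
have [W W_bound] := ratio_sum_bounded ratio0 a43 bad.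
have E := exchange_iet l_ge0 l_sum1 keane_T.
have /andP[a0 a1] := a01.
pose a' := if a == 0 then 1 else a.
have a'0 : 0 < a' by rewrite /a'; case: eqP => // /eqP h; rewrite lt_def h.
have a'1 : a' <= 1 by rewrite /a'; case: eqP => // _; exact: ltW.
pose e := Num.min (Num.min (1 - a) a') 2^-1.
have e0 : 0 < e by rewrite !lt_min subr_gt0 a1 a'0 invr_gt0 ltr0n.
have [j0 j00 small] := khinchin_small khinchin_r e0.
have {}small j : (j0 <= j)%N -> [/\ r j <= 1 - a, r j <= a' & r j <= 2^-1].
  by move=> /small; rewrite !le_min => /andP[/andP[]].
have rpos j : (j0 <= j)%N -> 0 < r j.
  by move=> jj; apply: (khinchin_gt0 khinchin_r); exact: leq_trans jj.
have rmono i j : (j0 <= i)%N -> (i <= j)%N -> r j <= r i.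
  by move=> ji; apply: (khinchin_le khinchin_r); exact: leq_trans ji.
pose H j : set R := `[a, a + r j[%classic.
pose L j : set R := `]a' - r j, a'[%classic.
have lawH := nested_targets_law (B := H) (al := fun=> a) (be := fun j => a + r j)
  E Hns W_bound khinchin_r j00.
have lawL := nested_targets_law (B := L) (al := fun j => a' - r j) (be := fun=> a')
  E Hns W_bound khinchin_r j00.
have {}lawH : {ae (@lebesgue_measure R), forall x : R, 0 <= x < 1 ->
    (fun N => (\sum_(1 <= j < N.+1) \1_(H (maxn j j0)) (iter j (iet l pi) x))
      / (\sum_(1 <= j < N.+1) r j)) @ \oo --> (1 : R)}.
  apply: lawH.
  - move=> j jj; have [h _ _] := small j jj; have rj := rpos j jj.
    by apply: target_itv => //; lra.
  - by move=> j _; rewrite addrAC subrr add0r.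
  - move=> i j ji ij z; rewrite /H /= !in_itv /= => /andP[az zr].
    by rewrite az; apply: lt_le_trans zr _; rewrite lerD2l; exact: rmono.
have {}lawL : {ae (@lebesgue_measure R), forall x : R, 0 <= x < 1 ->
    (fun N => (\sum_(1 <= j < N.+1) \1_(L (maxn j j0)) (iter j (iet l pi) x))
      / (\sum_(1 <= j < N.+1) r j)) @ \oo --> (1 : R)}.
  apply: lawL.
  - move=> j jj; have [_ h _] := small j jj; have rj := rpos j jj.
    split => //; [exact: measurable_itv|lra|lra|].
    by move=> z; rewrite /L /= !in_itv /= => /andP[/ltW -> /ltW ->].
  - by move=> j _; rewrite opprB addrC subrK.
  - move=> i j ji ij z; rewrite /L /= !in_itv /= => /andP[az zr].
    by rewrite zr andbT; apply: le_lt_trans az; rewrite lerD2l lerN2; exact: rmono.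
move: lawH lawL; apply: filterS2; first exact: (ae_filter_ringOfSetsType (@lebesgue_measure R)).
move=> x hH hL x01.
have {}hH := hH x01; have {}hL := hL x01.
have rp j : (0 < j)%N -> 0 < r j by exact: (khinchin_gt0 khinchin_r).
have [_ oo] := khinchin_r.
set T := iet l pi in hH hL *.
apply/cvgrPdist_le => eps eps0.
have eps2 : 0 < eps / 2 by rewrite divr_gt0.
have [K1 _ h1] := (iffLR (cvgrPdist_le _ _) hH) _ eps2.
have [K2 _ h2] := (iffLR (cvgrPdist_le _ _) hL) _ eps2.
have [K3 _ h3] := (iffLR (cvgryPge _) oo) (2 * j0%:R / eps).
exists (maxn (maxn K1 K2) K3).+1 => // N /= hN.
have [k1 k2 k3] : [/\ (K1 <= N)%N, (K2 <= N)%N & (K3 <= N)%N].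
  by move: hN; rewrite !gtn_max => /andP[/andP[/ltnW ? /ltnW ?] /ltnW].
have N0 : (0 < N)%N by exact: leq_trans hN.
have {h1}  := h1 N k1; have {h2} := h2 N k2; have {h3} := h3 N k3.
rewrite -mulr_sumr /=; set EE := \sum_(1 <= j < N.+1) r j.
set s1 := \sum_(1 <= j < N.+1) \1_(H _) _; set s2 := \sum_(1 <= j < N.+1) \1_(L _) _.
set s := \sum_(1 <= j < N.+1) _.
move=> h3 h2 h1.
have EE0 : 0 < EE.
  by rewrite /EE big_nat_recl //= ltr_pwDl ?rp // big_nat_cond sumr_ge0 // => j _; rewrite ltW ?rp.
have diff : `|s1 + s2 - s| <= 2 * j0%:R.
  rewrite /s1 /s2 /s -big_split -sumrB /=; apply: le_trans (ler_norm_sum _ _ _) _.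
  apply: (@le_trans _ _ (\sum_(1 <= j < N.+1) (if (j < j0)%N then 2 else 0))).
    apply: ler_sum_nat => j _; case: ltnP => jj.
      by rewrite !indicE bool_excess_le.
    have [q1 q2 q3] := small j jj.
    rewrite (circle_ball_halves a01 (erefl a') q1 q2 q3 (iterT01 E j x01)) subrr normr0 //.
  apply: le_trans (sum_nat_below (F := fun=> 2) _ _ _) _ => //.
  by rewrite sumr_const_nat -(mulr_natr 2) ler_pM2l // ler_nat; exact: leq_subr.
have -> : 1 - s / (2 * EE) = ((1 - s1 / EE) + (1 - s2 / EE) + (s1 + s2 - s) / EE) / 2.
  by field; rewrite gt_eqF.
have d3 : `|(s1 + s2 - s) / EE| <= eps.
  rewrite normrM normfV (gtr0_norm EE0) ler_pdivrMr //; apply: le_trans diff _.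
  by move: h3; rewrite ler_pdivrMr // [eps * _]mulrC.
rewrite normrM (@ger0_norm _ 2^-1) ?invr_ge0 // ler_pdivrMr //.
apply: le_trans (ler_normD _ _) _; apply: le_trans (lerD (ler_normD _ _) d3) _; lra.
Qed.
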